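(* Let $M$ be a lightlike hypersurface of an indefinite statistical manifold $(\overline{M},\overline{g},\overline{\nabla},\overline{\nabla}^{*})$, with screen distribution $S(TM)$, radical distribution $\mathrm{Rad}(TM)$, induced degenerate metric $g$, and induced connections $\nabla$ and $\nabla^{*}$. If $\mathrm{Rad}(TM)$ and $S(TM)$ are parallel with respect to both $\nabla$ and $\nabla^{*}$ and $\nabla$ is a metric connection, then $S(TM)$ is integrable, and on each integral manifold of $S(TM)$ the restrictions of $\nabla^{S}$ and $\nabla^{*S}$ coincide with the Levi--Civita connection of the metric induced by $g$ on that integral manifold.
   Context: $\Gamma(E)$ denotes smooth sections of $E$. An indefinite statistical manifold $(\overline{M},\overline{g},\overline{\nabla},\overline{\nabla}^{*})$ is a semi-Riemannian manifold $(\overline M,\overline g)$ with a torsion-free affine connection $\overline\nabla$ satisfying the Codazzi condition $(\overline{\nabla}_{X}\overline{g})(Y,Z)=(\overline{\nabla}_{Y}\overline{g})(X,Z)$, together with the dual connection $\overline\nabla^{*}$ determined by $X\overline{g}(Y,Z)=\overline{g}(\overline{\nabla}_{X}Y,Z)+\overline{g}(Y,\overline{\nabla}^{*}_{X}Z)$ (which is then also torsion-free). $M$ is a lightlike hypersurface: $M$ has codimension one and the induced metric $g$ is degenerate, so $\mathrm{Rad}(TM)=TM\cap TM^{\perp}=TM^{\perp}$ is a rank-one bundle. A screen distribution $S(TM)$ is a non-degenerate distribution complementary to $\mathrm{Rad}(TM)$ in $TM$; one is fixed. Fix a nowhere-zero section $\xi$ of $\mathrm{Rad}(TM)$ (in general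 it exists only locally, and all objects depending on it are understood on its domain). $N$ is the unique vector field along $M$ with $\overline{g}(N,N)=0$, $\overline{g}(N,\xi)=1$, $\overline{g}(N,W)=0$ for all $W\in\Gamma(S(TM))$; then $T\overline M|_M=TM\oplus\mathrm{span}\{N\}$. For $X,Y\in\Gamma(TM)$ the Gauss formulas $\overline{\nabla}_{X}Y=\nabla_{X}Y+B(X,Y)N$ and $\overline{\nabla}^{*}_{X}Y=\nabla^{*}_{X}Y+B^{*}(X,Y)N$, with $\nabla_XY,\nabla^*_XY\in\Gamma(TM)$, define the induced torsion-free connections $\nabla,\nabla^{*}$. For $X\in\Gamma(TM)$, $W\in\Gamma(S(TM))$ the decompositions $\nabla_{X}W=\nabla^{S}_{X}W+C(X,W)\xi$ and $\nabla^{*}_{X}W=\nabla^{*S}_{X}W+C^{*}(X,W)\xi$, with $\nabla^{S}_{X}W,\nabla^{*S}_XW\in\Gamma(S(TM))$, define the induced connections $\nabla^{S},\nabla^{*S}$ on $S(TM)$. A connection $D$ on $M$ is called a metric connection if $Dg=0$. A distribution $\mathcal D$ on $M$ is parallel with respect to $D$ if $D_XY\in\Gamma(\mathcal D)$ for all $X\in\Gamma(TM)$, $Y\in\Gamma(\mathcal D)$. *)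

(* Defs.v *)
From mathcomp Require Import all_boot all_order all_algebra.
From mathcomp Require Import boolp classical_sets functions reals.
From mathcomp Require Import topology normedtype derive.

Set Implicit Arguments.
Unset Strict Implicit.
Unset Printing Implicit Defensive.

Import Order.TTheory GRing.Theory Num.Theory numFieldNormedType.Exports.

Local Open Scope classical_set_scope.
Local Open Scope ring_scope.

(** * Smooth functions on open subsets of R^n *)

Fixpoint Ck (R : realType) (n k : nat) (A : set 'rV[R]_n)
    (f : 'rV[R]_n -> R) : Prop :=
  if k is k'.+1 then
    (forall x, A x -> differentiable f x) /\ (forall v, Ck k' A ('D_v f))
  else forall x, A x -> {for x, continuous f}.

Definition smooth_Rn (R : realType) (n : nat) (A : set 'rV[R]_n)
    (f : 'rV[R]_n -> R) : Prop :=
  forall k, Ck k A f.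

(** * Smooth manifolds *)

(* [cfun] and [cinv] are total functions, meaningful only on [cdom] and on its
   image respectively. *)
Record chart (R : realType) (n : nat) (T : Type) := Chart {
  cdom : set T;
  cfun : T -> 'rV[R]_n;
  cinv : 'rV[R]_n -> T }.

Definition is_chart (R : realType) (n : nat) (T : topologicalType)
    (c : chart R n T) : Prop :=
  [/\ open (cdom c),
      open (cfun c @` cdom c),
      (forall p, cdom c p -> cinv c (cfun c p) = p),
      (forall p, cdom c p -> {for p, continuous (cfun c)}) &
      (forall x, (cfun c @` cdom c) x -> {for x, continuous (cinv c)})].

(* The atlas need not be maximal; passing to the maximal atlas changes neither
   the smooth functions nor the tangent vectors below. *)
Record manifold (R : realType) (n : nat) := Manifold {
  point_space :> topologicalType;
  atlas : set (chart R n point_space);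
  manifold_hausdorff : hausdorff_space point_space;
  manifold_second_countable : @second_countable point_space;
  atlas_cover : forall p : point_space, exists2 c, atlas c & cdom c p;
  atlas_chart : forall c, atlas c -> is_chart c;
  atlas_smooth : forall c d, atlas c -> atlas d -> forall i : 'I_n,
    smooth_Rn (cfun c @` (cdom c `&` cdom d))
              (fun x => cfun d (cinv c x) ord0 i) }.

Definition smooth_on (R : realType) (n : nat) (M : manifold R n)
    (U : set M) (f : M -> R) : Prop :=
  forall c, atlas c -> smooth_Rn (cfun c @` (cdom c `&` U)) (f \o cinv c).

Definition smooth_at (R : realType) (n : nat) (M : manifold R n)
    (p : M) (f : M -> R) : Prop :=
  exists2 U : set M, open_nbhs p U & smooth_on U f.

Definition smooth_map (R : realType) (m n : nat) (M : manifold R m)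
    (N : manifold R n) (F : M -> N) : Prop :=
  continuous F /\
  forall (V : set N) (f : N -> R), open V -> smooth_on V f ->
    smooth_on (F @^-1` V) (f \o F).

(** * Tangent vectors *)

(* A tangent vector at p is a directional derivative at p, acting on functions
   that are smooth near p.  By convention it vanishes on all other functions,
   so that Leibniz equality, sums and scalar multiples in the function space
   [tvec M] are those of T_pM. *)
Definition tvec (R : realType) (n : nat) (M : manifold R n) : Type :=
  (M -> R) -> R^o.

Definition coord_vec (R : realType) (n : nat) (M : manifold R n)
    (c : chart R n M) (p : M) (a : 'rV[R]_n) : tvec M :=
  fun f => if `[< smooth_at p f >] then 'D_a (f \o cinv c) (cfun c p) else 0.

Definition tangent (R : realType) (n : nat) (M : manifold R n) (p : M)
    : set (tvec M) :=
  [set v | exists c a, [/\ atlas c, cdom c p & v = coord_vec c p a]].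

Definition differential (R : realType) (m n : nat) (M : manifold R m)
    (N : manifold R n) (F : M -> N) (p : M) (v : tvec M) : tvec N :=
  fun f => if `[< smooth_at (F p) f >] then v (f \o F) else 0.

Definition immersion (R : realType) (m n : nat) (M : manifold R m)
    (N : manifold R n) (F : M -> N) : Prop :=
  smooth_map F /\
  forall p v w, tangent p v -> tangent p w ->
    differential F p v = differential F p w -> v = w.

(** * Vector fields and sections along a map *)

Definition field_along (R : realType) (m n : nat) (M : manifold R m)
    (N : manifold R n) (F : M -> N) (U : set M) (W : M -> tvec N) : Prop :=
  (forall p, U p -> tangent (F p) (W p)) /\
  forall (V : set N) (f : N -> R), open V -> smooth_on V f ->
    smooth_on (U `&` F @^-1` V) (fun p => W p f).

Definition vector_field (R : realType) (n : nat) (M : manifold R n)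
    (U : set M) (X : M -> tvec M) : Prop :=
  field_along id U X.

(* Sections over U of the pullback bundle F^*D. *)
Definition section_along (R : realType) (m n : nat) (M : manifold R m)
    (N : manifold R n) (F : M -> N) (D : N -> set (tvec N)) (U : set M)
    (W : M -> tvec N) : Prop :=
  field_along F U W /\ forall p, U p -> D (F p) (W p).

Definition section_at (R : realType) (m n : nat) (M : manifold R m)
    (N : manifold R n) (F : M -> N) (D : N -> set (tvec N)) (p : M)
    (W : M -> tvec N) : Prop :=
  exists2 U : set M, open_nbhs p U & section_along F D U W.

Definition lie_bracket (R : realType) (n : nat) (M : manifold R n)
    (X Y : M -> tvec M) (p : M) : tvec M :=
  fun f => if `[< smooth_at p f >]
           then X p (fun q => Y q f) - Y p (fun q => X q f) else 0.

(** * Distributions *)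

Definition is_basis (R : realType) (n k : nat) (M : manifold R n)
    (D : set (tvec M)) (e : 'I_k -> tvec M) : Prop :=
  (forall a : 'I_k -> R, \sum_(i < k) a i *: e i = 0 -> forall i, a i = 0) /\
  D = [set v | exists a : 'I_k -> R, v = \sum_(i < k) a i *: e i].

Definition distribution (R : realType) (n : nat) (M : manifold R n) (k : nat)
    (D : M -> set (tvec M)) : Prop :=
  forall p : M, exists (U : set M) (E : 'I_k -> M -> tvec M),
    [/\ open_nbhs p U, (forall i, vector_field U (E i)) &
        forall q, U q -> is_basis (D q) (fun i => E i q)].

Definition integral_manifold (R : realType) (m n : nat) (L : manifold R m)
    (M : manifold R n) (D : M -> set (tvec M)) (j : L -> M) : Prop :=
  [/\ injective j, immersion j &
      forall q, differential j q @` tangent q = D (j q)].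

Definition integrable (R : realType) (n : nat) (M : manifold R n) (k : nat)
    (D : M -> set (tvec M)) : Prop :=
  forall p : M, exists (L : manifold R k) (j : L -> M),
    integral_manifold D j /\ exists q, j q = p.

(** * Metrics *)

Definition metric_field (R : realType) (n : nat) (M : manifold R n) : Type :=
  M -> tvec M -> tvec M -> R.

Definition nondegenerate_on (R : realType) (n : nat) (M : manifold R n)
    (D : M -> set (tvec M)) (g : metric_field M) : Prop :=
  forall p v, D p v -> (forall w, D p w -> g p v w = 0) -> v = 0.

Record metric_tensor (R : realType) (n : nat) (M : manifold R n)
    (g : metric_field M) : Prop := MetricTensor {
  metric_sym : forall p v w, tangent p v -> tangent p w -> g p v w = g p w v;
  metric_linear : forall p (a : R) u v w,
    tangent p u -> tangent p v -> tangent p w ->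
    g p (a *: u + v) w = a * g p u w + g p v w;
  metric_smooth : forall (U : set M) X Y, open U ->
    vector_field U X -> vector_field U Y ->
    smooth_on U (fun p => g p (X p) (Y p));
  metric_nondegenerate : nondegenerate_on (@tangent R n M) g }.

(* The index q is the same at all points, also when M is disconnected. *)
Definition constant_index (R : realType) (n : nat) (M : manifold R n)
    (g : metric_field M) : Prop :=
  exists q : nat, forall p, exists2 e : 'I_n -> tvec M,
    is_basis (tangent p) e &
    forall i j, g p (e i) (e j) =
      if i == j then (if (i < q)%N then -1 else 1) else 0.

Definition semi_riemannian (R : realType) (n : nat) (M : manifold R n)
    (g : metric_field M) : Prop :=
  metric_tensor g /\ constant_index g.

Definition induced_metric (R : realType) (m n : nat) (M : manifold R m)
    (N : manifold R n) (F : M -> N) (g : metric_field N) : metric_field M :=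
  fun p v w => g (F p) (differential F p v) (differential F p w).

(** * Connections *)

(* [nab p v W] is the covariant derivative at p, in direction v, of a section W
   defined near p.  Working with germs of sections instead of global ones costs
   no generality, since a covariant derivative is a local operator. *)
Definition conn_op (R : realType) (m n : nat) (M : manifold R m)
    (N : manifold R n) : Type :=
  M -> tvec M -> (M -> tvec N) -> tvec N.

(* Connections on the bundle F^*D over M.  A connection on a subbundle D of TM
   is the case F = id. *)
Record connection (R : realType) (m n : nat) (M : manifold R m)
    (N : manifold R n) (F : M -> N) (D : N -> set (tvec N))
    (nab : conn_op M N) : Prop := Connection {
  conn_section : forall (U : set M) X W, open U ->
    vector_field U X -> section_along F D U W ->
    section_along F D U (fun p => nab p (X p) W);
  conn_linear : forall p (a : R) u v W, tangent p u -> tangent p v ->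
    section_at F D p W ->
    nab p (a *: u + v) W = a *: nab p u W + nab p v W;
  conn_additive : forall p v W1 W2, tangent p v ->
    section_at F D p W1 -> section_at F D p W2 ->
    nab p v (fun q => W1 q + W2 q) = nab p v W1 + nab p v W2;
  conn_leibniz : forall p v (f : M -> R) W, tangent p v ->
    smooth_at p f -> section_at F D p W ->
    nab p v (fun q => f q *: W q) = (v f : R) *: W p + f p *: nab p v W;
  conn_local : forall p v W1 W2, tangent p v ->
    section_at F D p W1 -> section_at F D p W2 ->
    (\forall q \near p, W1 q = W2 q) -> nab p v W1 = nab p v W2 }.

Definition affine_connection (R : realType) (n : nat) (M : manifold R n)
    (nab : conn_op M M) : Prop :=
  connection id (@tangent R n M) nab.

(* [nabF] is the pullback along F of the connection [nab] on D.  It is how a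
   connection on N differentiates fields that are only defined along F: it is
   determined by the value [nab_{dF v} Z] on restrictions Z \o F of local
   sections Z, and the Leibniz rule. *)
Definition pullback_connection (R : realType) (m n : nat) (M : manifold R m)
    (N : manifold R n) (F : M -> N) (D : N -> set (tvec N))
    (nab : conn_op N N) (nabF : conn_op M N) : Prop :=
  connection F D nabF /\
  forall p v Z, tangent p v -> section_at id D (F p) Z ->
    nabF p v (Z \o F) = nab (F p) (differential F p v) Z.

Definition torsion_free (R : realType) (n : nat) (M : manifold R n)
    (nab : conn_op M M) : Prop :=
  forall (U : set M) X Y, open U -> vector_field U X -> vector_field U Y ->
    forall p, U p -> nab p (X p) Y - nab p (Y p) X = lie_bracket X Y p.

(* (nab_v g)(Y, Z) at p. *)
Definition cov_metric (R : realType) (n : nat) (M : manifold R n)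
    (nab : conn_op M M) (g : metric_field M) (p : M) (v : tvec M)
    (Y Z : M -> tvec M) : R :=
  v (fun q => g q (Y q) (Z q))
  - g p (nab p v Y) (Z p) - g p (Y p) (nab p v Z).

Definition metric_connection (R : realType) (n : nat) (M : manifold R n)
    (g : metric_field M) (nab : conn_op M M) : Prop :=
  forall (U : set M) X Y Z, open U ->
    vector_field U X -> vector_field U Y -> vector_field U Z ->
    forall p, U p -> cov_metric nab g p (X p) Y Z = 0.

Record levi_civita (R : realType) (n : nat) (M : manifold R n)
    (g : metric_field M) (nab : conn_op M M) : Prop := LeviCivita {
  lc_tensor : metric_tensor g;
  lc_connection : affine_connection nab;
  lc_torsion_free : torsion_free nab;
  lc_metric : metric_connection g nab }.

Definition parallel (R : realType) (n : nat) (M : manifold R n)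
    (D : M -> set (tvec M)) (nab : conn_op M M) : Prop :=
  forall (U : set M) X Y, open U -> vector_field U X -> section_along id D U Y ->
    forall p, U p -> D p (nab p (X p) Y).

(** * Statistical manifolds *)

Record statistical_manifold (R : realType) (n : nat) (M : manifold R n)
    (g : metric_field M) (nab nabs : conn_op M M) : Prop :=
  StatisticalManifold {
  stat_metric : semi_riemannian g;
  stat_connection : affine_connection nab;
  stat_torsion_free : torsion_free nab;
  stat_codazzi : forall (U : set M) X Y Z, open U ->
    vector_field U X -> vector_field U Y -> vector_field U Z ->
    forall p, U p ->
      cov_metric nab g p (X p) Y Z = cov_metric nab g p (Y p) X Z;
  stat_dual_connection : affine_connection nabs;
  stat_dual : forall (U : set M) X Y Z, open U ->
    vector_field U X -> vector_field U Y -> vector_field U Z ->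
    forall p, U p ->
      X p (fun q => g q (Y q) (Z q)) =
      g p (nab p (X p) Y) (Z p) + g p (Y p) (nabs p (X p) Z) }.

(** * Lightlike hypersurfaces *)

Definition Rad (R : realType) (n : nat) (M : manifold R n)
    (g : metric_field M) (p : M) : set (tvec M) :=
  [set v | tangent p v /\ forall w, tangent p w -> g p v w = 0].

Definition lightlike_hypersurface (R : realType) (n : nat)
    (Mbar : manifold R n.+1) (gbar : metric_field Mbar) (M : manifold R n)
    (i : M -> Mbar) : Prop :=
  immersion i /\
  forall p, exists2 v, Rad (induced_metric i gbar) p v & v != 0.

Record screen_distribution (R : realType) (m : nat) (M : manifold R m.+1)
    (g : metric_field M) (S : M -> set (tvec M)) : Prop := Screen {
  screen_distr : distribution m S;
  screen_nondegenerate : nondegenerate_on S g;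
  screen_disjoint : forall p v, S p v -> Rad g p v -> v = 0;
  screen_sum : forall p v, tangent p v ->
    exists s r, [/\ S p s, Rad g p r & v = s + r] }.

Definition radical_frame (R : realType) (n : nat) (M : manifold R n)
    (g : metric_field M) (U : set M) (xi : M -> tvec M) : Prop :=
  section_along id (Rad g) U xi /\ forall p, U p -> xi p != 0.

Definition transversal_field (R : realType) (n k : nat)
    (Mbar : manifold R n) (gbar : metric_field Mbar) (M : manifold R k)
    (i : M -> Mbar) (S : M -> set (tvec M)) (U : set M) (xi : M -> tvec M)
    (N : M -> tvec Mbar) : Prop :=
  field_along i U N /\
  forall p, U p ->
    [/\ gbar (i p) (N p) (N p) = 0,
        gbar (i p) (N p) (differential i p (xi p)) = 1 &
        forall w, S p w -> gbar (i p) (N p) (differential i p w) = 0].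

(* The Gauss formula.  The pair (xi, N) exists only locally, but span{N}, hence
   the tangential part [nab], does not depend on its choice. *)
Definition induced_connection (R : realType) (n k : nat)
    (Mbar : manifold R n) (gbar : metric_field Mbar) (M : manifold R k)
    (i : M -> Mbar) (S : M -> set (tvec M)) (nabbar : conn_op Mbar Mbar)
    (nab : conn_op M M) : Prop :=
  affine_connection nab /\
  exists2 nabi : conn_op M Mbar,
    pullback_connection i (@tangent R n Mbar) nabbar nabi &
  forall p0 : M, exists (U : set M) (xi : M -> tvec M) (N : M -> tvec Mbar)
      (B : M -> tvec M -> (M -> tvec M) -> R),
    [/\ open_nbhs p0 U, radical_frame (induced_metric i gbar) U xi,
        transversal_field gbar i S U xi N &
        forall p v Y, U p -> tangent p v ->
          section_at id (@tangent R k M) p Y ->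
          nabi p v (fun q => differential i q (Y q)) =
          differential i p (nab p v Y) + B p v Y *: N p].

Definition induced_screen_connection (R : realType) (k : nat)
    (M : manifold R k) (g : metric_field M) (S : M -> set (tvec M))
    (nab nabS : conn_op M M) : Prop :=
  connection id S nabS /\
  forall p0 : M, exists (U : set M) (xi : M -> tvec M)
      (C : M -> tvec M -> (M -> tvec M) -> R),
    [/\ open_nbhs p0 U, radical_frame g U xi &
        forall p v W, U p -> tangent p v -> section_at id S p W ->
          nab p v W = nabS p v W + C p v W *: xi p].

(* The connection [nabL] on the integral manifold j : L -> M of S is the
   restriction of the connection [nabS] on S, TL being identified with j^*S. *)
Definition restricted_connection (R : realType) (m n : nat)
    (L : manifold R m) (M : manifold R n) (j : L -> M)
    (S : M -> set (tvec M)) (nabS : conn_op M M) (nabL : conn_op L L) : Prop :=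
  affine_connection nabL /\
  exists2 nabj : conn_op L M,
    pullback_connection j S nabS nabj &
  forall q v Y, tangent q v -> section_at id (@tangent R m L) q Y ->
    differential j q (nabL q v Y) =
    nabj q v (fun q' => differential j q' (Y q')).

(* Main.v *)
(** Duality of [nabbar] and [nabbars] restricts to the screen, because the
    transversal field N is orthogonal to it: for Y, Z in S(TM),
      X g(Y, Z) = g(nab_X Y, Z) + g(Y, nabs_X Z).
    Since [nab] is metric, nabs_X Z - nab_X Z is orthogonal to S(TM); it also lies
    in S(TM), which is parallel for both connections and non-degenerate, so the two
    connections agree on the screen.  Hence so do [nabS] and [nabsS], and both are
    metric.  The Gauss formula shows that [nab] is torsion-free; as S(TM) is
    parallel, it is involutive, hence integrable by Frobenius' theorem, and the
    torsion-free metric connection [nab] restricts to the Levi-Civita connection of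
    every leaf.

    For Frobenius' theorem, a frame of an involutive distribution whose components
    in suitable directions are constant consists of commuting fields F_k.  With
    g_y the solution of g' = sum_k y_k F_k(g), g(0) = x0, the map y |-> g_y(1)
    parametrizes the leaf through x0.  It is differentiable with partial
    derivatives F_k because, by commutation and Gronwall's inequality,
      g_y(s) - g_x(s) - s sum_k (y_k - x_k) F_k(g_x(s)) = O(|y - x|^2). **)

From mathcomp Require Import all_boot all_order all_algebra.
From mathcomp Require Import boolp classical_sets functions cardinality reals.
From mathcomp Require Import interval_inference.
From mathcomp Require Import topology normedtype derive landau ring lra.
From mathcomp Require Import sequences ereal exp.
From mathcomp Require Import measure lebesgue_measure lebesgue_integral ftc.
(* Imported last so that [integrable] is the notion for distributions. *)
Require Import Defs.

Set Implicit Arguments.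
Unset Strict Implicit.
Unset Printing Implicit Defensive.

Import Order.TTheory GRing.Theory Num.Theory numFieldNormedType.Exports.

Local Open Scope classical_set_scope.
Local Open Scope ring_scope.

(** * Smooth functions on open subsets of R^n *)

(** Two things shape the proof. Sections along a map are differentiated by a pullback, which is
    prescribed only on restrictions of ambient sections; identities along [i] or along a leaf are
    therefore obtained by expansion in a local frame. One result on torsion and one on duality,
    stated for a distribution [D] and a map [F], serve twice: for the hypersurface in the ambient
    manifold, with [D] the ambient tangent bundle, and for the leaf in the hypersurface, with [D]
    the screen. In the flow construction, the parameters are confined to a ball so small that the
    driving field has Lipschitz constant 1/2 over a unit of time. Picard iteration then contracts in
    the uniform distance, Gronwall's inequality follows by evaluation at a maximum, and the factor 2
    = 1 / (1 - 1/2) enters the constants. A leaf must be an injective immersion of a whole manifold: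
    R^m is squeezed into the ball of parameters, and the constant matrix that normalizes the frame
    recovers the parameter from the endpoint, up to a translation. *)

Lemma near_eq_differentiable (R : numFieldType) (V W : normedModType R)
    (f g : V -> W) (x : V) :
  (\forall y \near x, f y = g y) -> differentiable f x -> differentiable g x.
Proof.
move=> fg df.
(* [g - f] vanishes near [x], so the zero map is its differential there, and [g] becomes a sum of
   differentiable functions. *)
have -> : g = f + (g - f) by rewrite addrC subrK.
apply: differentiableD => //.
have h0 : \forall y \near x, (g - f) y = 0.
  by near=> y; rewrite !fctE (near fg y)// subrr.
have hx0 := nbhs_singleton h0.
apply/diff_locallyP.
have E : (g - f) \o shift x = cst ((g - f) x) + (\0 : V -> W) +o_ 0 id.
  apply/eqaddoP => _/posnumP[e].
  rewrite hx0; near=> y.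
  have hy : (g - f) (y + x) = 0.
    by near: y; move: h0; rewrite (near_shift 0) subr0.
  by rewrite -[X in `|X|]/((g - f) (y + x) - (0 + 0)) hy addr0 subr0 normr0 mulr_ge0.
have C0 : continuous (\0 : V -> W) by exact: cst_continuous.
by rewrite (diff_unique C0 E).
Unshelve. all: by end_near. Qed.

Section Ck_calculus.
Variables (R : realType) (n : nat).
Implicit Types (A B : set 'rV[R]_n) (f g : 'rV[R]_n -> R).

Lemma Ck_sub k A B f : A `<=` B -> Ck k B f -> Ck k A f.
Proof.
elim: k f => [|k IH] f AB /=; first by move=> Bf x /AB /Bf.
by move=> [df Df]; split=> [x /AB/df//|v]; apply: IH.
Qed.

Lemma Ck_eq k A f g : open A -> (forall x, A x -> f x = g x) ->
  Ck k A f -> Ck k A g.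
Proof.
move=> oA; elim: k f g => [|k IH] f g fg /=.
  move=> fc x Ax; have := fc x Ax.
  have E : \forall y \near x, f y = g y.
    by apply: filterS (open_nbhs_nbhs (conj oA Ax)) => y /fg.
  rewrite /prop_for /continuous_at -(fg x Ax) => h.
  by apply: cvg_trans h; exact: (@near_eq_cvg _ _ _ (nbhs_filter x)).
have E x : A x -> \forall y \near x, f y = g y.
  by move=> Ax; apply: filterS (open_nbhs_nbhs (conj oA Ax)) => y /fg.
move=> [df Df]; split=> [x Ax|v].
  by apply: near_eq_differentiable (df x Ax); exact: E.
apply: IH (Df v) => x Ax; apply: near_eq_derive; exact: E.
Qed.

Lemma Ck_pred k A f : Ck k.+1 A f -> Ck k A f.
Proof.
elim: k f => [|k IH] f.
  by move=> [df _] x /df /differentiable_continuous.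
by move=> [df Df]; split=> // v; apply: IH.
Qed.

Lemma Ck_cst k A (c : R) : Ck k A (fun=> c).
Proof.
elim: k c => [|k IH] c /=; first by move=> x _; exact: cst_continuous.
split=> [x _|v]; first exact: differentiable_cst.
have -> : 'D_v (fun=> c) = fun=> 0; last exact: IH.
  by apply/funext => x; exact: derive_cst.
Qed.

Lemma Ck_add k A f g : open A -> Ck k A f -> Ck k A g ->
  Ck k A (fun x => f x + g x).
Proof.
move=> oA; elim: k f g => [|k IH] f g /=.
  by move=> cf cg x Ax; apply: continuousD; [exact: cf|exact: cg].
move=> [df Df] [dg Dg]; split=> [x Ax|v].
  by apply: differentiableD; [exact: df|exact: dg].
apply: (Ck_eq oA _ (IH _ _ (Df v) (Dg v))) => x Ax /=.
by rewrite -deriveD//; apply: diff_derivable; [exact: df|exact: dg].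
Qed.

Lemma Ck_mul k A f g : open A -> Ck k A f -> Ck k A g ->
  Ck k A (fun x => f x * g x).
Proof.
move=> oA; elim: k f g => [|k IH] f g.
  by move=> cf cg x Ax; apply: continuousM; [exact: cf|exact: cg].
move=> Cf Cg; have [df Df] := Cf; have [dg Dg] := Cg; split=> [x Ax|v].
  by apply: differentiableM; [exact: df|exact: dg].
apply: (@Ck_eq _ _ (fun x => f x * 'D_v g x + g x * 'D_v f x)) => //.
  move=> x Ax; rewrite -[RHS]/('D_v (f * g) x) deriveM//.
  - by apply: diff_derivable; exact: df.
  - by apply: diff_derivable; exact: dg.
by apply: Ck_add => //; apply: IH; [exact: Ck_pred Cf|exact: Dg|
  exact: Ck_pred Cg|exact: Df].
Qed.

Lemma Ck_inv k A f : open A -> (forall x, A x -> f x != 0) ->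
  Ck k A f -> Ck k A (fun x => (f x)^-1).
Proof.
move=> oA f0; elim: k => [|k IH] Cf.
  by move=> x Ax; apply: continuousV; [exact: f0|exact: Cf].
have [df Df] := Cf; split=> [x Ax|v].
  by apply: differentiableV; [exact: df|exact: f0].
apply: (@Ck_eq _ _ (fun x => (-1) * ((f x)^-1 * (f x)^-1 * 'D_v f x))) => //.
  move=> x Ax.
  rewrite [RHS](@deriveV R _ f); [|exact: f0|by apply: diff_derivable; exact: df].
  by rewrite mulN1r scaleNr expr2 invfM.
have := IH (Ck_pred Cf) => If.
by do ?apply: Ck_mul => //; [exact: Ck_cst|exact: Df].
Qed.

Lemma Ck_sum k A (I : Type) (r : seq I) (P : pred I) (F : I -> 'rV[R]_n -> R) :
  open A -> (forall i, P i -> Ck k A (F i)) ->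
  Ck k A (fun x => \sum_(i <- r | P i) F i x).
Proof.
move=> oA CF; elim: r => [|i r IH].
  by under eq_fun do rewrite big_nil; exact: Ck_cst.
have [Pi|nPi] := boolP (P i); last first.
  by under eq_fun do rewrite big_cons (negPf nPi).
under eq_fun do rewrite big_cons Pi.
by apply: Ck_add => //; exact: CF.
Qed.

Lemma derive_coord (v x : 'rV[R]_n) i :
  'D_v (fun y : 'rV[R]_n => y ord0 i) x = v ord0 i.
Proof.
have := derive_mx (@derivable_id _ _ x v).
by rewrite derive_id => /matrixP/(_ ord0 i); rewrite mxE.
Qed.

Lemma Ck_coord k A i : Ck k A (fun x : 'rV[R]_n => x ord0 i).
Proof.
case: k => [|k]; first by move=> x _; exact: coord_continuous.
split=> [x _|v]; first exact: differentiable_coord.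
have -> : 'D_v (fun x : 'rV[R]_n => x ord0 i) = fun=> v ord0 i.
  by apply/funext => x; exact: derive_coord.
exact: Ck_cst.
Qed.

End Ck_calculus.

Section Ck_composition.
Variables (R : realType) (m n : nat).
Implicit Types (A : set 'rV[R]_m) (B : set 'rV[R]_n).

Lemma differentiable_row (V : normedModType R) (phi : V -> 'rV[R]_n) x :
  (forall i, differentiable (fun y => phi y ord0 i) x) -> differentiable phi x.
Proof.
move=> dphi.
have -> : phi = \sum_(i < n) (fun y => phi y ord0 i *: (delta_mx 0 i : 'rV[R]_n)).
  by apply/funext => y; rewrite fct_sumE [LHS]row_sum_delta.
apply: differentiable_sum => i; exact: differentiableZl.
Qed.

Lemma diff_row (V : normedModType R) (phi : V -> 'rV[R]_n) x v i :
  differentiable phi x -> ('d phi x v) ord0 i = 'D_v (fun y => phi y ord0 i) x.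
Proof.
move=> dphi; rewrite -deriveE// derive_mx ?mxE//; exact: diff_derivable.
Qed.

Lemma continuous_row (T : topologicalType) (phi : T -> 'rV[R]_n) x :
  (forall i, {for x, continuous (fun y => phi y ord0 i)}) ->
  {for x, continuous phi}.
Proof.
move=> cphi; have -> : phi = fun y => \sum_(i < n) (phi y ord0 i *: (delta_mx 0 i : 'rV[R]_n)).
  by apply/funext => y; rewrite [LHS]row_sum_delta.
rewrite /prop_for /continuous_at; apply: cvg_big => [|i _]; first exact: add_continuous.
by apply: cvgZr_tmp; exact: cphi.
Qed.

Lemma derive_sum_delta (f : 'rV[R]_n -> R) x v : differentiable f x ->
  'D_v f x = \sum_(i < n) v ord0 i * 'D_('e_i) f x.
Proof.
move=> df; rewrite deriveE// [v in LHS]row_sum_delta linear_sum.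
by apply: eq_bigr => i _; rewrite linearZ /= deriveE.
Qed.

Lemma derive_comp_row (f : 'rV[R]_n -> R) (V : normedModType R)
    (phi : V -> 'rV[R]_n) x v :
  (forall i, differentiable (fun y => phi y ord0 i) x) ->
  differentiable f (phi x) ->
  'D_v (f \o phi) x =
  \sum_(i < n) 'D_v (fun y => phi y ord0 i) x * 'D_('e_i) f (phi x).
Proof.
move=> dphi df; have dp := differentiable_row dphi.
rewrite deriveE; last exact: differentiable_comp.
rewrite diff_comp//= -deriveE// derive_sum_delta//.
by apply: eq_bigr => i _; rewrite diff_row.
Qed.

(** The chain rule turns a derivative of the composite into products of derivatives of the
    components of [phi] with partial derivatives of [f] along [phi]. The induction is therefore on
    [k] with [f] general, while [phi] is kept and loses one order of regularity by [Ck_pred]. *)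
Lemma Ck_comp k A B (phi : 'rV[R]_m -> 'rV[R]_n) (f : 'rV[R]_n -> R) :
  open A -> (forall i, Ck k A (fun x => phi x ord0 i)) ->
  (forall x, A x -> B (phi x)) -> Ck k B f -> Ck k A (f \o phi).
Proof.
move=> oA; elim: k f => [|k IH] f Cphi AB Cf.
  move=> x Ax; apply: continuous_comp; last exact/Cf/AB.
  by apply: continuous_row => i; exact: Cphi.
have dphi x : A x -> forall i, differentiable (fun y => phi y ord0 i) x.
  by move=> Ax i; exact: (Cphi i).1.
have [df Df] := Cf; split=> [x Ax|v].
  apply: differentiable_comp; last exact/df/AB.
  exact/differentiable_row/dphi.
apply: (@Ck_eq _ _ _ _ (fun x => \sum_(i < n)
    ('D_v (fun y => phi y ord0 i) x * 'D_('e_i) f (phi x)))) => //.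
  move=> x Ax; rewrite derive_comp_row//; [exact: dphi|exact/df/AB].
apply: Ck_sum => // i _; apply: Ck_mul => //; first exact: (Cphi i).2.
apply: (IH ('D_('e_i) f)) => //; last exact: Df.
by move=> j; exact: Ck_pred.
Qed.

End Ck_composition.

(** * Mean values along lines and symmetry of mixed second derivatives *)

Section mixed_derivatives.
Variable R : realType.

Lemma is_derive_line (V : normedModType R) (f : V -> R) (y v : V) (s : R) :
  differentiable f (y + s *: v) ->
  is_derive s (1 : R) (fun t => f (y + t *: v)) ('D_v f (y + s *: v)).
Proof.
move=> df; pose l := fun t : R => y + t *: v.
have dl : is_diff s l ( *:%R^~ v).
  by apply: (is_diff_eq (is_diffD _ _)); apply/funext => t; rewrite fctE add0r.
have dfl : is_diff s (f \o l) ('d f (l s) \o ( *:%R^~ v)).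
  by apply: is_diff_comp => //; apply: differentiableP.
apply: DeriveDef; first by apply: diff_derivable; exact: (@ex_diff _ _ _ _ _ _ _ dfl).
rewrite deriveE; last exact: (@ex_diff _ _ _ _ _ _ _ dfl).
by rewrite (@diff_val _ _ _ _ _ _ _ dfl)/= scale1r deriveE.
Qed.

Lemma MVT_line (V : normedModType R) (f : V -> R) (y v : V) (h : R) : 0 < h ->
  (forall s, 0 <= s <= h -> differentiable f (y + s *: v)) ->
  exists2 c, 0 < c < h & f (y + h *: v) - f y = h * 'D_v f (y + c *: v).
Proof.
move=> h0 df.
have D s : s \in `[0, h] -> is_derive s 1 (fun t => f (y + t *: v)) ('D_v f (y + s *: v)).
  by rewrite in_itv/= => /df; exact: is_derive_line.
pose F : R -> R := fun t => f (y + t *: v).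
pose dF : R -> R := fun t => 'D_v f (y + t *: v).
have H1 s : s \in `]0, h[ -> is_derive s (1 : R) F (dF s).
  by rewrite in_itv/= => /andP[? ?]; apply: D; rewrite in_itv/= !ltW.
have H2 : {within `[0, h], continuous F}.
  by apply: derivable_within_continuous => s /D [].
have [c] := MVT h0 H1 H2.
rewrite in_itv/= /F /dF => ch; rewrite scale0r addr0 subr0 mulrC => E.
by exists c.
Qed.

(** The mean value theorem is applied twice: along [u] to the increment of [f] by [h *: v], then
    along [v] to ['D_u f]. The left-hand side is symmetric in [u] and [v], which is what the formula
    is for. *)
Lemma second_difference (V : normedModType R) (f : V -> R) (x u v : V) (h : R) :
  0 < h ->
  (forall s t, 0 <= s <= h -> 0 <= t <= h ->
     differentiable f (x + s *: u + t *: v) /\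
     differentiable ('D_u f) (x + s *: u + t *: v)) ->
  exists s t, [/\ 0 < s < h, 0 < t < h &
    f (x + h *: u + h *: v) - f (x + h *: u) - (f (x + h *: v) - f x)
    = h * (h * 'D_v ('D_u f) (x + s *: u + t *: v))].
Proof.
move=> h0 df.
have hh : 0 <= h <= h by rewrite lexx ltW.
have oh : 0 <= (0 : R) <= h by rewrite lexx ltW.
pose g := (fun y => f (h *: v + y)) - f.
have dsh y : differentiable (shift (h *: v)) (y : V).
  exact: (@differentiableD _ _ _ id (cst _)).
have dfh s : 0 <= s <= h -> differentiable (fun y => f (h *: v + y)) (x + s *: u).
  move=> sh; rewrite (_ : (fun y => _) = f \o shift (h *: v)); last first.
    by apply/funext => y; rewrite /= addrC.
  by apply: differentiable_comp => //=; exact: (df _ _ sh hh).1.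
have df0 s : 0 <= s <= h -> differentiable f (x + s *: u).
  by move=> sh; have := (df _ _ sh oh).1; rewrite scale0r addr0.
have [s sh Es] : exists2 s, 0 < s < h & g (x + h *: u) - g x = h * 'D_u g (x + s *: u).
  apply: MVT_line => // s sh; apply: differentiableB; [exact: dfh|exact: df0].
have sh' : 0 <= s <= h by case/andP: sh => ? ?; rewrite !ltW.
have [t th Et] : exists2 t, 0 < t < h &
    'D_u f (x + s *: u + h *: v) - 'D_u f (x + s *: u)
    = h * 'D_v ('D_u f) (x + s *: u + t *: v).
  exact: (MVT_line h0 (fun t th => (df _ _ sh' th).2)).
exists s, t; split=> //; rewrite -Et.
have -> : 'D_u f (x + s *: u + h *: v) - 'D_u f (x + s *: u) = 'D_u g (x + s *: u).
  rewrite deriveB; [|apply: diff_derivable; exact: dfh|apply: diff_derivable; exact: df0].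
  congr (_ - _).
  rewrite (_ : (fun y => _) = f \o shift (h *: v)); last first.
    by apply/funext => y; rewrite /= addrC.
  rewrite /derive /=.
  by under [in RHS]eq_fun do rewrite -addrA.
rewrite -Es /g !fctE opprB [h *: v + _]addrC.
by rewrite -!addrA [h *: v + x]addrC opprB.
Qed.

(** The symmetric second difference equates the two mixed derivatives at two points arbitrarily
    close to [x]; continuity of both derivatives carries the equality to [x]. *)
Lemma derive_symmetric n (A : set 'rV[R]_n) (f : 'rV[R]_n -> R) (x u v : 'rV[R]_n) :
  open A -> A x -> Ck 2 A f -> 'D_v ('D_u f) x = 'D_u ('D_v f) x.
Proof.
move=> oA Ax [df Df].
have /(nbhs_ballP _ _)[d d0 dA] : nbhs x A by exact: open_nbhs_nbhs.
have small (h s t : R) : 0 < h -> h * (`|u| + `|v| + 1) < d -> 0 <= s <= h -> 0 <= t <= h ->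
    forall e, h * (`|u| + `|v| + 1) < e -> `|x - (x + s *: u + t *: v)| < e.
  move=> h0 hd /andP[s0 sh] /andP[t0 th] e he.
  rewrite -addrA opprD addrA subrr sub0r normrN.
  apply: le_lt_trans (ler_normD _ _) _; rewrite !normrZ !ger0_norm//.
  apply: le_lt_trans he; rewrite !mulrDr mulr1 -addrA lerD ?ler_wpM2r//.
  by rewrite ler_wpDr ?ler_wpM2r// ltW.
apply/eqP; rewrite -subr_eq0 -normr_le0; apply/ler_addgt0Pl => e e0; rewrite addr0.
have c1 : {for x, continuous ('D_v ('D_u f))} by exact: (Df u).2.
have c2 : {for x, continuous ('D_u ('D_v f))} by exact: (Df v).2.
have e20 : 0 < e / 2 by rewrite divr_gt0.
have /cvgrPdist_lt/(_ _ e20)/nbhs_ballP[d1 d10 h1] := c1.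
have /cvgrPdist_lt/(_ _ e20)/nbhs_ballP[d2 d20 h2] := c2.
pose m := Num.min d (Num.min d1 d2).
have m0 : 0 < m by rewrite !lt_min d0 d10 d20.
(* [h * K] bounds the distance from [x] to every point of the parallelogram with sides [h *: u] and
   [h *: v]; the summand 1 keeps [K] positive when both vectors vanish. *)
pose K := `|u| + `|v| + 1.
have K0 : 0 < K by rewrite ltr_wpDl// addr_ge0.
pose h := m / 2 / K.
have h0 : 0 < h by rewrite !divr_gt0.
have hm : h * K < m by rewrite divfK ?gt_eqF// ltr_pdivrMr// mulr_natr mulr2n ltrDl.
have [hd hd1 hd2] : [/\ h * K < d, h * K < d1 & h * K < d2].
  by move: hm; rewrite !lt_min => /andP[-> /andP[-> ->]].
have inA s t : 0 <= s <= h -> 0 <= t <= h -> A (x + s *: u + t *: v).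
  move=> sh th; apply: dA; rewrite -ball_normE/=; exact: (small h).
have [|s [t [sh th E]]] := @second_difference _ f x u v h h0.
  by move=> s t sh th; split; [exact/df/inA|exact/(Df u).1/inA].
have [|t' [s' [th' sh' E']]] := @second_difference _ f x v u h h0.
  move=> t' s' th' sh'; rewrite addrAC.
  by split; [exact/df/inA|exact/(Df v).1/inA].
have W (a : R) : 0 < a < h -> 0 <= a <= h by move=> /andP[? ?]; rewrite !ltW.
have EE : 'D_v ('D_u f) (x + s *: u + t *: v) = 'D_u ('D_v f) (x + s' *: u + t' *: v).
  apply: (mulfI (lt0r_neq0 h0)); apply: (mulfI (lt0r_neq0 h0)).
  rewrite (_ : x + s' *: u + t' *: v = x + t' *: v + s' *: u); last exact: addrAC.
  apply: etrans (esym E) _; apply: etrans E'.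
  by rewrite (_ : x + h *: v + h *: u = x + h *: u + h *: v); [ring|exact: addrAC].
rewrite -(subrK ('D_v ('D_u f) (x + s *: u + t *: v)) ('D_v _ _)) -addrA {2}EE.
apply: le_trans (ler_normD _ _) _; rewrite [leRHS]splitr; apply: lerD; apply: ltW.
  by apply: h1; rewrite -ball_normE; exact: small h0 hd (W _ sh) (W _ th) _ hd1.
rewrite distrC; apply: h2; rewrite -ball_normE.
exact: small h0 hd (W _ sh') (W _ th') _ hd2.
Qed.

End mixed_derivatives.

(** * Ordinary differential equations *)

Section row_norm.
Variables (R : realType) (n : nat).
Implicit Types x y : 'rV[R]_n.

Lemma row_norm_le x (c : R) : 0 <= c -> (forall i, `|x ord0 i| <= c) -> `|x| <= c.
Proof.
move=> c0 xc; rewrite [leLHS]/Num.Def.normr/= mx_normrE.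
by apply: bigmax_le => // -[i j] _; rewrite /= [i]ord1.
Qed.

Lemma coord_norm_le x i : `|x ord0 i| <= `|x|.
Proof.
rewrite [leRHS]/Num.Def.normr/= mx_normrE.
exact: (le_bigmax _ (fun ij : 'I_1 * 'I_n => `|x ij.1 ij.2|) (ord0, i)).
Qed.

End row_norm.

Lemma continuous_dist (R : numFieldType) (V W : normedModType R) (f : V -> W) x :
  (forall e, 0 < e -> \forall y \near x, `|f x - f y| < e) -> {for x, continuous f}.
Proof. by move=> H; apply/cvgrPdist_lt. Qed.

Section primitives.
Variable R : realType.

(* Precomposing with [clamp01] makes functions on [0, 1] globally continuous. *)
Definition clamp01 (s : R) : R := Num.max 0 (Num.min s 1).

Lemma clamp01_itv s : 0 <= clamp01 s <= 1.
Proof. by rewrite le_max lexx/= ge_max ler01 ge_min lexx orbT. Qed.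

Lemma clamp01_id s : 0 <= s <= 1 -> clamp01 s = s.
Proof. by case/andP=> s0 s1; rewrite /clamp01 min_l// max_r. Qed.

Lemma clamp01_continuous : continuous clamp01.
Proof.
move=> s; rewrite /clamp01.
apply: (@continuous_max R R (cst 0) (fun t => Num.min t 1)); first exact: cst_continuous.
by apply: (@continuous_min R R id (cst 1)); [exact: cvg_id|exact: cst_continuous].
Qed.

Lemma primitive (g : R -> R) : continuous g -> exists F : R -> R,
  F 0 = 0 /\ forall s : R, 0 <= s <= 1 -> is_derive s (1 : R) F (g s).
Proof.
(* The integral starts at -1 and is considered inside [-1, 2], so that 0 and 1 are interior points
   and the derivative there is two-sided. *)
move=> cg; pose F0 x := (\int[lebesgue_measure]_(t in `[(-1)%R, x]) g t)%R.
have ig : lebesgue_measure.-integrable `[(-1)%R, 2%R] (fun t => (g t)%:E).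
  apply: continuous_compact_integrable; first exact: segment_compact.
  exact: continuous_subspaceT.
exists (fun x => F0 x - F0 0); split=> [|s /andP[s0 s1]]; first by rewrite subrr.
have [||dF F'] := @continuous_FTC1_closed R g (-1) s 2 _ ig _ (cg s).
- by rewrite (le_lt_trans s1)// ltr1n.
- by rewrite (lt_le_trans _ s0)// oppr_lt0.
have D : is_derive s (1 : R) F0 (g s).
  by apply: DeriveDef; [exact: dF|rewrite -derive1E; exact: F'].
have := is_deriveB D (is_derive_cst (F0 0) s 1).
by rewrite subr0.
Qed.

Lemma norm_le_derive (F f : R -> R) (c : R) : F 0 = 0 -> 0 <= c ->
  (forall s : R, 0 <= s <= 1 -> is_derive s (1 : R) F (f s)) ->
  (forall s : R, 0 <= s <= 1 -> `|f s| <= c) -> forall s : R, 0 <= s <= 1 -> `|F s| <= c.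
Proof.
move=> F0 c0 dF fc s /andP[s0 s1].
have in01 t : t \in `[0, s] -> 0 <= t <= 1.
  by rewrite in_itv/= => /andP[-> /le_trans ->].
have H1 t : t \in `]0, s[ -> is_derive t (1 : R) F (f t).
  by move=> ts; apply/dF/in01/subset_itv_oo_cc.
have H2 : {within `[0, s], continuous F}.
  by apply: derivable_within_continuous => t /in01 /dF [].
have [t ts] := MVT_segment s0 H1 H2.
rewrite F0 !subr0 => ->; rewrite normrM (ger0_norm s0).
by rewrite -[leRHS]mulr1 ler_pM//; exact/fc/in01.
Qed.

End primitives.

Lemma expr_small (R : realType) (q C e : R) : 0 <= q < 1 -> 0 < e ->
  exists k, C * q ^+ k < e.
Proof.
move=> /andP[q0 q1] e0.
have [C0|C0] := leP C 0.
  by exists 0%N; rewrite expr0 mulr1 (le_lt_trans C0).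
have qc : (GRing.exp q : R ^nat) @ \oo --> 0 by apply: cvg_expr; rewrite ger0_norm.
have eC : 0 < e / C by rewrite divr_gt0.
have [k _ /(_ k (leqnn k)) /=] := cvgr0_norm_lt _ qc _ eC.
by rewrite normrX ger0_norm// ltr_pdivlMr// mulrC => ?; exists k.
Qed.

(** * Fixed points of uniform contractions *)

Section uniform_contraction.
Variables (R : realType) (n : nat).
Variables (T : (R -> 'rV[R]_n) -> (R -> 'rV[R]_n)) (q : R).
Hypothesis q01 : 0 <= q < 1.
Hypothesis Tc : forall g, continuous g -> continuous (T g).
Hypothesis Tq : forall f g c, continuous f -> continuous g ->
  (forall s, `|f s - g s| <= c) -> forall s, `|T f s - T g s| <= q * c.

(** [M / (1 - q) * q ^+ k] is the sum of the bounds from step [k] on. The intervals of these radii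
    around the [u k] are nested, and the supremum of their left ends lies in all of them. *)
Lemma geometric_limit (u : nat -> R) (M : R) :
  (forall k, `|u k.+1 - u k| <= M * q ^+ k) ->
  exists l, forall k, `|u k - l| <= M / (1 - q) * q ^+ k.
Proof.
case/andP: q01 => q0 q1 uM.
have q1' : 0 < 1 - q by rewrite subr_gt0.
have M0 : 0 <= M.
  by have := le_trans (normr_ge0 _) (uM 0%N); rewrite expr0 mulr1.
pose C := M / (1 - q); have C0 : 0 <= C by rewrite divr_ge0// ltW.
have EC k : M * q ^+ k + C * q ^+ k.+1 = C * q ^+ k.
  by rewrite exprS mulrA -mulrDl /C; congr (_ * _); field; rewrite gt_eqF.
have dec k j : `|u (k + j)%N - u k| + C * q ^+ (k + j) <= C * q ^+ k.
  elim: j => [|j IH]; first by rewrite addn0 subrr normr0 add0r.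
  apply: le_trans IH; rewrite addnS -(EC (k + j)%N) addrA lerD2r.
  rewrite -(subrK (u (k + j)%N) (u (k + j).+1)) -addrA.
  by apply: le_trans (ler_normD _ _) _; rewrite [leRHS]addrC lerD2r uM.
have Cq k : 0 <= C * q ^+ k by rewrite mulr_ge0// exprn_ge0.
pose E := [set u k - C * q ^+ k | k in setT].
have E0 : E !=set0 by exists (u 0%N - C * q ^+ 0), 0%N.
have Eub k : ubound E (u k + C * q ^+ k).
  move=> _ [j _ <-]; rewrite lerBlDr.
  have [jk|/ltnW jk] := leqP j k.
    have := dec j (k - j)%N; rewrite subnKC// => d.
    have := Cq k; move: d; have := ler_norm (u j - u k); rewrite distrC.
    by move=> ? ? ?; lra.
  have := dec k (j - k)%N; rewrite subnKC// => d.
  have := Cq j; move: d; have := ler_norm (u j - u k).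
  by move=> ? ? ?; lra.
exists (sup E) => k; rewrite ler_norml; apply/andP; split.
  have : sup E <= u k + C * q ^+ k by exact: ge_sup.
  by rewrite -/C; lra.
have : u k - C * q ^+ k <= sup E.
  by apply: ub_le_sup; [exists (u 0%N + C * q ^+ 0)|exists k].
by rewrite -/C; lra.
Qed.

(** The argument works with uniform bounds instead of a normed space of functions: the iterates
    converge at a geometric rate uniformly in [s], the limit is formed in each coordinate, and both
    continuity and the fixed-point equation pass to the uniform limit. *)
Lemma contraction_fixpoint (g0 : R -> 'rV[R]_n) (M : R) : continuous g0 ->
  (forall s, `|T g0 s - g0 s| <= M) ->
  exists g, continuous g /\ T g = g.
Proof.
move=> c0 HM; case/andP: (q01) => q0 q1.
pose u k := iter k T g0.
have cu k : continuous (u k) by elim: k => //= k; exact: Tc.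
have du k s : `|u k.+1 s - u k s| <= M * q ^+ k.
  elim: k s => [|k IH] s; first by rewrite expr0 mulr1; exact: HM.
  by rewrite exprS mulrCA; exact: (Tq (cu k.+1) (cu k) IH).
have lim (s : R) : exists l : 'rV[R]_n, forall k, `|u k s - l| <= M / (1 - q) * q ^+ k.
  have H i : exists l : R, forall k, `|u k s ord0 i - l| <= M / (1 - q) * q ^+ k.
    apply: geometric_limit => k; apply: le_trans (du k s).
    by apply: le_trans (coord_norm_le _ i); rewrite !mxE.
  have [l Hl] := choice H; exists (\row_i l i) => k.
  apply: row_norm_le => [|i]; last by rewrite !mxE.
  rewrite mulr_ge0 ?exprn_ge0// divr_ge0 ?subr_ge0 ?(ltW q1)//.
  exact: le_trans (normr_ge0 _) (HM 0).
have [g Hg] := choice lim; pose C := M / (1 - q).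
have cg : continuous g.
  move=> s; apply: continuous_dist => e e0.
  have e3 : 0 < e / 3 by rewrite divr_gt0.
  have [k Hk] := expr_small C q01 e3.
  have /cvgrPdist_lt/(_ _ e3) := cu k s; apply: filterS => t Ht.
  have -> : g s - g t = (g s - u k s) + ((u k s - u k t) + (u k t - g t)).
    by rewrite !addrA !subrK.
  apply: le_lt_trans (ler_normD _ _) _.
  have {1}-> : e = e / 3 + (e / 3 + e / 3) by field.
  apply: ltrD; first by rewrite distrC (le_lt_trans (Hg s k)).
  apply: le_lt_trans (ler_normD _ _) _.
  by apply: ltrD => //; exact: le_lt_trans (Hg t k) _.
exists g; split=> //; apply/funext => s; apply/eqP; rewrite -subr_eq0 -normr_le0.
apply/ler_addgt0Pl => e e0; rewrite addr0.
have e2 : 0 < e / 2 by rewrite divr_gt0.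
have [k Hk] := expr_small C q01 e2.
rewrite -(subrKA (T (u k) s)); apply: le_trans (ler_normD _ _) _.
have C0 : 0 <= C * q ^+ k by exact: le_trans (normr_ge0 _) (Hg 0 k).
rewrite [leRHS]splitr; apply: lerD; apply: le_trans (ltW Hk).
  rewrite distrC; apply: le_trans (Tq (cu k) cg (Hg ^~ k) s) _.
  by rewrite -/C; nra.
apply: le_trans (Hg s k.+1) _; rewrite -/C exprS.
by rewrite mulrCA; nra.
Qed.

End uniform_contraction.

Section scalar_ode.
Variables (R : realType) (n : nat).

Lemma is_derive_rowP (g dg : R -> 'rV[R]_n) s :
  is_derive s (1 : R) g (dg s) <->
  forall i, is_derive s (1 : R) (fun t => g t ord0 i) (dg s ord0 i).
Proof.
split=> [[d <-] i|D].
  apply: DeriveDef; first exact/(derivable_mxP _ _ _).1.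
  by rewrite derive_mx// mxE.
have d : derivable g s 1.
  by apply/derivable_mxP => i j; rewrite [i]ord1; case: (D j).
apply: DeriveDef => //; rewrite derive_mx//; apply/rowP => i.
by rewrite mxE; case: (D i).
Qed.

Lemma norm_le_derive_row (F f : R -> 'rV[R]_n) (c : R) : F 0 = 0 -> 0 <= c ->
  (forall s : R, 0 <= s <= 1 -> is_derive s (1 : R) F (f s)) ->
  (forall s : R, 0 <= s <= 1 -> `|f s| <= c) -> forall s : R, 0 <= s <= 1 -> `|F s| <= c.
Proof.
move=> F0 c0 dF fc s s01; apply: row_norm_le => // i.
apply: (@norm_le_derive R (fun t => F t ord0 i) (fun t => f t ord0 i)) => //.
- by rewrite F0 mxE.
- by move=> t t01; exact: (is_derive_rowP _ _ _).1 (dF t t01) i.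
- by move=> t t01; apply: le_trans (fc t t01); exact: coord_norm_le.
Qed.

Lemma primitive_row (g : R -> 'rV[R]_n) : continuous g -> exists F : R -> 'rV[R]_n,
  F 0 = 0 /\ forall s : R, 0 <= s <= 1 -> is_derive s (1 : R) F (g s).
Proof.
move=> cg.
have H i : exists F : R -> R, F 0 = 0 /\
    forall s : R, 0 <= s <= 1 -> is_derive s (1 : R) F (g s ord0 i).
  by apply: (@primitive R (fun s => g s ord0 i)) => s; exact: (continuous_comp (cg s) (@coord_continuous _ _ _ _ _ _)).
have [F HF] := choice H; exists (fun s => \row_i F i s); split.
  by apply/rowP => i; rewrite !mxE; case: (HF i).
move=> s s01; apply/is_derive_rowP => i.
under eq_fun do rewrite mxE; exact: (HF i).2.
Qed.

(** Over a time interval of length one, a Lipschitz constant [q < 1] makes the Picard operator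
    itself a contraction for the uniform distance, so the solution on [0, 1] is obtained at once,
    without gluing. *)
Lemma ode_exists (G : 'rV[R]_n -> 'rV[R]_n) (x0 : 'rV[R]_n) (q : R) : 0 <= q < 1 ->
  (forall x y, `|G x - G y| <= q * `|x - y|) ->
  exists g : R -> 'rV[R]_n, g 0 = x0 /\
    forall s : R, 0 <= s <= 1 -> is_derive s (1 : R) g (G (g s)).
Proof.
move=> q01 Gq; case/andP: (q01) => q0 q1.
have cG : continuous G.
  move=> x; apply: continuous_dist => e e0.
  near=> y; apply: le_lt_trans (Gq x y) _; apply: (@le_lt_trans _ _ (1 * `|x - y|)).
    by rewrite ler_wpM2r// ltW.
  by rewrite mul1r; near: y; apply: filterS (nbhsx_ballx x e e0) => z; rewrite -ball_normE.
(* Primitives are chosen for all [g] at once; a discontinuous [g] receives the zero function, about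
   which nothing is claimed. *)
have H (g : R -> 'rV[R]_n) : exists F : R -> 'rV[R]_n, continuous g ->
    F 0 = 0 /\ forall s : R, 0 <= s <= 1 -> is_derive s (1 : R) F (G (g s)).
  have [cg|] := pselect (continuous g); last by exists (fun=> 0).
  have [|F HF] := @primitive_row (G \o g); last by exists F.
  by move=> s; apply: continuous_comp; [exact: cg|exact: cG].
have [P HP] := choice H.
(* The Picard operator. The primitive is controlled on [0, 1] only; [clamp01] makes [T g] continuous
   on the whole line and turns bounds on [0, 1] into uniform ones. *)
pose T g := fun s => x0 + P g (clamp01 s).
have Tc g : continuous g -> continuous (T g).
  move=> cg s; apply: continuousD; first exact: cst_continuous.
  apply: continuous_comp; first exact: clamp01_continuous.
  have [_ /(_ _ (clamp01_itv s)) []] := HP g cg.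
  by move=> /derivable1_diffP /differentiable_continuous.
have Tq f g c : continuous f -> continuous g ->
    (forall s, `|f s - g s| <= c) -> forall s, `|T f s - T g s| <= q * c.
  move=> cf cg fg s; rewrite /T opprD addrACA subrr add0r.
  have [f0 df] := HP f cf; have [g0 dg] := HP g cg.
  apply: (@norm_le_derive_row (P f - P g) (fun s => G (f s) - G (g s))).
  - by rewrite -[LHS]/(P f 0 - P g 0) f0 g0 subr0.
  - by rewrite mulr_ge0//; exact: le_trans (normr_ge0 _) (fg 0).
  - by move=> t t01; apply: is_deriveB; [exact: df|exact: dg].
  - by move=> t t01; apply: le_trans (Gq _ _) _; rewrite ler_wpM2l.
  - exact: clamp01_itv.
have c0 : continuous (fun _ : R => x0) by move=> s; exact: cvg_cst.
have [s|g [cg Tg]] := @contraction_fixpoint R n T q q01 Tc Tq _ `|G x0| c0.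
  rewrite /T addrC addKr; have [P0 dP] := HP _ c0.
  apply: (norm_le_derive_row P0 (normr_ge0 _) dP) => //; exact: clamp01_itv.
have [P0 dP] := HP g cg.
exists (fun s => x0 + P g s); split; first by rewrite P0 addr0.
move=> s s01.
have -> : x0 + P g s = g s by rewrite -[g in RHS]Tg /T clamp01_id.
have := is_deriveD (is_derive_cst x0 s 1) (dP s s01).
by rewrite add0r.
Unshelve. all: by end_near. Qed.

(** On an interval of length one with [q < 1], the usual exponential gives way to evaluation at a
    point [c] where the norm of [phi] is maximal: the mean value bound yields
    [|phi c| <= q * |phi c| + e]. *)
Lemma gronwall_row (phi dphi : R -> 'rV[R]_n) (q e : R) : 0 <= q < 1 -> 0 <= e ->
  phi 0 = 0 ->
  (forall s : R, 0 <= s <= 1 -> is_derive s (1 : R) phi (dphi s)) ->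
  (forall s : R, 0 <= s <= 1 -> `|dphi s| <= q * `|phi s| + e) ->
  forall s : R, 0 <= s <= 1 -> `|phi s| <= e / (1 - q).
Proof.
move=> /andP[q0 q1] e0 phi0 D B.
have cphi : {within `[0, 1], continuous (fun s => `|phi s|)}.
  have C : {within `[0, 1], continuous phi}.
    by apply: derivable_within_continuous => s; rewrite in_itv/= => /D [].
  by move=> s; apply: continuous_comp; [exact: C|exact: norm_continuous].
have [c c01 mc] := EVT_max ler01 cphi.
have b s : 0 <= s <= 1 -> `|phi s| <= `|phi c|.
  by move=> s01; apply: mc; rewrite in_itv.
have : `|phi c| <= q * `|phi c| + e.
  apply: (norm_le_derive_row phi0 _ D); last by rewrite in_itv in c01.
    by rewrite addr_ge0// mulr_ge0.
  move=> s s01; apply: le_trans (B s s01) _.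
  by rewrite lerD2r ler_wpM2l// b.
move=> h s s01; apply: le_trans (b s s01) _.
rewrite ler_pdivlMr ?subr_gt0//; lra.
Qed.

End scalar_ode.

(** * Flows of commuting fields *)

(** The form in which differentiability of the flow is established: a quadratic remainder is
    negligible against the increment, which identifies the differential. *)
Lemma quadratic_differentiable (R : realType) (V W : normedModType R)
    (f : V -> W) (x : V) (l : {linear V -> W}) (C : R) : continuous l ->
  (\forall y \near x, `|f y - f x - l (y - x)| <= C * `|y - x| ^+ 2) ->
  differentiable f x /\ 'd f x = l :> (V -> W).
Proof.
move=> cl H.
have E : f \o shift x = cst (f x) + l +o_ 0 id.
  apply/eqaddoP => _/posnumP[e].
  have C0 : 0 < `|C| + 1 by rewrite ltr_wpDl.
  have eC : 0 < e%:num / (`|C| + 1) by rewrite divr_gt0.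
  have H0 : \forall y \near 0, `|f (y + x) - f x - l (y + x - x)| <= C * `|y + x - x| ^+ 2.
    by move: H; rewrite (near_shift 0) subr0.
  have H1 : \forall y \near 0, `|y : V| < e%:num / (`|C| + 1).
    by apply: filterS (nbhsx_ballx (0 : V) _ eC) => z; rewrite -ball_normE /= sub0r normrN.
  apply: filterS2 H0 H1 => y Hy Hs.
  have -> : (f \o shift x - (cst (f x) + l)) y = f (y + x) - f x - l (y + x - x).
    by rewrite addrK -addrA -opprD.
  apply: le_trans Hy _; rewrite addrK expr2 mulrA ler_wpM2r//.
  apply: (@le_trans _ _ ((`|C| + 1) * `|y|)).
    by rewrite ler_wpM2r//; have := ler_norm C; lra.
  by rewrite mulrC -ler_pdivlMr// ltW.
have dl := diff_unique cl E; split=> //.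
by apply/diff_locallyP; rewrite dl.
Qed.

Lemma is_derive_comp_diff (R : realType) (V W : normedModType R) (F : V -> W)
    (g : R -> V) (dg : V) s : differentiable F (g s) -> is_derive s (1 : R) g dg ->
  is_derive s (1 : R) (F \o g) ('d F (g s) dg).
Proof.
move=> dF [/derivable1_diffP dgs <-].
have dFg := differentiable_comp dgs dF.
apply: DeriveDef; first exact: diff_derivable.
by rewrite deriveE// diff_comp//= deriveE.
Qed.

Section linear_combination.
Variables (R : realType) (m n : nat).

Lemma mulmx_row_norm_le (y : 'rV[R]_m) (a : 'I_m -> 'rV[R]_n) (c : R) :
  (forall k, `|a k| <= c) -> `|y *m (\matrix_k a k)| <= m%:R * `|y| * c.
Proof.
move=> ac; rewrite mulmx_sum_row.
apply: le_trans (ler_norm_sum _ _ _) _.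
apply: (@le_trans _ _ (\sum_(i < m) (`|y| * c))).
  apply: ler_sum => k _; rewrite rowK normrZ ler_pM//; exact: coord_norm_le.
by rewrite sumr_const card_ord -mulrA [leRHS]mulrC mulr_natr.
Qed.

Lemma linear_combination (W : lmodType R) (f : {linear 'rV[R]_n -> W}) (y : 'rV[R]_m)
    (a : 'I_m -> 'rV[R]_n) :
  f (y *m (\matrix_k a k)) = \sum_k y ord0 k *: f (a k).
Proof.
by rewrite mulmx_sum_row linear_sum; apply: eq_bigr => k _; rewrite linearZ rowK.
Qed.

Lemma symmetric_sum_swap (V : lmodType R) (D : 'I_m -> 'I_m -> V) (u v : 'rV[R]_m) :
  (forall k l, D k l = D l k) ->
  \sum_k u ord0 k *: (\sum_l v ord0 l *: D k l) =
  \sum_k v ord0 k *: (\sum_l u ord0 l *: D k l).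
Proof.
move=> DC; under eq_bigr do rewrite scaler_sumr.
rewrite exchange_big; apply: eq_bigr => l _; rewrite scaler_sumr.
by apply: eq_bigr => k _; rewrite !scalerA DC mulrC.
Qed.

Lemma mulmxr_continuous (A : 'M[R]_(m, n)) : continuous (fun v : 'rV[R]_m => v *m A).
Proof.
move=> v; apply: (@continuous_row R n 'rV[R]_m) => i.
have -> : (fun y : 'rV[R]_m => (y *m A) ord0 i) = fun y : 'rV[R]_m => \sum_j (y ord0 j * A j i).
  by apply/funext => y; rewrite mxE.
have C : Ck 0 setT (fun y : 'rV[R]_m => \sum_j (y ord0 j * A j i)).
  apply: Ck_sum => [|j _]; first exact: openT.
  by apply: Ck_mul; [exact: openT|exact: Ck_coord|exact: Ck_cst].
exact: C v I.
Qed.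

End linear_combination.

Lemma is_derive_scale_id (R : realType) n (h : R -> 'rV[R]_n) dh (s : R) :
  is_derive s (1 : R) h dh ->
  is_derive s (1 : R) (fun t => t *: h t) (s *: dh + h s).
Proof.
move=> D; apply/(is_derive_rowP _ (fun s => s *: dh + h s)) => i.
have {}D := (is_derive_rowP h (fun=> dh) s).1 D i.
have -> : (fun t => (t *: h t) ord0 i) = id * (fun t => h t ord0 i).
  by apply/funext => t; rewrite mxE.
apply: is_derive_eq; rewrite !mxE /=.
by rewrite -[_%:A]/(_ * 1) mulr1.
Qed.

Section commuting_flow.
Variables (R : realType) (m n : nat).
Variables (F : 'I_m -> 'rV[R]_n -> 'rV[R]_n) (x0 : 'rV[R]_n) (delta K L Q r : R).
Hypotheses (delta0 : 0 < delta) (K0 : 0 <= K) (L0 : 0 <= L) (Q0 : 0 <= Q).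
Hypotheses (r0 : 0 < r) (rL : m%:R * r * L <= 2^-1) (rK : m%:R * r * K <= delta).
Let cube := [set x : 'rV[R]_n | `|x - x0| <= delta].
Hypothesis FK : forall k x, cube x -> `|F k x| <= K.
Hypothesis FL : forall k x y, cube x -> cube y -> `|F k y - F k x| <= L * `|y - x|.
Hypothesis dF : forall k x, cube x -> differentiable (F k) x.
Hypothesis dFL : forall k x v, cube x -> `|'d (F k) x v| <= L * `|v|.
Hypothesis FQ : forall k x y, cube x -> cube y ->
  `|F k y - F k x - 'd (F k) x (y - x)| <= Q * `|y - x| ^+ 2.
Hypothesis FC : forall k l x, cube x -> 'd (F k) x (F l x) = 'd (F l) x (F k x).

(** Truncation to the cube extends the fields to globally Lipschitz ones, for which the differential
    equation is solvable. The solution is seen afterwards to stay in the cube, where truncation is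
    the identity. *)
Let clamp1 (a t : R) := Num.max (a - delta) (Num.min t (a + delta)).
Let clamp (x : 'rV[R]_n) : 'rV[R]_n := \row_i clamp1 (x0 ord0 i) (x ord0 i).

Lemma clamp_lipschitz x y : `|clamp x - clamp y| <= `|x - y|.
Proof.
apply: row_norm_le => // i; apply: le_trans (coord_norm_le (x - y) i).
rewrite !mxE /clamp1; set a := x0 _ _; set s := x _ _; set t := y _ _.
have := ler_norm (s - t); have := ler_norm (t - s); rewrite distrC => h1 h2.
rewrite ler_norml; have := delta0 => d0; apply/andP.
rewrite /Order.max /Order.min.
by do !case: ifPn; do 4 ?rewrite -leNgt; move=> *; split; lra.
Qed.

Lemma clamp_cube x : cube (clamp x).
Proof.
apply: row_norm_le => [|i]; first exact: ltW.
rewrite !mxE /clamp1; set a := x0 _ _; set s := x _ _.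
rewrite ler_norml; have := delta0 => d0; apply/andP.
rewrite /Order.max /Order.min.
by do !case: ifPn; do 2 ?rewrite -leNgt; move=> *; split; lra.
Qed.

Lemma clamp_id x : cube x -> clamp x = x.
Proof.
move=> cx; apply/rowP => i; rewrite mxE /clamp1.
have := le_trans (coord_norm_le _ i) cx; rewrite !mxE ler_norml => /andP[h1 h2].
by rewrite min_l ?max_r//; lra.
Qed.

(** The field that drives the ray of [y], namely the sum of the [y_k F_k], written as a matrix
    product so that linearity in [y] comes from matrix algebra. *)
Let lc (y : 'rV[R]_m) (x : 'rV[R]_n) := y *m (\matrix_k F k x).

Lemma lc_le y x : cube x -> `|lc y x| <= m%:R * `|y| * K.
Proof. by move=> cx; apply: mulmx_row_norm_le => k; exact: FK. Qed.

Lemma lcB y z x : lc (y - z) x = lc y x - lc z x.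
Proof. by rewrite /lc mulmxBl. Qed.

Lemma lc_subE y x x' : lc y x - lc y x' = y *m (\matrix_k (F k x - F k x')).
Proof. by rewrite /lc -mulmxBr; congr (_ *m _); apply/matrixP => k i; rewrite !mxE. Qed.

Lemma lc_lip y x x' : cube x -> cube x' ->
  `|lc y x - lc y x'| <= m%:R * `|y| * (L * `|x - x'|).
Proof. by move=> cx cx'; rewrite lc_subE; apply: mulmx_row_norm_le => k; exact: FL. Qed.

(** Here commutation of the fields enters the flow estimate: both sides are the double sum of
    [d_k x_l] times the differential of [F k] along [F l], and this differential is symmetric in [k]
    and [l] by [FC]. *)
Lemma diff_swap (x d : 'rV[R]_m) z : cube z ->
  d *m (\matrix_k 'd (F k) z (lc x z)) = x *m (\matrix_k 'd (F k) z (lc d z)).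
Proof.
move=> cz.
have E (u v : 'rV[R]_m) : u *m (\matrix_k 'd (F k) z (lc v z)) =
    \sum_k u ord0 k *: (\sum_l v ord0 l *: 'd (F k) z (F l z)).
  rewrite mulmx_sum_row; apply: eq_bigr => k _; rewrite rowK; congr (_ *: _).
  exact: linear_combination.
by rewrite !E; apply: symmetric_sum_swap => k l; exact: FC.
Qed.

Lemma m_norm_L (y : 'rV[R]_m) : `|y| <= r -> m%:R * `|y| * L <= 2^-1.
Proof. by move=> yr; apply: le_trans rL; rewrite ler_wpM2r// ler_wpM2l. Qed.

(** Both smallness conditions on [r] act here: [rL] gives the truncated field the Lipschitz constant
    1/2, and [rK] keeps its solution within [delta] of [x0] for a unit of time, so that truncation
    has no effect on it. The condition on [y] stands under the existential so that [choice] can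
    select a ray for every [y]. *)
Lemma ray_exists (y : 'rV[R]_m) : exists g : R -> 'rV[R]_n, `|y| <= r -> g 0 = x0 /\
  forall s : R, 0 <= s <= 1 -> cube (g s) /\ is_derive s (1 : R) g (lc y (g s)).
Proof.
have [yr|] := pselect (`|y| <= r); last by exists (fun=> 0).
pose G x := lc y (clamp x).
have q01 : 0 <= (2^-1 : R) < 1 by rewrite invr_ge0 ler0n invf_lt1// ltr1n.
have Gq x x' : `|G x - G x'| <= 2^-1 * `|x - x'|.
  apply: le_trans (lc_lip _ (clamp_cube _) (clamp_cube _)) _.
  rewrite mulrA; apply: ler_pM => //; [by rewrite !mulr_ge0|exact: m_norm_L|].
  exact: clamp_lipschitz.
have [g [g0 dg]] := ode_exists x0 q01 Gq; exists g => _; split=> // s s01.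
have cg : cube (g s).
  rewrite /cube/=.
  apply: (@norm_le_derive_row R n (fun s => g s - x0) (fun s => G (g s)) delta) => //.
  - by rewrite g0 subrr.
  - exact: ltW.
  - move=> t t01; have := is_deriveB (dg t t01) (is_derive_cst x0 t 1).
    by rewrite subr0.
  - move=> t _; apply: le_trans (lc_le _ (clamp_cube _)) _; apply: le_trans rK.
    by rewrite ler_wpM2r// ler_wpM2l.
by split=> //; have := dg s s01; rewrite /G clamp_id.
Qed.

(* Phi(y) is the endpoint of the ray of y; phi below is the remainder of its
   first-order expansion at x. *)
Lemma flow_exists : exists Phi : 'rV[R]_m -> 'rV[R]_n, Phi 0 = x0 /\
  forall x, `|x| < r -> [/\ cube (Phi x), differentiable Phi x &
    forall v, 'd Phi x v = lc v (Phi x)].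
Proof.
have q01 : 0 <= (2^-1 : R) < 1 by rewrite invr_ge0 ler0n invf_lt1// ltr1n.
have i01 : 0 <= (1 : R) <= 1 by rewrite ler01 lexx.
have [g Hg] := choice ray_exists; exists (g ^~ 1); split.
  have [|g0 Dg] := Hg 0; first by rewrite normr0 ltW.
  have := @norm_le_derive_row R n (fun s => g 0 s - x0) (fun s => lc 0 (g 0 s)) 0.
  move=> /(_ _ (lexx 0) _ _ 1 i01); rewrite normr_le0 subr_eq0 => H; apply/eqP/H.
  - by rewrite g0 subrr.
  - move=> s s01; have := is_deriveB (Dg s s01).2 (is_derive_cst x0 s 1).
    by rewrite subr0.
  - by move=> s s01; rewrite /lc mul0mx normr0.
move=> x xr; have [gx0 gx] := Hg x (ltW xr).
have cx s : 0 <= s <= 1 -> cube (g x s) by case/gx.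
(* [C1] bounds the spread of two rays and [C2] the remainder, both relative to powers of the
   parameter difference; the leading 2 is the Gronwall factor 1 / (1 - 1/2). *)
pose C1 : R := 2 * (m%:R * K).
pose C2 : R := 2 * (m%:R * (L * C1) + m%:R * r * (Q * C1 ^+ 2)).
have C10 : 0 <= C1 by rewrite !mulr_ge0.
have half : (1 - 2^-1 : R)^-1 = 2 by field.
have key y : `|y| < r -> `|g y 1 - g x 1 - lc (y - x) (g x 1)| <= C2 * `|y - x| ^+ 2.
  move=> yr; have [gy0 gy] := Hg y (ltW yr).
  have cy s : 0 <= s <= 1 -> cube (g y s) by case/gy.
  pose d := y - x; pose D s := g y s - g x s.
  have D0 : D 0 = 0 by rewrite /D gy0 gx0 subrr.
  have dD (s : R) : 0 <= s <= 1 -> is_derive s (1 : R) D (lc y (g y s) - lc x (g x s)).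
    by move=> s01; apply: is_deriveB; [exact: (gy s s01).2|exact: (gx s s01).2].
  have hD s : 0 <= s <= 1 -> `|D s| <= C1 * `|d|.
    move=> s01; have := gronwall_row q01 _ D0 dD _ s01.
    move=> /(_ (m%:R * `|d| * K)); rewrite half /C1 => H.
    have -> : 2 * (m%:R * K) * `|d| = m%:R * `|d| * K * 2 by ring.
    apply: H => [|t t01]; first by rewrite !mulr_ge0.
    have -> : lc y (g y t) - lc x (g x t) = (lc x (g y t) - lc x (g x t)) + lc d (g y t).
      by rewrite /d lcB [RHS]addrC addrA subrK.
    apply: le_trans (ler_normD _ _) _; apply: lerD; last exact/lc_le/cy.
    apply: le_trans (lc_lip _ (cy _ t01) (cx _ t01)) _.
    by rewrite mulrA ler_wpM2r// m_norm_L// ltW.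
  pose phi s := D s - s *: lc d (g x s).
  have phi0 : phi 0 = 0 by rewrite /phi D0 scale0r subr0.
  pose dlc s : 'rV[R]_n := d *m (\matrix_k 'd (F k) (g x s) (lc x (g x s))).
  have dphi (s : R) : 0 <= s <= 1 -> is_derive s (1 : R) phi
     (lc y (g y s) - lc x (g x s) - (s *: dlc s + lc d (g x s))).
    move=> s01; apply: is_deriveB; first exact: dD.
    have H : is_derive s (1 : R) (fun t => lc d (g x t)) (dlc s).
      have -> : (fun t => lc d (g x t)) = \sum_(k < m) (d ord0 k \*: (F k \o g x)).
        by apply/funext => t; rewrite fct_sumE /lc mulmx_sum_row; apply: eq_bigr => k _; rewrite rowK.
      rewrite /dlc mulmx_sum_row; apply: is_derive_sum => k; rewrite rowK.
      apply: is_deriveZ; apply: is_derive_comp_diff; first exact/dF/cx.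
      exact: (gx s s01).2.
    exact: is_derive_scale_id.
  have hphi s : 0 <= s <= 1 -> `|phi s| <= C2 * `|d| ^+ 2.
    move=> s01; have := gronwall_row q01 _ phi0 dphi _ s01.
    move=> /(_ ((m%:R * (L * C1) + m%:R * r * (Q * C1 ^+ 2)) * `|d| ^+ 2)); rewrite half => H.
    rewrite /C2 -mulrA mulrC; apply: H => [|t t01].
      by rewrite mulr_ge0 ?exprn_ge0// addr_ge0// !mulr_ge0// ?exprn_ge0// ltW.
    (* The derivative of [phi] splits into a part linear in [phi], absorbed by Gronwall, and two
       errors of order [|d| ^+ 2]: the variation of [lc d] between the rays and the Taylor remainder
       of the fields. It is [diff_swap] that rewrites [dlc t] so that it combines with the linear
       term in [D t] into one in [phi t]. *)
    have -> : lc y (g y t) - lc x (g x t) - (t *: dlc t + lc d (g x t)) =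
       x *m (\matrix_k 'd (F k) (g x t) (phi t)) + ((lc d (g y t) - lc d (g x t)) +
       x *m (\matrix_k (F k (g y t) - F k (g x t) - 'd (F k) (g x t) (D t)))).
      have -> : dlc t = x *m (\matrix_k 'd (F k) (g x t) (lc d (g x t))).
        by apply: diff_swap; exact: cx.
      have -> : (\matrix_k 'd (F k) (g x t) (phi t)) = (\matrix_k 'd (F k) (g x t) (D t)) -
          t *: (\matrix_k 'd (F k) (g x t) (lc d (g x t))).
        by apply/matrixP => k i; rewrite /phi !mxE linearB linearZ !mxE.
      have -> : (\matrix_k (F k (g y t) - F k (g x t) - 'd (F k) (g x t) (D t))) =
          (\matrix_k F k (g y t)) - (\matrix_k F k (g x t)) -
          (\matrix_k 'd (F k) (g x t) (D t)).
        by apply/matrixP => k i; rewrite !mxE.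
      rewrite /lc /d !mulmxBr !mulmxBl -scalemxAr.
      by apply/rowP => i; rewrite !mxE; ring.
    apply: le_trans (ler_normD _ _) _; apply: lerD.
      apply: le_trans (mulmx_row_norm_le _ _) _.
        by move=> k; apply: dFL; exact: cx.
      by rewrite mulrA ler_wpM2r// m_norm_L// ltW.
    apply: le_trans (ler_normD _ _) _; rewrite mulrDl; apply: lerD.
      apply: le_trans (lc_lip _ (cy _ t01) (cx _ t01)) _.
      have := hD t t01; rewrite -/(D t) => h.
      have -> : m%:R * (L * C1) * `|d| ^+ 2 = m%:R * `|d| * (L * (C1 * `|d|)) by ring.
      by rewrite ler_wpM2l ?mulr_ge0// ler_wpM2l.
    apply: le_trans (mulmx_row_norm_le _ (c := Q * (C1 * `|d|) ^+ 2) _) _.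
      move=> k; apply: le_trans (FQ k (cx _ t01) (cy _ t01)) _.
      by rewrite ler_wpM2l// lerXn2r ?nnegrE ?mulr_ge0//; exact: hD.
    have -> : m%:R * `|x| * (Q * (C1 * `|d|) ^+ 2) = `|x| * (m%:R * (Q * C1 ^+ 2) * `|d| ^+ 2).
      by ring.
    have -> : m%:R * r * (Q * C1 ^+ 2) * `|d| ^+ 2 = r * (m%:R * (Q * C1 ^+ 2) * `|d| ^+ 2).
      by ring.
    by rewrite ler_wpM2r ?(ltW xr)// !mulr_ge0 ?exprn_ge0.
  by have := hphi 1 i01; rewrite /phi scale1r.
have [] := @quadratic_differentiable R _ _ (g ^~ 1) x (mulmxr (\matrix_k F k (g x 1))) C2.
- exact: mulmxr_continuous.
- near=> y; apply: key; near: y.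
  have rx : 0 < r - `|x| by rewrite subr_gt0.
  apply: filterS (nbhsx_ballx x _ rx) => y; rewrite -ball_normE/= => yx.
  by rewrite -(subrK x y) (le_lt_trans (ler_normD _ _))// -ltrBrDr distrC.
by move=> dPhi EPhi; split=> //; [exact: cx|move=> v; rewrite EPhi].
Unshelve. all: by end_near. Qed.

End commuting_flow.

(** * Uniform bounds and Taylor estimates on a cube *)

Section cube_estimates.
Variables (R : realType) (n : nat).
Variables (x0 : 'rV[R]_n) (delta : R).
Hypothesis delta0 : 0 < delta.
Let cube := [set x : 'rV[R]_n | `|x - x0| <= delta].

Lemma cube_compact : compact cube.
Proof.
have -> : cube = closed_ball_ Num.Def.normr x0 delta.
  by apply/seteqP; split=> x; rewrite /cube /closed_ball_/= distrC.
apply: bounded_closed_compact; last exact: closed_closed_ball_.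
exists (delta + `|x0|); split=> [|M /ltW MM x]; first exact: num_real.
rewrite /closed_ball_/= distrC => xd; apply: le_trans MM.
by rewrite -{1}(subrK x0 x) (le_trans (ler_normD _ _))// lerD2r.
Qed.

Lemma cube_bounded (f : 'rV[R]_n -> R) : (forall x, cube x -> {for x, continuous f}) ->
  exists2 C, 0 <= C & forall x, cube x -> `|f x| <= C.
Proof.
move=> cf.
have cnf : {within cube, continuous (fun x => `|f x|)}.
  apply: continuous_in_subspaceT => x; rewrite inE => cx.
  by apply: continuous_comp; [exact: cf|exact: norm_continuous].
have c0 : cube !=set0 by exists x0; rewrite /cube/= subrr normr0 ltW.
have [c _ Hc] := EVT_max_rV c0 cube_compact cnf.
by exists `|f c| => // x cx; apply: Hc; rewrite inE.
Qed.

Lemma cube_bounded_family (I : finType) (f : I -> 'rV[R]_n -> R) :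
  (forall i x, cube x -> {for x, continuous (f i)}) ->
  exists2 C, 0 <= C & forall i x, cube x -> `|f i x| <= C.
Proof.
move=> cf.
have H i : exists C, 0 <= C /\ forall x, cube x -> `|f i x| <= C.
  by have [C C0 HC] := cube_bounded (cf i); exists C.
have [C HC] := choice H; exists (\sum_i C i).
  by apply: sumr_ge0 => i _; case: (HC i).
move=> i x cx; apply: le_trans ((HC i).2 x cx) _.
by rewrite (bigD1 i)//= lerDl sumr_ge0// => j _; case: (HC j).
Qed.

Lemma cube_convex (x y : 'rV[R]_n) (c : R) : cube x -> cube y -> 0 <= c <= 1 ->
  cube (x + c *: (y - x)).
Proof.
move=> cx cy /andP[c0 c1].
have -> : x + c *: (y - x) = (1 - c) *: (x - x0) + c *: (y - x0) + x0.
  by apply/rowP => i; rewrite !mxE; ring.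
rewrite /cube/= addrK; apply: le_trans (ler_normD _ _) _; rewrite !normrZ.
have c1' : 0 <= 1 - c by rewrite subr_ge0.
rewrite (ger0_norm c0) (ger0_norm c1').
have -> : delta = (1 - c) * delta + c * delta by ring.
by apply: lerD; rewrite ler_wpM2l.
Qed.

Variables (A : set 'rV[R]_n) (f : 'rV[R]_n -> R) (C : R).
Hypotheses (oA : open A) (cubeA : cube `<=` A) (Cf : Ck 2 A f) (C0 : 0 <= C).
Hypothesis C1 : forall a x, cube x -> `|'D_('e_a) f x| <= C.
Hypothesis C2 : forall a b x, cube x -> `|'D_('e_b) ('D_('e_a) f) x| <= C.

Lemma sum_coord_le (v : 'rV[R]_n) (a : 'I_n -> R) (B : R) : 0 <= B ->
  (forall i, `|a i| <= B) -> `|\sum_i v ord0 i * a i| <= n%:R * `|v| * B.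
Proof.
move=> B0 aB; apply: le_trans (ler_norm_sum _ _ _) _.
apply: (@le_trans _ _ (\sum_(i < n) (`|v| * B))).
  by apply: ler_sum => k _; rewrite normrM ler_pM//; exact: coord_norm_le.
by rewrite sumr_const card_ord -mulrA [leRHS]mulrC mulr_natr.
Qed.

Let df x : cube x -> differentiable f x.
Proof. by move=> /cubeA; exact: Cf.1. Qed.

Lemma cube_derive_le v x : cube x -> `|'D_v f x| <= n%:R * `|v| * C.
Proof.
move=> cx; rewrite derive_sum_delta; last exact: df.
by apply: sum_coord_le => // i; exact: C1.
Qed.

Lemma cube_lipschitz x y : cube x -> cube y -> `|f y - f x| <= n%:R * `|y - x| * C.
Proof.
move=> cx cy.
have [s s01|c /andP[c0 c1]] := @MVT_line R _ f x (y - x) 1 ltr01.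
  exact/df/cube_convex.
rewrite scale1r [x + (y - x)]addrC subrK mul1r => ->.
by apply/cube_derive_le/cube_convex => //; rewrite !ltW.
Qed.

Lemma cube_derive2_le v x : cube x -> `|'D_v ('D_v f) x| <= n%:R * `|v| * (n%:R * `|v| * C).
Proof.
move=> cx; have Ax := cubeA cx; rewrite derive_sum_delta; last exact: (Cf.2 v).1.
apply: sum_coord_le => [|i]; first by rewrite !mulr_ge0.
(* Symmetry moves the basis direction inside, so that the remaining derivative along [v] can be
   expanded in the basis as well. *)
rewrite (derive_symmetric v _ oA Ax Cf) derive_sum_delta; last exact: (Cf.2 _).1.
by apply: sum_coord_le => // j; exact: C2.
Qed.

(** Two mean values along the segment leave [c * 'D_v ('D_v f)] with [v = y - x] and [0 < c < 1];
    both evaluation points stay in the convex cube. *)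
Lemma cube_taylor x y : cube x -> cube y ->
  `|f y - f x - 'D_(y - x) f x| <= n%:R ^+ 2 * C * `|y - x| ^+ 2.
Proof.
move=> cx cy; set v := y - x.
have [s s01|c /andP[c0 c1]] := @MVT_line R _ f x v 1 ltr01.
  exact/df/cube_convex.
rewrite scale1r {1}/v [x + (y - x)]addrC subrK mul1r => ->.
have cc s : 0 <= s <= c -> 0 <= s <= 1.
  by move=> /andP[-> h]; rewrite (le_trans h)// ltW.
have [s sc|e /andP[e0 ec]] := @MVT_line R _ ('D_v f) x v c c0.
  by apply: (Cf.2 v).1; apply/cubeA/cube_convex => //; exact: cc.
move=> ->; rewrite normrM (gtr0_norm c0).
apply: (@le_trans _ _ (1 * (n%:R * `|v| * (n%:R * `|v| * C)))); last first.
  by rewrite mul1r le_eqVlt; apply/orP; left; apply/eqP; ring.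
apply: ler_pM => //; [exact: ltW|exact: ltW|].
by apply/cube_derive2_le/cube_convex => //; apply: cc; rewrite !ltW.
Qed.

End cube_estimates.

(** Provides the constants of [flow_exists]: a closed cube inside [A] is compact, so the fields and
    their derivatives of orders one and two are bounded on it, which yields [K], [L] and [Q]; the
    radius [r] is chosen last. *)
Lemma commuting_flow (R : realType) (m n : nat) (F : 'I_m -> 'rV[R]_n -> 'rV[R]_n)
    (A : set 'rV[R]_n) (x0 : 'rV[R]_n) : open A -> A x0 ->
  (forall k i, Ck 2 A (fun x => F k x ord0 i)) ->
  (forall x, A x -> forall k l, 'd (F k) x (F l x) = 'd (F l) x (F k x)) ->
  exists2 r, 0 < r & exists Phi : 'rV[R]_m -> 'rV[R]_n, Phi 0 = x0 /\
    forall x, `|x| < r -> [/\ A (Phi x), differentiable Phi x &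
      forall v, 'd Phi x v = v *m (\matrix_k F k (Phi x))].
Proof.
move=> oA Ax0 CF FC.
have /(nbhs_ballP _ _)[d d0 dA] : nbhs x0 A by exact: open_nbhs_nbhs.
pose delta := d / 2; have delta0 : 0 < delta by rewrite divr_gt0.
pose cube := [set x : 'rV[R]_n | `|x - x0| <= delta].
have cubeA : cube `<=` A.
  move=> x cx; apply: dA; rewrite -ball_normE/= distrC (le_lt_trans cx)//.
  by rewrite /delta ltr_pdivrMr// mulr_natr mulr2n ltrDl.
pose f (k : 'I_m * 'I_n) := fun x => F k.1 x ord0 k.2.
have [Ca Ca0 HCa] : exists2 C, 0 <= C & forall k x, cube x -> `|f k x| <= C.
  apply: cube_bounded_family => // k x /cubeA Ax.
  exact/differentiable_continuous/(CF k.1 k.2).1.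
have [Cb Cb0 HCb] : exists2 C, 0 <= C & forall (k : ('I_m * 'I_n) * 'I_n) x, cube x ->
    `|'D_('e_(k.2)) (f k.1) x| <= C.
  apply: cube_bounded_family => // k x /cubeA Ax.
  exact/differentiable_continuous/((CF k.1.1 k.1.2).2 _).1.
have [Cc Cc0 HCc] : exists2 C, 0 <= C & forall (k : (('I_m * 'I_n) * 'I_n) * 'I_n) x, cube x ->
    `|'D_('e_(k.2)) ('D_('e_(k.1.2)) (f k.1.1)) x| <= C.
  apply: cube_bounded_family => // k x /cubeA Ax.
  exact: ((CF k.1.1.1 k.1.1.2).2 _).2.
pose C := Cb + Cc; have C0 : 0 <= C by rewrite addr_ge0.
have H1 k i a x : cube x -> `|'D_('e_a) (f (k, i)) x| <= C.
  by move=> cx; apply: le_trans (HCb (k, i, a) x cx) _; rewrite lerDl.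
have H2 k i a b x : cube x -> `|'D_('e_b) ('D_('e_a) (f (k, i))) x| <= C.
  by move=> cx; apply: le_trans (HCc (k, i, a, b) x cx) _; rewrite lerDr.
have dF k x : cube x -> differentiable (F k) x.
  by move=> /cubeA Ax; apply: differentiable_row => i; exact: (CF k i).1.
pose L := n%:R * C; pose Q := n%:R ^+ 2 * C.
have L0 : 0 <= L by rewrite mulr_ge0.
have Q0 : 0 <= Q by rewrite mulr_ge0 ?exprn_ge0.
(* The two entries of the minimum give the conditions [rL] and [rK]; the added 1 keeps the
   denominators positive. *)
pose r := Num.min (2^-1 / (m%:R * L + 1)) (delta / (m%:R * Ca + 1)).
have p1 : 0 < m%:R * L + 1 by rewrite ltr_wpDl ?mulr_ge0.
have p2 : 0 < m%:R * Ca + 1 by rewrite ltr_wpDl ?mulr_ge0.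
have r0 : 0 < r by rewrite lt_min !divr_gt0// invr_gt0.
have rL : m%:R * r * L <= 2^-1.
  have : r * (m%:R * L + 1) <= 2^-1 by rewrite -ler_pdivlMr// ge_min lexx.
  by have := r0; rewrite mulrAC; nra.
have rK : m%:R * r * Ca <= delta.
  have : r * (m%:R * Ca + 1) <= delta by rewrite -ler_pdivlMr// ge_min lexx orbT.
  by have := r0; rewrite mulrAC; nra.
have [|||||||Phi [Phi0 HPhi]] := @flow_exists R m n F x0 delta Ca L Q r delta0 _ L0 Q0 r0 rL rK => //.
- by move=> k x cx; apply: row_norm_le => // i; exact: HCa (k, i) x cx.
- move=> k x y cx cy; apply: row_norm_le => [|i]; first by rewrite mulr_ge0.
  rewrite !mxE /L mulrAC.
  exact: (@cube_lipschitz R n x0 delta A (f (k, i)) C cubeA (CF k i) C0 (H1 k i)).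
- move=> k x v cx; apply: row_norm_le => [|i]; first by rewrite mulr_ge0.
  rewrite diff_row; last exact: dF.
  rewrite /L mulrAC.
  exact: (@cube_derive_le R n x0 delta A (f (k, i)) C cubeA (CF k i) C0 (H1 k i)).
- move=> k x y cx cy; apply: row_norm_le => [|i]; first by rewrite mulr_ge0 ?exprn_ge0.
  rewrite !mxE diff_row; last exact: dF.
  exact: (@cube_taylor R n x0 delta A (f (k, i)) C oA cubeA (CF k i) C0 (H2 k i)).
- by move=> k l x /cubeA Ax; exact: FC.
exists r => //; exists Phi; split=> // x xr.
by have [cx dPhi EPhi] := HPhi x xr; split=> //; exact: cubeA.
Qed.

(* The derivatives of Phi are smooth functions of Phi, so smoothness bootstraps. *)
Lemma derivative_smooth (R : realType) (m n : nat) (F : 'I_m -> 'rV[R]_n -> 'rV[R]_n)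
    (A : set 'rV[R]_n) (B : set 'rV[R]_m) (Phi : 'rV[R]_m -> 'rV[R]_n) : open A -> open B ->
  (forall k i, smooth_Rn A (fun x => F k x ord0 i)) ->
  (forall x, B x -> [/\ A (Phi x), differentiable Phi x &
      forall v, 'd Phi x v = v *m (\matrix_k F k (Phi x))]) ->
  forall i, smooth_Rn B (fun x => Phi x ord0 i).
Proof.
move=> oA oB CF HPhi i k; elim: k i => [|k IH] i.
  move=> x /HPhi[_ /differentiable_continuous cPhi _].
  exact: (continuous_comp cPhi (@coord_continuous _ _ _ _ _ _)).
have dPhi x : B x -> differentiable (fun y => Phi y ord0 i) x.
  by case/HPhi => _ d _; apply: differentiable_comp d (differentiable_coord _ _ _).
split=> // v.
apply: (@Ck_eq _ _ _ _ (fun x => \sum_j v ord0 j * F j (Phi x) ord0 i)) => //.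
  move=> x Bx; have [_ d E] := HPhi x Bx.
  rewrite -diff_row// E mxE; by apply: eq_bigr => j _; rewrite mxE.
apply: Ck_sum => // j _; apply: Ck_mul => //; first exact: Ck_cst.
apply: (@Ck_comp R m n k B A Phi (fun y => F j y ord0 i)) => //.
  by move=> x /HPhi[].
exact: CF.
Qed.

(** * Smooth functions and tangent vectors *)

Lemma near_open (T : topologicalType) (p : T) (P : T -> Prop) :
  (\forall q \near p, P q) -> exists V : set T, [/\ open V, V p & forall q, V q -> P q].
Proof.
move=> H; have : nbhs p P by [].
by rewrite nbhsE => -[V [oV Vp] VP]; exists V.
Qed.

Section charts.
Variables (R : realType) (n : nat) (M : manifold R n).
Implicit Types (c d : chart R n M) (p : M) (U V : set M) (f g : M -> R).

Lemma Ck_local k (A : set 'rV[R]_n) (f : 'rV[R]_n -> R) :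
  (forall x, A x -> exists2 B, B x & Ck k B f) -> Ck k A f.
Proof.
elim: k f => [|k IH] f H.
  by move=> x Ax; have [B Bx] := H x Ax; apply.
split=> [x Ax|v]; first by have [B Bx [df _]] := H x Ax; exact: df.
by apply: IH => x Ax; have [B Bx [_ /(_ v) Df]] := H x Ax; exists B.
Qed.

Definition coord_fun c (i : 'I_n) : M -> R := fun p => cfun c p ord0 i.

Lemma chartK c p : atlas c -> cdom c p -> cinv c (cfun c p) = p.
Proof. by move=> /atlas_chart [_ _ + _ _]; apply. Qed.

Lemma chart_image_open c U : atlas c -> open U -> open (cfun c @` (cdom c `&` U)).
Proof.
move=> ac oU; have [od oi K _ cinvc] := atlas_chart ac.
rewrite openE => x [p [cp Up] <-].
have xi : (cfun c @` cdom c) (cfun c p) by exists p.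
have n1 : nbhs (cfun c p) (cfun c @` cdom c) by exact: open_nbhs_nbhs.
have n2 : nbhs (cfun c p) (cinv c @^-1` U).
  by apply: cinvc => //; rewrite K//; exact: open_nbhs_nbhs.
apply: filterS2 n1 n2 => _ [q cq <-]; rewrite /= K// => Uq.
by exists q.
Qed.

Lemma chart_image_nbhs c p U : atlas c -> cdom c p -> open U -> U p ->
  open_nbhs (cfun c p) (cfun c @` (cdom c `&` U)).
Proof. by move=> ac cp oU Up; split; [exact: chart_image_open|exists p]. Qed.

Lemma smooth_on_sub U V f : V `<=` U -> smooth_on U f -> smooth_on V f.
Proof.
move=> VU sf c ac k; apply: Ck_sub (sf c ac k).
by move=> _ [p [cp Vp] <-]; exists p => //; split=> //; exact: VU.
Qed.

Lemma smooth_on_eq U f g : open U -> (forall p, U p -> f p = g p) ->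
  smooth_on U f -> smooth_on U g.
Proof.
move=> oU fg sf c ac k.
apply: Ck_eq (sf c ac k); first exact: chart_image_open.
by move=> _ [p [cp Up] <-] /=; rewrite chartK// fg.
Qed.

Lemma smooth_onP U f : open U -> smooth_on U f <-> forall p, U p -> smooth_at p f.
Proof.
move=> oU; split=> [sf p Up|sf c ac k]; first by exists U.
apply: Ck_local => _ [p [cp Up] <-]; have [V [oV Vp] sV] := sf p Up.
by exists (cfun c @` (cdom c `&` V)); [exists p|exact: sV].
Qed.

Lemma smooth_at_eq p f g : (\forall q \near p, f q = g q) ->
  smooth_at p f -> smooth_at p g.
Proof.
move=> /near_open[V [oV Vp fg]] [U [oU Up] sU].
have oUV : open (U `&` V) by exact: openI.
exists (U `&` V) => //; apply: (smooth_on_eq oUV) (_ : smooth_on _ f).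
  by move=> q [_ Vq]; exact: fg.
by apply: smooth_on_sub sU => q [].
Qed.

Lemma smooth_at_near p f : smooth_at p f -> \forall q \near p, smooth_at q f.
Proof.
move=> [U [oU Up] sU]; apply: filterS (open_nbhs_nbhs (conj oU Up)) => q Uq.
by exists U.
Qed.

Lemma smooth_at_cst p (a : R) : smooth_at p (fun=> a).
Proof. by exists setT; [split=> //; exact: openT|move=> c ac k; exact: Ck_cst]. Qed.

Lemma smooth_atD p f g : smooth_at p f -> smooth_at p g ->
  smooth_at p (fun q => f q + g q).
Proof.
move=> [U [oU Up] sU] [V [oV Vp] sV].
have oUV : open (U `&` V) by exact: openI.
exists (U `&` V) => // c ac k; apply: Ck_add; first exact: chart_image_open.
  by apply: smooth_on_sub sU c ac k => q [].
by apply: smooth_on_sub sV c ac k => q [].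
Qed.

Lemma smooth_atM p f g : smooth_at p f -> smooth_at p g ->
  smooth_at p (fun q => f q * g q).
Proof.
move=> [U [oU Up] sU] [V [oV Vp] sV].
have oUV : open (U `&` V) by exact: openI.
exists (U `&` V) => // c ac k; apply: Ck_mul; first exact: chart_image_open.
  by apply: smooth_on_sub sU c ac k => q [].
by apply: smooth_on_sub sV c ac k => q [].
Qed.

Lemma smooth_at_sum p (I : Type) (r : seq I) (P : pred I) (F : I -> M -> R) :
  (forall i, P i -> smooth_at p (F i)) ->
  smooth_at p (fun q => \sum_(i <- r | P i) F i q).
Proof.
move=> sF; elim: r => [|i r IH].
  by under eq_fun do rewrite big_nil; exact: smooth_at_cst.
have [Pi|nPi] := boolP (P i); last first.
  by under eq_fun do rewrite big_cons (negPf nPi).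
by under eq_fun do rewrite big_cons Pi; apply: smooth_atD => //; exact: sF.
Qed.

Lemma smooth_at_prod p (I : Type) (r : seq I) (P : pred I) (F : I -> M -> R) :
  (forall i, P i -> smooth_at p (F i)) ->
  smooth_at p (fun q => \prod_(i <- r | P i) F i q).
Proof.
move=> sF; elim: r => [|i r IH].
  by under eq_fun do rewrite big_nil; exact: smooth_at_cst.
have [Pi|nPi] := boolP (P i); last first.
  by under eq_fun do rewrite big_cons (negPf nPi).
by under eq_fun do rewrite big_cons Pi; apply: smooth_atM => //; exact: sF.
Qed.

Lemma smooth_at_differentiable p f c : smooth_at p f -> atlas c -> cdom c p ->
  differentiable (f \o cinv c) (cfun c p).
Proof. by move=> [U [oU Up] sU] ac cp; apply: (sU c ac 1%N).1; exists p. Qed.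

Lemma smooth_at_continuous p f : smooth_at p f -> {for p, continuous f}.
Proof.
move=> sf; have [c ac cp] := atlas_cover p.
have [od _ K cc _] := atlas_chart ac.
have E : \forall q \near p, (f \o cinv c \o cfun c) q = f q.
  by apply: filterS (open_nbhs_nbhs (conj od cp)) => q cq /=; rewrite K.
have C : (f \o cinv c \o cfun c) q @[q --> p] --> f p.
  rewrite -[f p](nbhs_singleton E); apply: continuous_comp; first exact: cc.
  exact: differentiable_continuous (smooth_at_differentiable sf ac cp).
apply: cvg_trans C; exact: near_eq_cvg.
Qed.

Lemma smooth_atV p f : f p != 0 -> smooth_at p f -> smooth_at p (fun q => (f q)^-1).
Proof.
move=> fp0 sf.
have fn : \forall q \near p, f q != 0.
  exact: (smooth_at_continuous sf) (open_nbhs_nbhs (conj (@open_neq _ 0) fp0)).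
have [U [oU Up] sU] := sf; have [V [oV Vp f0]] := near_open fn.
have oUV : open (U `&` V) by exact: openI.
exists (U `&` V) => // c ac k; apply: Ck_inv; first exact: chart_image_open.
  by move=> _ [q [cq [_ Vq]] <-] /=; rewrite chartK//; exact: f0.
by apply: smooth_on_sub sU c ac k => q [].
Qed.

(** Any other chart differs by a transition map, which is smooth; on a set inside one chart domain,
    that chart alone decides smoothness. *)
Lemma smooth_on_chart c V f : atlas c -> open V -> V `<=` cdom c ->
  smooth_Rn (cfun c @` V) (f \o cinv c) -> smooth_on V f.
Proof.
move=> ac oV Vc sf d ad k; set B := cfun d @` _.
have oB : open B by exact: chart_image_open.
apply: (@Ck_eq _ _ _ _ ((f \o cinv c) \o (fun x => cfun c (cinv d x)))) => //.
  by move=> _ [p [dp Vp] <-] /=; rewrite (chartK ad)// chartK//; exact: Vc.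
apply: (@Ck_comp _ _ _ _ _ (cfun c @` V)) => //.
- move=> i; apply: Ck_sub (atlas_smooth ad ac i k) => _ [p [dp Vp] <-].
  by exists p => //; split=> //; exact: Vc.
- by move=> _ [p [dp Vp] <-]; rewrite (chartK ad)//; exists p.
Qed.

Lemma coord_fun_smooth c p i : atlas c -> cdom c p -> smooth_at p (coord_fun c i).
Proof.
move=> ac cp; have [od _ K _ _] := atlas_chart ac; exists (cdom c) => //.
apply: (smooth_on_chart ac) => // k.
have oi : open (cfun c @` cdom c) by rewrite -[cdom c]setIT; exact: chart_image_open openT.
apply: (@Ck_eq _ _ _ _ (fun x : 'rV[R]_n => x ord0 i)) => //; last exact: Ck_coord.
by move=> _ [q cq <-]; rewrite /coord_fun /= K.
Qed.

(** The partial derivative along the [i]-th coordinate of [c], kept as a function on [M] so that it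
    can be iterated; it is meaningful on [cdom c]. *)
Definition chart_deriv c (i : 'I_n) f : M -> R :=
  fun p => 'D_('e_i) (f \o cinv c) (cfun c p).

Lemma chart_deriv_smooth c p i f : atlas c -> cdom c p -> smooth_at p f ->
  smooth_at p (chart_deriv c i f).
Proof.
move=> ac cp [U [oU Up] sU]; have [od _ K _ _] := atlas_chart ac.
have oV : open (cdom c `&` U) by exact: openI.
exists (cdom c `&` U) => //; apply: (smooth_on_chart ac oV) => [q []//|k].
apply: (@Ck_eq _ _ _ _ ('D_('e_i) (f \o cinv c))).
- exact: chart_image_open.
- by move=> _ [q [cq Uq] <-]; rewrite /chart_deriv /= K.
- exact: (sU c ac k.+1).2.
Qed.

End charts.

Section tangent_vectors.
Variables (R : realType) (n : nat) (M : manifold R n).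
Implicit Types (c d : chart R n M) (p : M) (U V : set M) (f g : M -> R) (v w : tvec M).

Lemma coord_vecE c p a f : smooth_at p f ->
  coord_vec c p a f = 'D_a (f \o cinv c) (cfun c p).
Proof. by move=> sf; rewrite /coord_vec asboolT. Qed.

Lemma coord_vec_notsmooth c p a f : ~ smooth_at p f -> coord_vec c p a f = 0.
Proof. by move=> sf; rewrite /coord_vec asboolF. Qed.

Lemma tangent_notsmooth p v f : tangent p v -> ~ smooth_at p f -> v f = 0.
Proof. by move=> [c [a [_ _ ->]]]; exact: coord_vec_notsmooth. Qed.

Lemma tangent_near p v f g : tangent p v -> (\forall q \near p, f q = g q) -> v f = v g.
Proof.
move=> [c [a [ac cp ->]]] fg.
have gf : \forall q \near p, g q = f q by apply: filterS fg.
(* If [f] is not smooth at [p], then neither is [g], and both values are zero by the convention on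
   tangent vectors. *)
have [sf|sf] := pselect (smooth_at p f); last first.
  by rewrite !coord_vec_notsmooth// => sg; apply: sf; exact: smooth_at_eq gf sg.
rewrite !coord_vecE//; last exact: smooth_at_eq fg sf.
apply: near_eq_derive; have [V [oV Vp {}fg]] := near_open fg.
apply: filterS (open_nbhs_nbhs (chart_image_nbhs ac cp oV Vp)) => _ [q [cq Vq] <-].
by rewrite /= chartK// fg.
Qed.

Lemma tangentD p v f g : tangent p v -> smooth_at p f -> smooth_at p g ->
  v (fun q => f q + g q) = v f + v g.
Proof.
move=> [c [a [ac cp ->]]] sf sg; rewrite !coord_vecE//; last exact: smooth_atD.
by rewrite -deriveD//; apply: diff_derivable; exact: smooth_at_differentiable.
Qed.

Lemma tangentM p v f g : tangent p v -> smooth_at p f -> smooth_at p g ->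
  v (fun q => f q * g q) = v f * g p + f p * v g.
Proof.
move=> [c [a [ac cp ->]]] sf sg; rewrite !coord_vecE//; last exact: smooth_atM.
have dd h : smooth_at p h -> derivable (h \o cinv c) (cfun c p) a.
  by move=> sh; apply: diff_derivable; exact: smooth_at_differentiable.
apply: etrans (deriveM (dd _ sf) (dd _ sg)) _.
by rewrite addrC [_ *: 'D_a (f \o _) _]mulrC -[(f \o _) _]/(f _) -[(g \o _) _]/(g _) chartK.
Qed.

Lemma tangent_cst p v (a : R) : tangent p v -> v (fun=> a) = 0.
Proof.
move=> [c [b [ac cp ->]]]; rewrite coord_vecE; last exact: smooth_at_cst.
exact: derive_cst.
Qed.

Lemma tangent_sum p v k (f : 'I_k -> M -> R) : tangent p v ->
  (forall i, smooth_at p (f i)) ->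
  v (fun q => \sum_(i < k) f i q) = \sum_(i < k) v (f i).
Proof.
move=> tv sf; elim: (index_enum 'I_k) => [|i r IH].
  by under eq_fun do rewrite big_nil; rewrite big_nil; exact: tangent_cst tv.
under eq_fun do rewrite big_cons; rewrite big_cons -IH; apply: (tangentD tv) => //.
exact: smooth_at_sum.
Qed.

End tangent_vectors.

Lemma smooth_map_id (R : realType) (m : nat) (M : manifold R m) : smooth_map (@id M).
Proof. by split=> [p|V f oV]; [exact: cvg_id|]. Qed.

Section expansions_along_maps.
Variables (R : realType) (m n : nat) (M : manifold R m) (N : manifold R n).
Variable F : M -> N.
Hypothesis sF : smooth_map F.
Implicit Types (p : M) (v : tvec M) (f : N -> R).

Lemma smooth_map_at p f : smooth_at (F p) f -> smooth_at p (f \o F).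
Proof.
move=> [U [oU Up] sU]; exists (F @^-1` U); last exact: sF.2.
by split=> //; apply: open_comp => // q _; exact: sF.1.
Qed.

(** The chain rule read in charts: derivatives of all pullbacks [f \o F] are governed by those of
    the target coordinates. The identity map gives the usual expansion of a tangent vector. *)
Lemma tangent_expand_along p v (d : chart R n N) f : tangent p v -> atlas d ->
  cdom d (F p) -> smooth_at (F p) f ->
  v (f \o F) = \sum_j v (coord_fun d j \o F) * chart_deriv d j f (F p).
Proof.
move=> [c [a [ac cp ->]]] ad dp sf.
rewrite coord_vecE; last exact: smooth_map_at.
pose phi (x : 'rV[R]_m) := cfun d (F (cinv c x)).
have phip : phi (cfun c p) = cfun d (F p) by rewrite /phi (chartK ac).
have [od _ _ _ _] := atlas_chart ad.
transitivity ('D_a ((f \o cinv d) \o phi) (cfun c p)).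
  apply: near_eq_derive.
  have oV : open (F @^-1` cdom d) by apply: open_comp => // q _; exact: sF.1.
  apply: filterS (open_nbhs_nbhs (chart_image_nbhs ac cp oV dp)) => _ [q [cq dq] <-].
  by rewrite /phi /= (chartK ac)// (chartK ad).
have sphi i : smooth_at p (coord_fun d i \o F) by apply/smooth_map_at/coord_fun_smooth.
have dphi i : differentiable (fun y => phi y ord0 i) (cfun c p).
  exact: (smooth_at_differentiable (sphi i) ac cp).
rewrite derive_comp_row//; last by rewrite phip; exact: smooth_at_differentiable.
by apply: eq_bigr => i _; rewrite coord_vecE// phip.
Qed.

End expansions_along_maps.

Section tangent_spaces.
Variables (R : realType) (n : nat) (M : manifold R n).
Implicit Types (c d : chart R n M) (p : M) (f : M -> R) (v w : tvec M).

Lemma tangent_expand p v c f : tangent p v -> atlas c -> cdom c p -> smooth_at p f ->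
  v f = \sum_i v (coord_fun c i) * chart_deriv c i f p.
Proof. exact: (tangent_expand_along (smooth_map_id M)). Qed.

Lemma coord_vec_tangent c p a : atlas c -> cdom c p -> tangent p (coord_vec c p a).
Proof. by move=> ac cp; exists c, a. Qed.

Lemma coord_vec_coord c p a i : atlas c -> cdom c p ->
  coord_vec c p a (coord_fun c i) = a ord0 i.
Proof.
move=> ac cp; rewrite coord_vecE; last exact: coord_fun_smooth.
have [oc _ _ _ _] := atlas_chart ac.
rewrite -[RHS](derive_coord a (cfun c p)); apply: near_eq_derive.
apply: filterS (open_nbhs_nbhs (chart_image_nbhs ac cp oc cp)) => _ [q [dq cq] <-].
by rewrite /coord_fun/= chartK.
Qed.

Lemma tangent_ext p v w c : tangent p v -> tangent p w -> atlas c -> cdom c p ->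
  (forall i, v (coord_fun c i) = w (coord_fun c i)) -> v = w.
Proof.
move=> tv tw ac cp vw; apply/funext => f.
have [sf|sf] := pselect (smooth_at p f).
  rewrite (tangent_expand tv ac cp sf) (tangent_expand tw ac cp sf).
  by apply: eq_bigr => i _; rewrite vw.
by rewrite (tangent_notsmooth tv sf) (tangent_notsmooth tw sf).
Qed.

Lemma tangent_coord p v c : tangent p v -> atlas c -> cdom c p ->
  v = coord_vec c p (\row_i v (coord_fun c i)).
Proof.
move=> tv ac cp; apply: (tangent_ext tv _ ac cp); first exact: coord_vec_tangent.
by move=> i; rewrite coord_vec_coord// mxE.
Qed.

(** Tangency is Leibniz equality with a coordinate vector, so a candidate has to be controlled on
    every function: zero off the smooth ones, a combination of partial derivatives on them. *)
Lemma tangent_criterion p c v (a : 'I_n -> R) : atlas c -> cdom c p ->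
  (forall f, ~ smooth_at p f -> v f = 0) ->
  (forall f, smooth_at p f -> v f = \sum_i a i * chart_deriv c i f p) ->
  tangent p v.
Proof.
move=> ac cp v0 vs; have tc := coord_vec_tangent (\row_i a i) ac cp.
suff -> : v = coord_vec c p (\row_i a i) by [].
apply/funext => f; have [sf|sf] := pselect (smooth_at p f); last first.
  by rewrite v0// (tangent_notsmooth tc).
rewrite vs// (tangent_expand tc ac cp sf); apply: eq_bigr => i _.
by rewrite coord_vec_coord// mxE.
Qed.

Lemma tangent_linear p (a : R) v w : tangent p v -> tangent p w ->
  tangent p (a *: v + w).
Proof.
move=> tv tw; have [c ac cp] := atlas_cover p.
apply: (@tangent_criterion p c _ (fun i => a * v (coord_fun c i) + w (coord_fun c i)) ac cp).
  move=> f sf; rewrite -[LHS]/(a * v f + w f).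
  by rewrite (tangent_notsmooth tv sf) (tangent_notsmooth tw sf) mulr0 addr0.
move=> f sf; rewrite -[LHS]/(a * v f + w f).
rewrite (tangent_expand tv ac cp sf) (tangent_expand tw ac cp sf) mulr_sumr -big_split.
by apply: eq_bigr => i _ /=; rewrite mulrDl mulrA.
Qed.

Lemma tangent0 p : tangent p (0 : tvec M).
Proof.
have [c ac cp] := atlas_cover p.
apply: (@tangent_criterion p c _ (fun=> 0) ac cp) => // f _.
by rewrite big1// => i _; rewrite mul0r.
Qed.

Lemma tangentZ p (a : R) v : tangent p v -> tangent p (a *: v).
Proof. by move=> tv; rewrite -[_ *: _]addr0; apply: tangent_linear => //; exact: tangent0. Qed.

Lemma tangent_add p v w : tangent p v -> tangent p w -> tangent p (v + w).
Proof. by move=> tv tw; rewrite -[v]scale1r; exact: tangent_linear. Qed.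

Lemma tangent_sub p v w : tangent p v -> tangent p w -> tangent p (v - w).
Proof. by move=> tv tw; rewrite addrC -scaleN1r; exact: tangent_linear. Qed.

Lemma tangent_lincomb p k (a : 'I_k -> R) (e : 'I_k -> tvec M) :
  (forall i, tangent p (e i)) -> tangent p (\sum_i a i *: e i).
Proof.
move=> te; elim/big_ind: _ => [|u v|i _]; [exact: tangent0|exact: tangent_add|].
exact: tangentZ.
Qed.

Lemma tvec_sumE k (a : 'I_k -> R) (e : 'I_k -> tvec M) f :
  (\sum_i a i *: e i) f = \sum_i a i * e i f.
Proof. by rewrite fct_sumE. Qed.

Lemma frame_row_free p c k (e : 'I_k -> tvec M) : atlas c -> cdom c p ->
  (forall i, tangent p (e i)) ->
  (forall a : 'I_k -> R, \sum_(i < k) a i *: e i = 0 -> forall i, a i = 0) ->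
  row_free (\matrix_(i, j) e i (coord_fun c j)).
Proof.
move=> ac cp te fe; apply: inj_row_free => u uA; apply/rowP => i; rewrite mxE.
apply: (fe (u ord0)); apply: (tangent_ext _ (tangent0 _) ac cp).
  exact: tangent_lincomb.
move=> j; rewrite tvec_sumE; transitivity ((u *m \matrix_(i, j) e i (coord_fun c j)) ord0 j).
  by rewrite mxE; apply: eq_bigr => l _; rewrite !mxE.
by rewrite uA mxE.
Qed.

End tangent_spaces.

(** * Smooth maps and fields *)

Section smooth_maps.
Variables (R : realType) (m n : nat) (M : manifold R m) (N : manifold R n).
Variable F : M -> N.
Hypothesis sF : smooth_map F.
Implicit Types (p : M) (v w : tvec M) (f : N -> R).

Lemma smooth_map_near p (P : N -> Prop) :
  (\forall q \near F p, P q) -> \forall q \near p, P (F q).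
Proof. exact: sF.1. Qed.

Lemma differentialE p v f : smooth_at (F p) f -> differential F p v f = v (f \o F).
Proof. by move=> sf; rewrite /differential asboolT. Qed.

Lemma differential_notsmooth p v f : ~ smooth_at (F p) f -> differential F p v f = 0.
Proof. by move=> sf; rewrite /differential asboolF. Qed.

Lemma differential_tangent p v : tangent p v -> tangent (F p) (differential F p v).
Proof.
move=> tv; have [d ad dp] := atlas_cover (F p).
apply: (@tangent_criterion _ _ _ _ d _ (fun j => v (coord_fun d j \o F)) ad dp) => f sf.
  exact: differential_notsmooth.
by rewrite differentialE// (tangent_expand_along sF tv ad dp sf).
Qed.

Lemma differential_linear p (a : R) v w :
  differential F p (a *: v + w) = a *: differential F p v + differential F p w.
Proof.
apply/funext => f; rewrite -[RHS]/(a * differential F p v f + differential F p w f).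
by rewrite /differential; case: asboolP => // _; rewrite mulr0 addr0.
Qed.

Lemma differentialZ p (a : R) v : differential F p (a *: v) = a *: differential F p v.
Proof.
apply/funext => f; rewrite -[RHS]/(a * differential F p v f).
by rewrite /differential; case: asboolP => // _; rewrite mulr0.
Qed.

Lemma differential_sub p v w :
  differential F p (v - w) = differential F p v - differential F p w.
Proof. by rewrite addrC -scaleN1r differential_linear scaleN1r addrC. Qed.

End smooth_maps.

Section fields.
Variables (R : realType) (m n : nat) (M : manifold R m) (N : manifold R n).
Variable F : M -> N.
Hypothesis sF : smooth_map F.
Implicit Types (p : M) (v w : tvec M) (f : N -> R) (U : set M).

(** The germ form of [field_along]: arguments that shrink neighbourhoods repeatedly can be carried
    out at a point, without tracking domains. *)
Definition smooth_field_at p (W : M -> tvec N) : Prop :=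
  (\forall q \near p, tangent (F q) (W q)) /\
  forall f, smooth_at (F p) f -> smooth_at p (fun q => W q f).

Lemma field_alongP U W : open U ->
  field_along F U W <-> forall p, U p -> smooth_field_at p W.
Proof.
move=> oU; split=> [[tW sW] p Up|H].
  split; first by apply: filterS (open_nbhs_nbhs (conj oU Up)) => q Uq; exact: tW.
  move=> f [V [oV Vp] sV].
  exists (U `&` F @^-1` V); last exact: sW.
  by split=> //; apply: openI => //; apply: open_comp => // q _; exact: sF.1.
split=> [p Up|V f oV sf]; first exact: nbhs_singleton (H p Up).1.
apply/smooth_onP.
  by apply: openI => //; apply: open_comp => // q _; exact: sF.1.
by move=> p [Up Vp]; apply: (H p Up).2; exists V.
Qed.

Lemma smooth_field_chart p W (d : chart R n N) : atlas d -> cdom d (F p) ->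
  (\forall q \near p, tangent (F q) (W q)) ->
  (forall j, smooth_at p (fun q => W q (coord_fun d j))) -> smooth_field_at p W.
Proof.
move=> ad dp tW sW; split=> // f sf.
have [od _ _ _ _] := atlas_chart ad.
apply: (@smooth_at_eq _ _ _ _
   (fun q => \sum_j W q (coord_fun d j) * chart_deriv d j f (F q))).
  have H1 : \forall q \near p, cdom d (F q).
    by apply: (smooth_map_near sF); exact: open_nbhs_nbhs.
  have H2 : \forall q \near p, smooth_at (F q) f.
    by apply: (smooth_map_near sF (P := fun q => smooth_at q f)); exact: smooth_at_near.
  by apply: filterS3 tW H1 H2 => q tq dq sq; rewrite -(tangent_expand tq).
apply: smooth_at_sum => j _; apply: smooth_atM => //.
by apply: (smooth_map_at sF (f := chart_deriv d j f)); exact: chart_deriv_smooth.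
Qed.

Lemma smooth_fieldD p W1 W2 : smooth_field_at p W1 -> smooth_field_at p W2 ->
  smooth_field_at p (fun q => W1 q + W2 q).
Proof.
move=> [t1 s1] [t2 s2]; split.
  by apply: filterS2 t1 t2 => q; exact: tangent_add.
by move=> f sf; apply: smooth_atD; [exact: s1|exact: s2].
Qed.

Lemma smooth_fieldZ p h W : smooth_at p h -> smooth_field_at p W ->
  smooth_field_at p (fun q => h q *: W q).
Proof.
move=> sh [t s]; split.
  by apply: filterS t => q; exact: tangentZ.
by move=> f sf; apply: smooth_atM => //; exact: s.
Qed.

Lemma smooth_field0 p : smooth_field_at p (fun=> 0).
Proof.
split; first by near=> q; exact: tangent0.
by move=> f sf; exact: smooth_at_cst.
Unshelve. all: by end_near. Qed.

Lemma smooth_field_eq p W1 W2 : (\forall q \near p, W1 q = W2 q) ->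
  smooth_field_at p W1 -> smooth_field_at p W2.
Proof.
move=> E [t s]; split; first by apply: filterS2 E t => q ->.
move=> f sf; apply: smooth_at_eq (s f sf).
by apply: filterS E => q ->.
Qed.

End fields.

Section field_images.
Variables (R : realType) (m n : nat) (M : manifold R m) (N : manifold R n).
Variable F : M -> N.
Hypothesis sF : smooth_map F.

Lemma smooth_field_comp p (Z : N -> tvec N) : smooth_field_at id (F p) Z ->
  smooth_field_at F p (Z \o F).
Proof.
move=> [t s]; split; first exact: (smooth_map_near sF (P := fun q => tangent q (Z q))).
by move=> f sf; apply: (smooth_map_at sF (f := fun q => Z q f)); exact: s.
Qed.

Lemma smooth_field_differential p (Y : M -> tvec M) : smooth_field_at id p Y ->
  smooth_field_at F p (fun q => differential F q (Y q)).
Proof.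
move=> [t s]; split.
  by apply: filterS t => q; exact: differential_tangent.
move=> f sf; apply: (smooth_at_eq _ (s _ (smooth_map_at sF sf))).
have H2 : \forall q \near p, smooth_at (F q) f.
  by apply: (smooth_map_near sF (P := fun q => smooth_at q f)); exact: smooth_at_near.
by apply: filterS H2 => q sq; rewrite differentialE.
Qed.

End field_images.

(** * Lie brackets in charts *)

Section brackets.
Variables (R : realType) (n : nat) (M : manifold R n).
Implicit Types (p : M) (f : M -> R) (X Y : M -> tvec M).

Lemma chart_deriv_symmetric (c : chart R n M) i j f p : atlas c -> cdom c p ->
  smooth_at p f ->
  chart_deriv c i (chart_deriv c j f) p = chart_deriv c j (chart_deriv c i f) p.
Proof.
move=> ac cp [U [oU Up] sU].
have [oc _ _ _ _] := atlas_chart ac.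
have E a b : chart_deriv c a (chart_deriv c b f) p =
    'D_('e_a) ('D_('e_b) (f \o cinv c)) (cfun c p).
  apply: near_eq_derive.
  apply: filterS (open_nbhs_nbhs (chart_image_nbhs ac cp oc cp)) => _ [q [cq _] <-].
  by rewrite /chart_deriv /= (chartK ac).
have [oA Ap] := chart_image_nbhs ac cp oU Up.
rewrite !E; exact: (derive_symmetric _ _ oA Ap (sU c ac 2%N)).
Qed.

Lemma chart_expand_field p (c : chart R n M) (X : M -> tvec M) f :
  atlas c -> cdom c p -> smooth_field_at id p X -> smooth_at p f ->
  \forall q \near p, X q f = \sum_i X q (coord_fun c i) * chart_deriv c i f q.
Proof.
move=> ac cp [tX _] sf; have [oc _ _ _ _] := atlas_chart ac.
have H1 : \forall q \near p, cdom c q by exact: open_nbhs_nbhs.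
by apply: filterS3 tX H1 (smooth_at_near sf) => q tq cq sq; exact: tangent_expand.
Qed.

Lemma second_derivative p (c : chart R n M) v (Y : M -> tvec M) f :
  atlas c -> cdom c p -> tangent p v -> smooth_field_at id p Y -> smooth_at p f ->
  v (fun q => Y q f) = \sum_j v (fun q => Y q (coord_fun c j)) * chart_deriv c j f p +
    \sum_j Y p (coord_fun c j) *
      (\sum_i v (coord_fun c i) * chart_deriv c i (chart_deriv c j f) p).
Proof.
move=> ac cp tv sY sf; rewrite (tangent_near tv (chart_expand_field ac cp sY sf)).
have sx j : smooth_at p (fun q => Y q (coord_fun c j)) by apply/sY.2/coord_fun_smooth.
have sd j : smooth_at p (chart_deriv c j f) by exact: chart_deriv_smooth.
rewrite (tangent_sum tv) => [|j]; last exact: smooth_atM.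
rewrite -big_split; apply: eq_bigr => j _ /=.
by rewrite (tangentM tv)// (tangent_expand tv ac cp (sd j)).
Qed.

(** The second-order parts of the two iterated derivatives coincide by symmetry of mixed partials
    and cancel; only first derivatives of [f] remain, which makes the bracket a tangent vector. *)
Lemma bracket_expand p (c : chart R n M) X Y f : atlas c -> cdom c p ->
  smooth_field_at id p X -> smooth_field_at id p Y -> smooth_at p f ->
  lie_bracket X Y p f = \sum_j (X p (fun q => Y q (coord_fun c j)) -
     Y p (fun q => X q (coord_fun c j))) * chart_deriv c j f p.
Proof.
move=> ac cp sX sY sf; rewrite /lie_bracket asboolT//.
have tX := nbhs_singleton sX.1; have tY := nbhs_singleton sY.1.
rewrite (second_derivative ac cp tX sY sf) (second_derivative ac cp tY sX sf).
have E : \sum_j Y p (coord_fun c j) *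
      (\sum_i X p (coord_fun c i) * chart_deriv c i (chart_deriv c j f) p) =
   \sum_j X p (coord_fun c j) *
      (\sum_i Y p (coord_fun c i) * chart_deriv c i (chart_deriv c j f) p).
  under eq_bigr do rewrite mulr_sumr.
  rewrite exchange_big; apply: eq_bigr => i _; rewrite mulr_sumr.
  apply: eq_bigr => j _; rewrite (chart_deriv_symmetric i j ac cp sf).
  by rewrite mulrCA.
rewrite E opprD addrACA subrr addr0 -sumrB.
by apply: eq_bigr => j _; rewrite mulrBl.
Qed.

Lemma bracket_tangent p X Y : smooth_field_at id p X -> smooth_field_at id p Y ->
  tangent p (lie_bracket X Y p).
Proof.
move=> sX sY; have [c ac cp] := atlas_cover p.
apply: (@tangent_criterion _ _ _ p c _ (fun j => X p (fun q => Y q (coord_fun c j)) -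
     Y p (fun q => X q (coord_fun c j))) ac cp) => f sf.
  by rewrite /lie_bracket asboolF.
exact: bracket_expand.
Qed.

End brackets.

(** * Distributions and sections *)

Lemma near_near (T : topologicalType) (p : T) (P : T -> Prop) :
  (\forall q \near p, P q) -> \forall q \near p, \forall r \near q, P r.
Proof.
move=> /near_open[V [oV Vp VP]]; apply: filterS (open_nbhs_nbhs (conj oV Vp)) => q Vq.
exact: filterS (open_nbhs_nbhs (conj oV Vq)).
Qed.

Section smooth_matrices.
Variables (R : realType) (n : nat) (M : manifold R n) (p : M).

Lemma smooth_at_det k (A : M -> 'M[R]_k) : (forall i j, smooth_at p (fun q => A q i j)) ->
  smooth_at p (fun q => \det (A q)).
Proof.
move=> sA; apply: smooth_at_sum => s _; apply: smooth_atM; first exact: smooth_at_cst.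
by apply: smooth_at_prod => i _.
Qed.

Lemma smooth_at_mulmx k l r (A : M -> 'M[R]_(k, l)) (B : M -> 'M[R]_(l, r)) i j :
  (forall i j, smooth_at p (fun q => A q i j)) ->
  (forall i j, smooth_at p (fun q => B q i j)) ->
  smooth_at p (fun q => (A q *m B q) i j).
Proof.
move=> sA sB; under eq_fun do rewrite mxE.
by apply: smooth_at_sum => h _; exact: smooth_atM.
Qed.

Lemma det_near_neq0 k (A : M -> 'M[R]_k) : (forall i j, smooth_at p (fun q => A q i j)) ->
  \det (A p) != 0 -> \forall q \near p, \det (A q) != 0.
Proof.
move=> sA d0.
exact: (smooth_at_continuous (smooth_at_det sA)) (open_nbhs_nbhs (conj (@open_neq _ 0) d0)).
Qed.

(** Cramer's formula holds wherever the determinant is nonzero, hence near [p], and is rational in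
    the entries. *)
Lemma smooth_at_invmx k (A : M -> 'M[R]_k) i j :
  (forall i j, smooth_at p (fun q => A q i j)) -> \det (A p) != 0 ->
  smooth_at p (fun q => invmx (A q) i j).
Proof.
move=> sA d0.
apply: (@smooth_at_eq _ _ _ _ (fun q => (\det (A q))^-1 * cofactor (A q) j i)).
  apply: filterS (det_near_neq0 sA d0) => q dq.
  by rewrite /invmx unitmxE unitfE dq !mxE.
apply: smooth_atM; first exact/smooth_atV/smooth_at_det.
apply: smooth_atM; first exact: smooth_at_cst.
by apply: smooth_at_det => a b; under eq_fun do rewrite !mxE.
Qed.

End smooth_matrices.

Section frames.
Variables (R : realType) (m n : nat) (M : manifold R m) (N : manifold R n).
Variable F : M -> N.
Hypothesis sF : smooth_map F.

(** Smoothness tested against all functions yields a neighbourhood for each of them and no common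
    one; the finitely many coordinate functions of one chart do yield a common neighbourhood, and
    they suffice. *)
Lemma smooth_field_near p (W : M -> tvec N) : smooth_field_at F p W ->
  \forall q \near p, smooth_field_at F q W.
Proof.
move=> [tW sW]; have [d ad dp] := atlas_cover (F p).
have [od _ _ _ _] := atlas_chart ad.
have H1 : \forall q \near p, cdom d (F q) by apply: (smooth_map_near sF); exact: open_nbhs_nbhs.
have H2 : \forall q \near p, forall j, smooth_at q (fun r => W r (coord_fun d j)).
  by apply: filter_forall => j; apply/smooth_at_near/sW/coord_fun_smooth.
apply: filterS3 H1 H2 (near_near tW) => q dq sq tq.
exact: smooth_field_chart dq tq sq.
Qed.

(** The coefficients are known pointwise only; an explicit formula makes them smooth. With [A] the
    coordinate matrix of the frame and [P] a constant right inverse of [A p], the square matrix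
    [A q *m P] is invertible near [p], and the coefficients are the coordinates of [W] times [P]
    times its inverse. *)
Lemma frame_coefficients p k (E : 'I_k -> N -> tvec N) (W : M -> tvec N) :
  (forall i, smooth_field_at id (F p) (E i)) ->
  (forall a : 'I_k -> R, \sum_(i < k) a i *: E i (F p) = 0 -> forall i, a i = 0) ->
  smooth_field_at F p W ->
  (\forall q \near p, exists a : 'I_k -> R, W q = \sum_(i < k) a i *: E i (F q)) ->
  exists w : 'I_k -> M -> R, (forall i, smooth_at p (w i)) /\
    \forall q \near p, W q = \sum_(i < k) w i q *: E i (F q).
Proof.
move=> sE fE sW WE; have [d ad dp] := atlas_cover (F p).
pose A q : 'M[R]_(k, n) := \matrix_(i, a) E i (F q) (coord_fun d a).
have sA i a : smooth_at p (fun q => A q i a).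
  under eq_fun do rewrite mxE.
  apply: (smooth_map_at sF (f := fun y => E i y (coord_fun d a))).
  by apply: (sE i).2; exact: coord_fun_smooth.
have rA : row_free (A p).
  exact: (frame_row_free ad dp (fun i => nbhs_singleton (sE i).1) fE).
pose P := pinvmx (A p); pose B q := A q *m P.
have Bp : B p = 1%:M by exact: mulmxVp.
have sB i j : smooth_at p (fun q => B q i j).
  by apply: smooth_at_mulmx => // ? ?; exact: smooth_at_cst.
have dB : \det (B p) != 0 by rewrite Bp det1 oner_eq0.
pose w q : 'rV[R]_k := (\row_a W q (coord_fun d a)) *m P *m invmx (B q).
exists (fun i q => w q ord0 i); split=> [i|].
  apply: smooth_at_mulmx => [a b|a b]; last exact: smooth_at_invmx.
  apply: smooth_at_mulmx => [a' b'|a' b']; last exact: smooth_at_cst.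
  under eq_fun do rewrite mxE.
  by apply: sW.2; exact: coord_fun_smooth.
apply: filterS2 WE (det_near_neq0 sB dB) => q [a Ea] dq.
have uB : B q \in unitmx by rewrite unitmxE unitfE.
rewrite Ea; suff -> : w q = \row_i a i by apply: eq_bigr => i _; rewrite mxE.
rewrite /w (_ : \row_b _ = (\row_i a i) *m A q); last first.
  by apply/rowP => b; rewrite !mxE Ea tvec_sumE; apply: eq_bigr => i _; rewrite !mxE.
by rewrite -[_ *m A q *m P]mulmxA mulmxK.
Qed.

End frames.

Section distributions.
Variables (R : realType) (n : nat) (N : manifold R n) (k : nat) (D : N -> set (tvec N)).
Hypothesis dD : distribution k D.

Lemma local_frame p : exists E : 'I_k -> N -> tvec N,
  [/\ forall i, smooth_field_at id p (E i),
      \forall q \near p, is_basis (D q) (fun i => E i q) &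
      forall i, \forall q \near p, D q (E i q)].
Proof.
have [U [E [[oU Up] vE bE]]] := dD p; exists E.
have nU : \forall q \near p, U q by exact: open_nbhs_nbhs.
split=> [i||i].
- by have /(field_alongP (smooth_map_id N)) := vE i; apply.
- exact: filterS nU.
- apply: filterS nU => q Uq; rewrite (bE q Uq).2.
  exists (fun j => (j == i)%:R); rewrite (bigD1 i)//= eqxx scale1r big1 ?addr0//.
  by move=> j /negPf ->; rewrite scale0r.
Qed.

Lemma distribution_tangent p v : D p v -> tangent p v.
Proof.
have [E [sE /nbhs_singleton bE _]] := local_frame p.
rewrite bE.2 => -[a ->]; apply: tangent_lincomb => i.
exact: nbhs_singleton (sE i).1.
Qed.

Lemma distribution_lincomb p l (a : 'I_l -> R) (e : 'I_l -> tvec N) :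
  (forall i, D p (e i)) -> D p (\sum_i a i *: e i).
Proof.
have [E [_ /nbhs_singleton bE _]] := local_frame p; rewrite bE.2 => De.
have [b Eb] := choice De; exists (fun j => \sum_i a i * b i j).
under eq_bigr do rewrite Eb scaler_sumr.
rewrite exchange_big; apply: eq_bigr => j _; rewrite scaler_suml.
by apply: eq_bigr => i _; rewrite scalerA.
Qed.

Lemma distributionD p u v : D p u -> D p v -> D p (u + v).
Proof.
move=> Du Dv.
have := @distribution_lincomb p 2 (fun=> 1) (fun i => if i == ord0 then u else v).
rewrite !big_ord_recl big_ord0 /= addr0 !scale1r; apply.
by move=> i; case: ifP.
Qed.

Lemma distributionZ p a u : D p u -> D p (a *: u).
Proof.
move=> Du; have := @distribution_lincomb p 1 (fun=> a) (fun=> u).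
by rewrite !big_ord_recl big_ord0 addr0; apply.
Qed.

Lemma distribution0 p : D p 0.
Proof.
have := @distribution_lincomb p 0 (fun=> 0) (fun=> 0); rewrite big_ord0; apply.
by case.
Qed.

End distributions.

(** Lets results on sections of a distribution cover ordinary vector fields and affine
    connections. *)
Lemma tangent_distribution (R : realType) (n : nat) (N : manifold R n) :
  distribution n (@tangent R n N).
Proof.
move=> p; have [c ac cp] := atlas_cover p; have [oc _ _ _ _] := atlas_chart ac.
exists (cdom c), (fun i q => coord_vec c q 'e_i); split=> //.
  move=> i; apply/(field_alongP (smooth_map_id N)) => // q cq.
  have nc : \forall r \near q, cdom c r by exact: open_nbhs_nbhs.
  apply: (smooth_field_chart (smooth_map_id N) ac cq) => [|j].
    by apply: filterS nc => r cr; exact: coord_vec_tangent.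
  apply: smooth_at_eq (smooth_at_cst q ('e_i ord0 j)).
  by apply: filterS nc => r cr; rewrite coord_vec_coord.
move=> q cq; have te i : tangent q (coord_vec c q 'e_i) by exact: coord_vec_tangent.
have ex (a : 'I_n -> R) j : (\sum_(i < n) a i *: coord_vec c q 'e_i) (coord_fun c j) = a j.
  rewrite tvec_sumE (bigD1 j)//= coord_vec_coord// mxE !eqxx mulr1 big1 ?addr0// => i ij.
  by rewrite coord_vec_coord// mxE eqxx /= eq_sym (negPf ij) mulr0.
split=> [a E0 i|]; first by rewrite -(ex a i) E0.
apply/seteqP; split=> [v tv|_ [a ->]]; last exact: tangent_lincomb.
exists (fun i => v (coord_fun c i)); apply: (tangent_ext tv _ ac cq).
  exact: tangent_lincomb.
by move=> i; rewrite ex.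
Qed.

Section sections.
Variables (R : realType) (m n : nat) (M : manifold R m) (N : manifold R n).
Variable F : M -> N.
Hypothesis sF : smooth_map F.
Variables (k : nat) (D : N -> set (tvec N)).
Hypothesis dD : distribution k D.

Lemma section_atP p W : section_at F D p W <->
  smooth_field_at F p W /\ \forall q \near p, D (F q) (W q).
Proof.
split=> [[U [oU Up] [/(field_alongP sF _ oU) fW DW]]|[sW DW]].
  by split; [exact: fW|apply: filterS (open_nbhs_nbhs (conj oU Up)) => q; exact: DW].
have [U [oU Up UP]] := near_open (filterI (smooth_field_near sF sW) DW).
exists U => //; split=> [|q /UP[]//].
by apply/(field_alongP sF _ oU) => q /UP[].
Qed.

Lemma section_coefficients p (E : 'I_k -> N -> tvec N) W :
  (forall i, smooth_field_at id (F p) (E i)) ->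
  (\forall q \near F p, is_basis (D q) (fun i => E i q)) ->
  section_at F D p W ->
  exists w : 'I_k -> M -> R, (forall i, smooth_at p (w i)) /\
    \forall q \near p, W q = \sum_(i < k) w i q *: E i (F q).
Proof.
move=> sE bE /section_atP[sW DW]; apply: (frame_coefficients sF) => //.
  exact: (nbhs_singleton bE).1.
have bE' : \forall q \near p, is_basis (D (F q)) (fun i => E i (F q)).
  exact: (smooth_map_near sF (P := fun q => is_basis (D q) (fun i => E i q))).
by apply: filterS2 bE' DW => q [_ ->].
Qed.

Lemma sectionZ p h W : smooth_at p h -> section_at F D p W ->
  section_at F D p (fun q => h q *: W q).
Proof.
move=> sh /section_atP[sW DW]; apply/section_atP; split; first exact: smooth_fieldZ.
by apply: filterS DW => q; exact: (distributionZ dD).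
Qed.

Lemma sectionD p W1 W2 : section_at F D p W1 -> section_at F D p W2 ->
  section_at F D p (fun q => W1 q + W2 q).
Proof.
move=> /section_atP[sW DW] /section_atP[sW' DW']; apply/section_atP.
split; first exact: smooth_fieldD.
by apply: filterS2 DW DW' => q; exact: (distributionD dD).
Qed.

Lemma section0 p : section_at F D p (fun=> 0).
Proof.
apply/section_atP; split; first exact: smooth_field0.
by near=> q; exact: (distribution0 dD).
Unshelve. all: by end_near. Qed.

Lemma section_sum p l (r : seq 'I_l) (W : 'I_l -> M -> tvec N) :
  (forall i, section_at F D p (W i)) ->
  section_at F D p (fun q => \sum_(i <- r) W i q).
Proof.
move=> sW; elim: r => [|i r IH].
  by under eq_fun do rewrite big_nil; exact: section0.
by under eq_fun do rewrite big_cons; exact: sectionD.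
Qed.

Lemma section_eq p W1 W2 : (\forall q \near p, W1 q = W2 q) ->
  section_at F D p W1 -> section_at F D p W2.
Proof.
move=> E /section_atP[sW DW]; apply/section_atP; split.
  exact: smooth_field_eq E sW.
by apply: filterS2 E DW => q ->.
Qed.

Variable nab : conn_op M N.
Hypothesis cnab : connection F D nab.

Lemma connection0 p v : tangent p v -> nab p v (fun=> 0) = 0.
Proof.
move=> tv; have := conn_leibniz cnab tv (smooth_at_cst p 0) (section0 p).
by rewrite (tangent_cst _ tv) !scale0r addr0.
Qed.

Lemma connection_sum p v l (f : 'I_l -> M -> R) (W : 'I_l -> M -> tvec N) :
  tangent p v -> (forall i, smooth_at p (f i)) -> (forall i, section_at F D p (W i)) ->
  nab p v (fun q => \sum_(i < l) f i q *: W i q) =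
  \sum_(i < l) ((v (f i) : R) *: W i p + f i p *: nab p v (W i)).
Proof.
move=> tv sf sW; elim: (index_enum 'I_l) => [|i r IH].
  by under eq_fun do rewrite big_nil; rewrite big_nil; exact: connection0.
under eq_fun do rewrite big_cons; rewrite big_cons -IH -(conn_leibniz cnab tv (sf i) (sW i)).
apply: (conn_additive cnab tv); first exact: sectionZ.
by apply: section_sum => j; exact: sectionZ.
Qed.

Lemma connection_expand p v (E : 'I_k -> N -> tvec N) (w : 'I_k -> M -> R) W :
  tangent p v -> (forall i, smooth_field_at id (F p) (E i)) ->
  (forall i, \forall q \near F p, D q (E i q)) ->
  (forall i, smooth_at p (w i)) -> (\forall q \near p, W q = \sum_(i < k) w i q *: E i (F q)) ->
  nab p v W =
  \sum_(i < k) ((v (w i) : R) *: E i (F p) + w i p *: nab p v (E i \o F)).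
Proof.
move=> tv sE DE sw EW.
have sEF i : section_at F D p (E i \o F).
  apply/section_atP; split; first exact: (smooth_field_comp sF (sE i)).
  exact: (smooth_map_near sF (P := fun q => D q (E i q))).
rewrite -(connection_sum tv sw sEF).
have sS : section_at F D p (fun q => \sum_(i < k) w i q *: (E i \o F) q).
  by apply: section_sum => i; exact: sectionZ.
apply: (conn_local cnab tv) => //; apply: section_eq sS.
by apply: filterS EW => q ->.
Qed.

End sections.

(** * Bilinear forms and pullback connections *)

(** A metric tensor stripped of non-degeneracy, because the metric induced on a lightlike
    hypersurface is degenerate; smoothness is put in germ form. *)
Record smooth_bilinear (R : realType) (n : nat) (N : manifold R n)
    (g : metric_field N) : Prop := SmoothBilinear {
  bilinear_sym : forall p v w, tangent p v -> tangent p w -> g p v w = g p w v;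
  bilinear_linear : forall p (a : R) u v w,
    tangent p u -> tangent p v -> tangent p w ->
    g p (a *: u + v) w = a * g p u w + g p v w;
  bilinear_smooth : forall p X Y, smooth_field_at id p X -> smooth_field_at id p Y ->
    smooth_at p (fun q => g q (X q) (Y q)) }.

Section bilinear_forms.
Variables (R : realType) (n : nat) (N : manifold R n) (g : metric_field N).

Lemma metric_tensor_bilinear : metric_tensor g -> smooth_bilinear g.
Proof.
move=> [gs gl gsm _]; split=> // p X Y sX sY.
have nX := smooth_field_near (smooth_map_id N) sX.
have nY := smooth_field_near (smooth_map_id N) sY.
have [U [oU Up UP]] := near_open (filterI nX nY).
exists U => //; apply: gsm => //; apply/(field_alongP (smooth_map_id N) _ oU) => q /UP[] //.
Qed.

Hypothesis bg : smooth_bilinear g.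

Lemma bilinearD p u v w : tangent p u -> tangent p v -> tangent p w ->
  g p (u + v) w = g p u w + g p v w.
Proof. by move=> tu tv tw; rewrite -[u]scale1r (bilinear_linear bg)// mul1r scale1r. Qed.

Lemma bilinearDr p u v w : tangent p u -> tangent p v -> tangent p w ->
  g p w (u + v) = g p w u + g p w v.
Proof.
move=> tu tv tw; rewrite (bilinear_sym bg)//; last exact: tangent_add.
by rewrite bilinearD// (bilinear_sym bg tu)// (bilinear_sym bg tv).
Qed.

Lemma bilinear0 p w : tangent p w -> g p 0 w = 0.
Proof.
move=> tw; have := bilinearD (tangent0 p) (tangent0 p) tw.
by rewrite addr0 => /eqP; rewrite -subr_eq0 opprD addNKr oppr_eq0 => /eqP.
Qed.

Lemma bilinearZ p a u w : tangent p u -> tangent p w -> g p (a *: u) w = a * g p u w.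
Proof.
move=> tu tw; rewrite -[a *: u]addr0 (bilinear_linear bg)//; last exact: tangent0.
by rewrite bilinear0// addr0.
Qed.

Lemma bilinearB p u v w : tangent p u -> tangent p v -> tangent p w ->
  g p (u - v) w = g p u w - g p v w.
Proof.
move=> tu tv tw; rewrite addrC -scaleN1r (bilinear_linear bg)//.
by rewrite mulN1r addrC.
Qed.

Lemma bilinear_lincombl p k (a : 'I_k -> R) (e : 'I_k -> tvec N) w :
  (forall i, tangent p (e i)) -> tangent p w ->
  g p (\sum_i a i *: e i) w = \sum_i a i * g p (e i) w.
Proof.
move=> te tw; elim: (index_enum 'I_k) => [|i r IH].
  by rewrite !big_nil bilinear0.
rewrite !big_cons (bilinear_linear bg) ?IH//.
by elim/big_ind: _ => [|u v|j _]; [exact: tangent0|exact: tangent_add|exact: tangentZ].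
Qed.

Lemma bilinear_lincombr p k (a : 'I_k -> R) (e : 'I_k -> tvec N) w :
  (forall i, tangent p (e i)) -> tangent p w ->
  g p w (\sum_i a i *: e i) = \sum_i a i * g p w (e i).
Proof.
move=> te tw; rewrite (bilinear_sym bg)//; last exact: tangent_lincomb.
rewrite bilinear_lincombl//; apply: eq_bigr => i _.
by rewrite (bilinear_sym bg).
Qed.

End bilinear_forms.

Section forms_along_maps.
Variables (R : realType) (m n : nat) (M : manifold R m) (N : manifold R n).
Variable F : M -> N.
Hypothesis sF : smooth_map F.
Variable g : metric_field N.
Hypothesis bg : smooth_bilinear g.

(** Smoothness of the form is assumed for fields on [N]; fields along [F] are brought back to these
    by expansion in a local frame. *)
Lemma bilinear_along_smooth p W1 W2 : smooth_field_at F p W1 -> smooth_field_at F p W2 ->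
  smooth_at p (fun q => g (F q) (W1 q) (W2 q)).
Proof.
move=> s1 s2; have [E [sE bE DE]] := local_frame (@tangent_distribution _ _ N) (F p).
have H W : smooth_field_at F p W -> exists w : 'I_n -> M -> R, (forall i, smooth_at p (w i)) /\
    \forall q \near p, W q = \sum_(i < n) w i q *: E i (F q).
  move=> sW; apply: (section_coefficients sF sE bE).
  by apply/(section_atP sF); split=> //; case: sW.
have [w1 [sw1 E1]] := H _ s1; have [w2 [sw2 E2]] := H _ s2.
apply: (@smooth_at_eq _ _ _ _
  (fun q => \sum_i w1 i q * (\sum_j w2 j q * g (F q) (E i (F q)) (E j (F q))))).
  have tE : \forall q \near p, forall i, tangent (F q) (E i (F q)).
    apply: filter_forall => i.
    exact: (smooth_map_near sF (P := fun q => tangent q (E i q))).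
  apply: filterS3 E1 E2 tE => q -> -> te.
  rewrite (bilinear_lincombl bg)//; last exact: tangent_lincomb.
  by apply: eq_bigr => i _; rewrite (bilinear_lincombr bg).
apply: smooth_at_sum => i _; apply: smooth_atM => //.
apply: smooth_at_sum => j _; apply: smooth_atM => //.
apply: (smooth_map_at sF (f := fun y => g y (E i y) (E j y))).
exact: (bilinear_smooth bg).
Qed.

Lemma induced_bilinear : smooth_bilinear (induced_metric F g).
Proof.
split=> [p v w tv tw|p a u v w tu tv tw|p X Y sX sY].
- by apply: (bilinear_sym bg); exact: differential_tangent.
- rewrite /induced_metric differential_linear (bilinear_linear bg)//;
    exact: differential_tangent.
- by apply: bilinear_along_smooth; exact: smooth_field_differential.
Qed.

End forms_along_maps.

Lemma section_extend (R : realType) (n : nat) (N : manifold R n) (k : nat)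
    (D : N -> set (tvec N)) (dD : distribution k D) p v : D p v -> exists Z, section_at id D p Z /\ Z p = v.
Proof.
have [E [sE bE DE]] := local_frame dD p.
rewrite (nbhs_singleton bE).2 => -[a ->].
exists (fun q => \sum_(i < k) a i *: E i q); split=> //.
apply: (section_sum (smooth_map_id N) dD) => i.
apply: (sectionZ (smooth_map_id N) dD); first exact: smooth_at_cst.
by apply/(section_atP (smooth_map_id N)); split.
Qed.

Section connection_values.
Variables (R : realType) (m n : nat) (M : manifold R m) (N : manifold R n).
Variable F : M -> N.
Hypothesis sF : smooth_map F.
Variables (k : nat) (D : N -> set (tvec N)).
Hypothesis dD : distribution k D.

Lemma connection_section p X W (nab : conn_op M N) : connection F D nab ->
  smooth_field_at id p X -> section_at F D p W ->
  section_at F D p (fun q => nab q (X q) W).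
Proof.
move=> cn sX [V [oV Vp] sW].
have nX := smooth_field_near (smooth_map_id M) sX.
have nV : \forall q \near p, V q by exact: open_nbhs_nbhs.
have [U [oU Up UP]] := near_open (filterI nX nV).
exists U => //; apply: (conn_section cn) => //.
  by apply/(field_alongP (smooth_map_id M) _ oU) => q /UP[].
split; last by move=> q /UP[_]; exact: sW.2.
have := sW.1; move=> /(field_alongP sF _ oV) H.
by apply/(field_alongP sF _ oU) => q /UP[_]; exact: H.
Qed.

(** [conn_section] speaks of whole fields, so [v] is first extended to one. *)
Lemma connection_value p v W (nab : conn_op M N) : connection F D nab ->
  tangent p v -> section_at F D p W -> D (F p) (nab p v W).
Proof.
move=> cn tv sW.
have [X [/(section_atP (smooth_map_id M))[sX _] <-]] :=
  section_extend (@tangent_distribution _ _ M) tv.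
have /(section_atP sF)[_ /nbhs_singleton //] := connection_section cn sX sW.
Qed.

Lemma connection_lincomb p l (a : 'I_l -> R) (v : 'I_l -> tvec M) W (nab : conn_op M N) :
  connection F D nab -> (forall i, tangent p (v i)) -> section_at F D p W ->
  nab p (\sum_i a i *: v i) W = \sum_i a i *: nab p (v i) W.
Proof.
move=> cn tv sW; elim: (index_enum 'I_l) => [|i r IH].
  rewrite !big_nil.
  have := conn_linear cn 1 (tangent0 p) (tangent0 p) sW.
  rewrite !scale1r addr0 => /eqP; rewrite -subr_eq0 opprD addNKr oppr_eq0.
  by move=> /eqP.
rewrite !big_cons (conn_linear cn) ?IH//.
by elim/big_ind: _ => [|u w|j _]; [exact: tangent0|exact: tangent_add|exact: tangentZ].
Qed.

End connection_values.

Lemma antisymmetric_sum (R : realType) (V : lmodType R) k (x y : 'I_k -> R)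
    (T : 'I_k -> 'I_k -> V) :
  \sum_i y i *: (\sum_l x l *: T l i) - \sum_i x i *: (\sum_l y l *: T l i) =
  \sum_i \sum_l (y i * x l) *: (T l i - T i l).
Proof.
under eq_bigr do rewrite scaler_sumr.
under [X in _ - X]eq_bigr do rewrite scaler_sumr.
rewrite [X in _ - X]exchange_big -sumrB; apply: eq_bigr => i _.
rewrite -sumrB; apply: eq_bigr => l _.
by rewrite !scalerA [x l * y i]mulrC -scalerBr.
Qed.

(** * Torsion and duality of pullback connections *)

Section pullbacks.
Variables (R : realType) (m n : nat) (M : manifold R m) (N : manifold R n).
Variable F : M -> N.
Hypothesis sF : smooth_map F.
Variables (k : nat) (D : N -> set (tvec N)).
Hypothesis dD : distribution k D.

Lemma pullback_expand (nab : conn_op N N) (nabF : conn_op M N) p v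
    (E : 'I_k -> N -> tvec N) (w : 'I_k -> M -> R) W :
  pullback_connection F D nab nabF -> tangent p v ->
  (forall i, smooth_field_at id (F p) (E i)) ->
  (forall i, \forall q \near F p, D q (E i q)) ->
  (forall i, smooth_at p (w i)) ->
  (\forall q \near p, W q = \sum_(i < k) w i q *: E i (F q)) ->
  nabF p v W = \sum_(i < k) ((v (w i) : R) *: E i (F p) +
     w i p *: nab (F p) (differential F p v) (E i)).
Proof.
move=> [cF pF] tv sE DE sw EW; rewrite (connection_expand sF dD cF tv sE DE sw EW).
apply: eq_bigr => i _; congr (_ + _ *: _); rewrite pF//.
by apply/(section_atP (smooth_map_id N)); split.
Qed.

(** Both sides are expanded in a frame [E] of [D]. The terms that differentiate coefficients agree,
    and the terms bilinear in the coefficients pair off antisymmetrically into torsions of the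
    [E i], which the hypothesis turns into brackets. That hypothesis concerns sections of [D] only,
    so the result applies to a connection on the screen. *)
Lemma pullback_torsion (nab : conn_op N N) (nabF : conn_op M N) p X Y :
  connection id D nab -> pullback_connection F D nab nabF ->
  (forall q Z1 Z2, section_at id D q Z1 -> section_at id D q Z2 ->
     nab q (Z1 q) Z2 - nab q (Z2 q) Z1 = lie_bracket Z1 Z2 q) ->
  smooth_field_at id p X -> smooth_field_at id p Y ->
  (\forall q \near p, D (F q) (differential F q (X q))) ->
  (\forall q \near p, D (F q) (differential F q (Y q))) ->
  nabF p (X p) (fun q => differential F q (Y q)) -
  nabF p (Y p) (fun q => differential F q (X q)) = differential F p (lie_bracket X Y p).
Proof.
move=> cn pF tf sX sY DX DY.
have [E [sE bE DE]] := local_frame dD (F p).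
have sec X' : smooth_field_at id p X' -> (\forall q \near p, D (F q) (differential F q (X' q))) ->
    section_at F D p (fun q => differential F q (X' q)).
  move=> s1 s2; apply/(section_atP sF); split=> //.
  exact: (smooth_field_differential sF).
have [x [sx Ex]] := section_coefficients sF sE bE (sec _ sX DX).
have [y [sy Ey]] := section_coefficients sF sE bE (sec _ sY DY).
have tX : tangent p (X p) by exact: nbhs_singleton sX.1.
have tY : tangent p (Y p) by exact: nbhs_singleton sY.1.
have sEi i : section_at id D (F p) (E i) by apply/(section_atP (smooth_map_id N)); split.
have tE i : tangent (F p) (E i (F p)) by exact: nbhs_singleton (sE i).1.
rewrite (pullback_expand pF tX sE DE sy Ey) (pullback_expand pF tY sE DE sx Ex).
rewrite (nbhs_singleton Ex) (nbhs_singleton Ey).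
have nE (a : 'I_k -> R) i : nab (F p) (\sum_(l < k) a l *: E l (F p)) (E i) =
    \sum_(l < k) a l *: nab (F p) (E l (F p)) (E i).
  exact: (connection_lincomb _ cn).
under eq_bigr do rewrite nE.
under [X in _ - X]eq_bigr do rewrite nE.
(* An iterated derivative of [f \o F] in the frame: one sum differentiates the coefficients, the
   other the frame fields. It is stated for arbitrary fields in order to serve both orders of [X]
   and [Y]. *)
have second (X1 Y1 : M -> tvec M) (x1 y1 : 'I_k -> M -> R) f : tangent p (X1 p) ->
    (forall i, smooth_at p (y1 i)) -> smooth_at (F p) f ->
    (\forall q \near p, differential F q (X1 q) = \sum_(i < k) x1 i q *: E i (F q)) ->
    (\forall q \near p, differential F q (Y1 q) = \sum_(i < k) y1 i q *: E i (F q)) ->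
    X1 p (fun q => Y1 q (f \o F)) = \sum_(i < k) X1 p (y1 i) * E i (F p) f +
      \sum_(i < k) y1 i p *: (\sum_(l < k) x1 l p *: (E l (F p) (fun q => E i q f) : R^o)).
  move=> tX1 sy1 sf Ex1 Ey1.
  have H2 : \forall q \near p, smooth_at (F q) f.
    by apply: (smooth_map_near sF (P := fun q => smooth_at q f)); exact: smooth_at_near.
  have EY : \forall q \near p, Y1 q (f \o F) = \sum_(i < k) y1 i q * ((fun q => E i q f) \o F) q.
    by apply: filterS2 H2 Ey1 => q sq Eq; rewrite -(differentialE _ sq) Eq tvec_sumE.
  have sEf i : smooth_at (F p) (fun q => E i q f) by exact: (sE i).2.
  rewrite (tangent_near tX1 EY) (tangent_sum tX1) => [|i]; last first.
    by apply: smooth_atM => //; exact: smooth_map_at.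
  rewrite -big_split; apply: eq_bigr => i _ /=.
  rewrite (tangentM tX1 (sy1 i) (smooth_map_at sF (sEf i))); congr (_ + _ * _).
  by rewrite -(differentialE _ (sEf i)) (nbhs_singleton Ex1) tvec_sumE.
rewrite !big_split /= opprD addrACA -sumrB antisymmetric_sum.
apply/funext => f.
pose d k := (X p (y k) - Y p (x k)) *: E k (F p).
rewrite (_ : (\sum_i _ + _) f = \sum_(i < k) (X p (y i) - Y p (x i)) * E i (F p) f +
    \sum_(i < k) \sum_(l < k) (y i p * x l p) * lie_bracket (E l) (E i) (F p) f); last first.
  rewrite -[LHS]/((\sum_i _ : tvec N) f + (\sum_i _ : tvec N) f) !fct_sumE; congr (_ + _).
    by apply: eq_bigr => i _; rewrite -scalerBl.
  apply: eq_bigr => i _; rewrite fct_sumE; apply: eq_bigr => l _.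
  by rewrite -tf.
have [sf|sf] := pselect (smooth_at (F p) f); last first.
  rewrite (differential_notsmooth _ sf) !big1 ?addr0// => i _.
    by rewrite big1// => l _; rewrite /lie_bracket asboolF// mulr0.
  by rewrite (tangent_notsmooth (tE i) sf) mulr0.
rewrite [RHS](differentialE _ sf) [in RHS]/lie_bracket [in RHS]asboolT; last exact: (smooth_map_at sF sf).
rewrite (second X Y x y f)// (second Y X y x f)// opprD addrACA -sumrB antisymmetric_sum.
congr (_ + _); first by apply: eq_bigr => i _; rewrite mulrBl.
by apply: eq_bigr => i _; apply: eq_bigr => l _; rewrite /lie_bracket asboolT.
Qed.

(** Two connections are allowed so that this covers both statistical duality and, when they are
    equal, metric compatibility. The image of [v] has to lie in [D] because the hypothesis
    differentiates along sections of [D]. After expansion in a frame the identity reduces to the one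
    for the frame fields. *)
Lemma pullback_duality (g : metric_field N) (nab nab' : conn_op N N)
    (nabF nabF' : conn_op M N) p v Y Z : smooth_bilinear g ->
  connection id D nab -> connection id D nab' ->
  pullback_connection F D nab nabF -> pullback_connection F D nab' nabF' ->
  (forall q Z0 Z1 Z2, section_at id D q Z0 -> section_at id D q Z1 -> section_at id D q Z2 ->
     Z0 q (fun r => g r (Z1 r) (Z2 r)) =
     g q (nab q (Z0 q) Z1) (Z2 q) + g q (Z1 q) (nab' q (Z0 q) Z2)) ->
  tangent p v -> D (F p) (differential F p v) ->
  section_at F D p Y -> section_at F D p Z ->
  v (fun q => g (F q) (Y q) (Z q)) =
  g (F p) (nabF p v Y) (Z p) + g (F p) (Y p) (nabF' p v Z).
Proof.
move=> bg cn cn' pF pF' dual tv Dv sY sZ.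
have [E [sE bE DE]] := local_frame dD (F p).
have [y [sy Ey]] := section_coefficients sF sE bE sY.
have [z [sz Ez]] := section_coefficients sF sE bE sZ.
have sEi i : section_at id D (F p) (E i) by apply/(section_atP (smooth_map_id N)); split.
have tE i : tangent (F p) (E i (F p)) by exact: nbhs_singleton (sE i).1.
have tdv : tangent (F p) (differential F p v) by exact: differential_tangent.
have tn i : tangent (F p) (nab (F p) (differential F p v) (E i)).
  apply: (distribution_tangent dD); exact: (connection_value (smooth_map_id N) cn tdv (sEi i)).
have tn' i : tangent (F p) (nab' (F p) (differential F p v) (E i)).
  apply: (distribution_tangent dD); exact: (connection_value (smooth_map_id N) cn' tdv (sEi i)).
pose G i l q := g q (E i q) (E l q).
have sG i l : smooth_at (F p) (G i l) by exact: (bilinear_smooth bg).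
have sGF i l : smooth_at p (G i l \o F) by exact: smooth_map_at.
have vG i l : v (G i l \o F) = g (F p) (nab (F p) (differential F p v) (E i)) (E l (F p)) +
    g (F p) (E i (F p)) (nab' (F p) (differential F p v) (E l)).
  have [Z0 [sZ0 Z0v]] := section_extend dD Dv.
  by rewrite -(differentialE _ (sG i l)) -Z0v dual.
have nE : \forall q \near p, g (F q) (Y q) (Z q) =
    \sum_i y i q * (\sum_l z l q * (G i l \o F) q).
  have tEn : \forall q \near p, forall i, tangent (F q) (E i (F q)).
    apply: filter_forall => i.
    by apply: (smooth_map_near sF (P := fun q => tangent q (E i q))); exact: (sE i).1.
  apply: filterS3 Ey Ez tEn => q -> -> te.
  rewrite (bilinear_lincombl bg)//; last exact: tangent_lincomb.
  by apply: eq_bigr => i _; rewrite (bilinear_lincombr bg).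
have sum_smooth i : smooth_at p (fun q => \sum_l z l q * (G i l \o F) q).
  by apply: smooth_at_sum => l _; exact: smooth_atM.
rewrite (tangent_near tv nE) (tangent_sum tv) => [|i]; last exact: smooth_atM.
have step i : v (fun q => y i q * (\sum_l z l q * (G i l \o F) q)) =
   v (y i) * (\sum_l z l p * G i l (F p)) + y i p * (\sum_l (v (z l) * G i l (F p) +
     z l p * (g (F p) (nab (F p) (differential F p v) (E i)) (E l (F p)) +
    g (F p) (E i (F p)) (nab' (F p) (differential F p v) (E l))))).
  rewrite (tangentM tv)//; congr (_ + _ * _); rewrite (tangent_sum tv) => [|l]; last exact: smooth_atM.
  by apply: eq_bigr => l _; rewrite (tangentM tv)// vG.
under eq_bigr do rewrite step.
rewrite (pullback_expand pF tv sE DE sy Ey) (pullback_expand pF' tv sE DE sz Ez).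
rewrite (nbhs_singleton Ey) (nbhs_singleton Ez) !big_split /=.
rewrite (bilinearD bg); do ?exact: tangent_lincomb.
rewrite !(bilinear_lincombl bg)//; do ?[exact: tangent_lincomb|
  by apply: tangent_add; exact: tangent_lincomb].
rewrite -addrA; congr (_ + _).
  by apply: eq_bigr => i _; rewrite (bilinear_lincombr bg).
rewrite -big_split; apply: eq_bigr => i _ /=.
rewrite (bilinearDr bg)//; do ?exact: tangent_lincomb.
rewrite !(bilinear_lincombr bg)// -mulrDr; congr (_ * _).
rewrite -!big_split; apply: eq_bigr => l _ /=; rewrite mulrDr.
by rewrite addrCA.
Qed.

End pullbacks.

(** * The induced connections of the hypersurface *)

Section pointwise_forms.
Variables (R : realType) (n : nat) (M : manifold R n).

Lemma common_domain p (X Y Z : M -> tvec M) : smooth_field_at id p X ->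
  smooth_field_at id p Y -> smooth_field_at id p Z ->
  exists U : set M, [/\ open U, U p, vector_field U X, vector_field U Y & vector_field U Z].
Proof.
have sid := smooth_map_id M => sX sY sZ.
have H : \forall q \near p, [/\ smooth_field_at id q X, smooth_field_at id q Y &
    smooth_field_at id q Z].
  by apply: filterS3 (smooth_field_near sid sX) (smooth_field_near sid sY) (smooth_field_near sid sZ).
have [U [oU Up UP]] := near_open H; exists U.
by split=> //; apply/(field_alongP sid _ oU) => q /UP[].
Qed.

Lemma tangent_extend p v : tangent p v -> exists X : M -> tvec M, smooth_field_at id p X /\ X p = v.
Proof.
move=> tv; have [X [/(section_atP (smooth_map_id M))[sX _] Xv]] :=
  section_extend (@tangent_distribution _ _ M) tv.
by exists X.
Qed.

Lemma torsion_free_at (nab : conn_op M M) : torsion_free nab ->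
  forall p X Y, smooth_field_at id p X -> smooth_field_at id p Y ->
  nab p (X p) Y - nab p (Y p) X = lie_bracket X Y p.
Proof.
move=> tf p X Y sX sY; have [U [oU Up vX vY _]] := common_domain sX sY sY.
exact: (tf U).
Qed.

Lemma torsion_free_from_at (nab : conn_op M M) :
  (forall p X Y, smooth_field_at id p X -> smooth_field_at id p Y ->
  nab p (X p) Y - nab p (Y p) X = lie_bracket X Y p) -> torsion_free nab.
Proof.
move=> H U X Y oU /(field_alongP (smooth_map_id M) _ oU) vX
  /(field_alongP (smooth_map_id M) _ oU) vY p Up.
by apply: H; [exact: vX|exact: vY].
Qed.

Lemma metric_connection_at (g : metric_field M) (nab : conn_op M M) :
  metric_connection g nab ->
  forall p v Y Z, tangent p v -> smooth_field_at id p Y -> smooth_field_at id p Z ->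
  v (fun q => g q (Y q) (Z q)) = g p (nab p v Y) (Z p) + g p (Y p) (nab p v Z).
Proof.
move=> mc p v Y Z /tangent_extend[X [sX <-]] sY sZ.
have [U [oU Up vX vY vZ]] := common_domain sX sY sZ.
have /eqP := mc U X Y Z oU vX vY vZ p Up.
by rewrite /cov_metric -addrA -opprD subr_eq0 => /eqP.
Qed.

Lemma metric_connection_from_at (g : metric_field M) (nab : conn_op M M) :
  (forall p v Y Z, tangent p v -> smooth_field_at id p Y -> smooth_field_at id p Z ->
  v (fun q => g q (Y q) (Z q)) = g p (nab p v Y) (Z p) + g p (Y p) (nab p v Z)) ->
  metric_connection g nab.
Proof.
move=> H U X Y Z oU [tX _] /(field_alongP (smooth_map_id M) _ oU) vY
  /(field_alongP (smooth_map_id M) _ oU) vZ p Up.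
by rewrite /cov_metric (H p _ _ _ (tX _ Up) (vY _ Up) (vZ _ Up)) -addrA -opprD subrr.
Qed.

Lemma parallel_at (D : M -> set (tvec M)) (nab : conn_op M M) : parallel D nab ->
  forall p v Y, tangent p v -> section_at id D p Y -> D p (nab p v Y).
Proof.
move=> pD p v Y /tangent_extend[X [sX <-]] /(section_atP (smooth_map_id M))[sY DY].
have nX := smooth_field_near (smooth_map_id M) sX.
have nY := smooth_field_near (smooth_map_id M) sY.
have [U [oU Up UP]] := near_open (filterI (filterI nX nY) DY).
apply: (pD U) => //; first by apply/(field_alongP (smooth_map_id M) _ oU) => q /UP[[]].
split; last by move=> q /UP[].
by apply/(field_alongP (smooth_map_id M) _ oU) => q /UP[[]].
Qed.

End pointwise_forms.

Section hypersurface.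
Variables (R : realType) (m : nat) (Mbar : manifold R m.+2) (gbar : metric_field Mbar).
Variables (M : manifold R m.+1) (i : M -> Mbar) (ST : M -> set (tvec M)).
Let g := induced_metric i gbar.
Hypothesis ii : immersion i.
Hypothesis bgbar : smooth_bilinear gbar.
Hypothesis Hscreen : screen_distribution g ST.
Let si : smooth_map i := ii.1.
Let dS : distribution m ST := screen_distr Hscreen.
Let dTbar : distribution m.+2 (@tangent R m.+2 Mbar) := @tangent_distribution _ _ Mbar.

Let bg : smooth_bilinear g := induced_bilinear si bgbar.

(** Fixing [p] turns the local data of the Gauss formula into single vectors [xi] and [N], the form
    in which the orthogonality arguments use them. *)
Lemma gauss (nabbar : conn_op Mbar Mbar) (nab : conn_op M M) :
  induced_connection gbar i ST nabbar nab ->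
  exists2 nabi : conn_op M Mbar, pullback_connection i (@tangent R m.+2 Mbar) nabbar nabi &
  forall p, exists (xi : tvec M) (N : tvec Mbar) (B : tvec M -> (M -> tvec M) -> R),
  [/\ Rad g p xi, tangent (i p) N, gbar (i p) N (differential i p xi) = 1,
    forall w, ST p w -> gbar (i p) N (differential i p w) = 0 &
    forall v Y, tangent p v -> smooth_field_at id p Y ->
      nabi p v (fun q => differential i q (Y q)) = differential i p (nab p v Y) + B v Y *: N].
Proof.
move=> [_ [nabi pi H]]; exists nabi => // p.
have [U [xi [N [B [[oU Up] [[_ Rxi] _] [[tN _] HN] HB]]]]] := H p.
have [N0 N1 NS] := HN p Up.
exists (xi p), (N p), (B p); split=> //; [exact: Rxi|exact: tN|].
move=> v Y tv sY; apply: HB => //.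
by apply/(section_atP (smooth_map_id M)); split=> //; case: sY.
Qed.

Let tangent_section p (Y : M -> tvec M) : smooth_field_at id p Y ->
  section_at i (@tangent R m.+2 Mbar) p (fun q => differential i q (Y q)).
Proof.
move=> sY; apply/(section_atP si); split; first exact: smooth_field_differential.
exact: (smooth_field_differential si sY).1.
Qed.

(** The torsion [u] of [nab] is tangent to [M], and the vanishing of the ambient torsion makes its
    image a multiple of [N]. Pairing the image with that of [xi] gives zero, as [xi] is radical, and
    also the coefficient of [N], as [N] and [xi] have product 1. So the image vanishes, and [u] with
    it by injectivity of the differential. *)
Lemma induced_torsion_free (nabbar : conn_op Mbar Mbar) (nab : conn_op M M) :
  affine_connection nabbar -> torsion_free nabbar ->
  induced_connection gbar i ST nabbar nab -> torsion_free nab.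
Proof.
move=> cbar tfbar Hn; have cn := Hn.1; apply: torsion_free_from_at => p X Y sX sY.
have [nabi pi /(_ p)[xi [N [B [Rxi tN N1 NS HB]]]]] := gauss Hn.
have tX : tangent p (X p) := nbhs_singleton sX.1.
have tY : tangent p (Y p) := nbhs_singleton sY.1.
have cv v W : tangent p v -> smooth_field_at id p W -> tangent p (nab p v W).
  move=> tv sW; apply: (connection_value (smooth_map_id M) cn tv).
  by apply/(section_atP (smooth_map_id M)); split=> //; case: sW.
have E : nabi p (X p) (fun q => differential i q (Y q)) -
    nabi p (Y p) (fun q => differential i q (X q)) = differential i p (lie_bracket X Y p).
  apply: (pullback_torsion si dTbar cbar pi) => //.
  - move=> q Z1 Z2 /(section_atP (smooth_map_id Mbar))[s1 _] /(section_atP (smooth_map_id Mbar))[s2 _].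
    exact: (torsion_free_at tfbar s1 s2).
  - exact: (smooth_field_differential si sX).1.
  - exact: (smooth_field_differential si sY).1.
pose u := nab p (X p) Y - nab p (Y p) X - lie_bracket X Y p.
have tu : tangent p u.
  apply: tangent_sub; last exact: bracket_tangent.
  by apply: tangent_sub; exact: cv.
have txi : tangent p xi := Rxi.1.
have Eu : differential i p u = (B (Y p) X - B (X p) Y) *: N.
  rewrite !differential_sub -E (HB _ _ tX sY) (HB _ _ tY sX) scalerBl.
  by rewrite opprB addrA addrA subrK opprD addrA [differential _ _ _ + _]addrC addrK.
have b0 : B (Y p) X - B (X p) Y = 0.
  have : gbar (i p) (differential i p u) (differential i p xi) = 0.
    by rewrite -[LHS]/(g p u xi) (bilinear_sym bg)// Rxi.2.
  rewrite Eu (bilinearZ bgbar) ?N1 ?mulr1//; exact: differential_tangent.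
have u0 : u = 0.
  apply: (ii.2 p) => //; first exact: tangent0.
  by rewrite Eu b0 scale0r -[in RHS](scale0r (0 : tvec M)) differentialZ scale0r.
by apply/eqP; rewrite -subr_eq0 -/u u0.
Qed.

Variables (nabbar nabbars : conn_op Mbar Mbar) (nab nabs nabS nabsS : conn_op M M).
Hypothesis Hstat : statistical_manifold gbar nabbar nabbars.
Hypothesis Hnab : induced_connection gbar i ST nabbar nab.
Hypothesis Hnabs : induced_connection gbar i ST nabbars nabs.

Let sid : smooth_map (@id M) := smooth_map_id M.

Let nab_tangent (nb : conn_op M M) p v Y : affine_connection nb ->
  tangent p v -> smooth_field_at id p Y -> tangent p (nb p v Y).
Proof.
move=> cn tv sW; apply: (connection_value (smooth_map_id M) cn tv).
by apply/(section_atP (smooth_map_id M)); split=> //; case: sW.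
Qed.

(* On the screen the transversal parts of the Gauss formulas are orthogonal to
   both arguments, so the ambient duality restricts. *)
Lemma screen_duality p v Y Z : tangent p v -> section_at id ST p Y -> section_at id ST p Z ->
  v (fun q => g q (Y q) (Z q)) = g p (nab p v Y) (Z p) + g p (Y p) (nabs p v Z).
Proof.
move=> tv /(section_atP sid)[sY /nbhs_singleton DY] /(section_atP sid)[sZ /nbhs_singleton DZ].
have [nabi pni /(_ p)[xi [N [B [_ tN _ NS HB]]]]] := gauss Hnab.
have [nabsi pnsi /(_ p)[xis [Ns [Bs [_ tNs _ NSs HBs]]]]] := gauss Hnabs.
have tY : tangent p (Y p) := nbhs_singleton sY.1.
have tZ : tangent p (Z p) := nbhs_singleton sZ.1.
rewrite (pullback_duality si dTbar bgbar (stat_connection Hstat)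
  (stat_dual_connection Hstat) pni pnsi _ tv _ (tangent_section sY) (tangent_section sZ)).
- rewrite (HB _ _ tv sY) (HBs _ _ tv sZ).
  rewrite (bilinearD bgbar); do ?exact: differential_tangent; last first.
  + exact: tangentZ.
  + by apply: differential_tangent => //; apply: nab_tangent => //; exact: Hnab.1.
  rewrite (bilinearDr bgbar); do ?exact: differential_tangent; last first.
  + exact: tangentZ.
  + by apply: differential_tangent => //; apply: nab_tangent => //; exact: Hnabs.1.
  rewrite (bilinearZ bgbar) ?NS ?mulr0 ?addr0//; last exact: differential_tangent.
  rewrite [X in _ + (_ + X)](bilinear_sym bgbar) ?(bilinearZ bgbar) ?NSs ?mulr0 ?addr0//;
    do ?exact: differential_tangent; exact: tangentZ.
- move=> q Z0 Z1 Z2 /(section_atP (smooth_map_id Mbar))[s0 _].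
  move=> /(section_atP (smooth_map_id Mbar))[s1 _] /(section_atP (smooth_map_id Mbar))[s2 _].
  have [U [oU Up v0 v1 v2]] := common_domain s0 s1 s2.
  exact: (stat_dual Hstat oU v0 v1 v2).
- exact: differential_tangent.
Qed.

Hypothesis S_par : parallel ST nab.
Hypothesis S_pars : parallel ST nabs.
Hypothesis Hmetric : metric_connection g nab.

Lemma dual_screen_eq p v Z : tangent p v -> section_at id ST p Z -> nabs p v Z = nab p v Z.
Proof.
move=> tv secZ; have /(section_atP sid)[sZ /nbhs_singleton DZ] := secZ.
have Sn := parallel_at S_par tv secZ; have Sns := parallel_at S_pars tv secZ.
have tn := distribution_tangent dS Sn; have tns := distribution_tangent dS Sns.
apply/eqP; rewrite -subr_eq0; apply/eqP.
apply: (screen_nondegenerate Hscreen (p := p)).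
  rewrite addrC -scaleN1r; apply: (distributionD dS) => //; exact: (distributionZ dS).
move=> w Sw; have [Y [secY Yw]] := section_extend dS Sw.
have /(section_atP sid)[sY _] := secY.
have tw := distribution_tangent dS Sw.
have := screen_duality tv secY secZ.
rewrite (metric_connection_at Hmetric tv sY sZ) => /addrI; rewrite Yw => E.
by rewrite (bilinearB bg)// (bilinear_sym bg tns)// (bilinear_sym bg tn)// E subrr.
Qed.

(** Parallelism puts [nb p v W] in the screen, like [nbS p v W]; the multiple of [xi] by which they
    differ lies both in the screen and in the radical, hence is zero. *)
Lemma screen_connection_eq (nb nbS : conn_op M M) : parallel ST nb ->
  induced_screen_connection g ST nb nbS ->
  forall p v W, tangent p v -> section_at id ST p W -> nbS p v W = nb p v W.
Proof.
move=> par [cS H] p v W tv sW.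
have [U [xi [C [[oU Up] [[_ Rxi] _] HC]]]] := H p.
have E := HC p v W Up tv sW.
have SnS : ST p (nbS p v W) by exact: (connection_value sid cS tv sW).
have Sn : ST p (nb p v W) by exact: (parallel_at par tv sW).
have C0 : C p v W *: xi p = 0.
  apply: (screen_disjoint Hscreen (p := p)).
    have -> : C p v W *: xi p = nb p v W + (-1) *: nbS p v W.
      by rewrite E scaleN1r addrC addKr.
    by apply: (distributionD dS) => //; exact: (distributionZ dS).
  have [txi Rg] := Rxi p Up; split; first exact: tangentZ.
  by move=> w tw; rewrite (bilinearZ bg)// Rg// mulr0.
by rewrite E C0 addr0.
Qed.

Lemma screen_involutive : torsion_free nab -> forall p X Y,
  section_at id ST p X -> section_at id ST p Y -> ST p (lie_bracket X Y p).
Proof.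
move=> tf p X Y secX secY.
have /(section_atP sid)[sX _] := secX; have /(section_atP sid)[sY _] := secY.
rewrite -(torsion_free_at tf sX sY) -scaleN1r.
apply: (distributionD dS); last apply: (distributionZ dS).
  apply: (parallel_at S_par) => //; exact: nbhs_singleton sX.1.
apply: (parallel_at S_par) => //; exact: nbhs_singleton sY.1.
Qed.

End hypersurface.

(** * Frobenius' theorem *)

(** Balls with rational centres and radii 1/(k+1) form a countable base. The leaf is modelled on
    R^m, which must therefore satisfy the axioms of a manifold. *)
Lemma row_second_countable (R : realType) m : @second_countable 'rV[R]_m.
Proof.
pose f (u : 'rV[rat]_m * nat) : set 'rV[R]_m :=
  ball (map_mx ratr u.1 : 'rV[R]_m) (u.2.+1%:R^-1).
exists (f @` setT).
  exact: card_le_trans (card_image_le f setT) (countableP _).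
split=> [_ [u _ <-]|x V /nbhs_ballP[e /= e0 xV]].
  by apply: ball_open; rewrite invr_gt0 ltr0n.
have e2 : 0 < e / 2 by rewrite divr_gt0.
have [N] := ltr_add_invr e2; rewrite add0r => Ne.
have N0 : 0 < N.+1%:R^-1 :> R by rewrite invr_gt0 ltr0n.
have H j : exists q : rat, `|x ord0 j - ratr q| < N.+1%:R^-1.
  have [|q] := @rat_in_itvoo R (x ord0 j - N.+1%:R^-1) (x ord0 j + N.+1%:R^-1).
    by rewrite ltrBlDr -addrA ltrDl addr_gt0.
  by rewrite in_itv/= => h; exists q; rewrite distrC ltr_distl.
have [q Hq] := choice H.
have xq : ball (map_mx ratr (\row_j q j) : 'rV[R]_m) (N.+1%:R^-1) x.
  by split=> // i j; rewrite !mxE [i]ord1 /ball/= distrC; exact: Hq.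
exists (f (\row_j q j, N)); first by split=> //; exists (\row_j q j, N).
move=> z qz; apply: xV; have := ball_triangle (ball_sym xq) qz.
by apply: le_ball; rewrite /= [leRHS]splitr; apply: lerD; exact: ltW.
Qed.

Section euclidean_space.
Variables (R : realType) (m : nat).

Definition id_chart : chart R m 'rV[R]_m := Chart setT id id.

Lemma id_chart_is_chart : is_chart id_chart.
Proof.
split; [exact: openT| |by []| |]; first by rewrite image_id; exact: openT.
all: by move=> p _; exact: cvg_id.
Qed.

Lemma euclidean_smooth (c d : chart R m 'rV[R]_m) : [set id_chart] c -> [set id_chart] d ->
  forall i : 'I_m,
    smooth_Rn (cfun c @` (cdom c `&` cdom d)) (fun x => cfun d (cinv c x) ord0 i).
Proof. by move=> -> -> i k; exact: Ck_coord. Qed.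

Definition euclidean : manifold R m :=
  @Manifold R m 'rV[R]_m [set id_chart] (@norm_hausdorff _ _)
    (@row_second_countable R m)
    (fun p => ex_intro2 _ _ id_chart erefl I)
    (fun c => fun E : c = id_chart => eq_ind_r _ id_chart_is_chart E)
    euclidean_smooth.

End euclidean_space.

(* A diffeomorphism of R^m onto an open subset of the ball of radius r: it lets the
   whole of R^m serve as the leaf. *)
Section squeeze.
Variables (R : realType) (m : nat) (r : R).
Hypothesis r0 : 0 < r.

(** A rescaled and shifted logistic function: it decreases from r/2 to -r/2 and fixes 0, so the leaf
    keeps its base point. *)
Definition squeeze1 (t : R) : R := r * ((1 + expR t)^-1 - 2^-1).

Definition squeeze (y : 'rV[R]_m) : 'rV[R]_m := \row_k squeeze1 (y ord0 k).

Lemma expR_neq0 (t : R) : 1 + expR t != 0.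
Proof. by rewrite gt_eqF// addr_gt0// expR_gt0. Qed.

Lemma squeeze_lt y : `|squeeze y| < r.
Proof.
apply: (@le_lt_trans _ _ (r / 2)); last by rewrite ltr_pdivrMr// mulr_natr mulr2n ltrDl.
apply: row_norm_le => [|k]; first by rewrite divr_ge0// ltW.
rewrite mxE normrM gtr0_norm// ler_wpM2l ?(ltW r0)//.
have e0 := expR_gt0 (y ord0 k); set t := expR _.
have h1 : 0 < (1 + t)^-1 by rewrite invr_gt0 addr_gt0.
have h2 : (1 + t)^-1 < 1 by rewrite invf_lt1 ?addr_gt0// ltrDl.
by rewrite ler_norml; apply/andP; split; lra.
Qed.

Lemma squeeze0 : squeeze 0 = 0.
Proof. by apply/rowP => k; rewrite !mxE /squeeze1 expR0 subrr mulr0. Qed.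

Lemma squeeze_inj : injective squeeze.
Proof.
move=> y z /rowP E; apply/rowP => k; have := E k; rewrite !mxE /squeeze1.
move=> /(mulfI (lt0r_neq0 r0)) /addIr /invr_inj /addrI; exact: expR_inj.
Qed.

Lemma derive_expR_coord (v y : 'rV[R]_m) k :
  differentiable (fun z : 'rV[R]_m => expR (z ord0 k)) y /\
  'D_v (fun z : 'rV[R]_m => expR (z ord0 k)) y = v ord0 k * expR (y ord0 k).
Proof.
have dc : differentiable (fun z : 'rV[R]_m => z ord0 k) y by exact: differentiable_coord.
have de : differentiable (@expR R) (y ord0 k) by apply/derivable1_diffP/derivable_expR.
have d : differentiable (expR \o (fun z : 'rV[R]_m => z ord0 k)) y by exact: differentiable_comp.
split=> //; rewrite -[LHS]/('D_v (expR \o (fun z : 'rV[R]_m => z ord0 k)) y).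
rewrite deriveE// diff_comp//= -(deriveE _ dc) derive_coord.
rewrite -[X in 'd _ _ X]mulr1 -[X in 'd _ _ X]/(v ord0 k *: (1 : R)) linearZ -(deriveE _ de).
by congr (_ * _); exact: (@derive_val _ _ _ _ _ _ _ (is_derive_expR _)).
Qed.

Lemma Ck_expR_coord k (a : 'I_m) (A : set 'rV[R]_m) :
  open A -> Ck k A (fun z : 'rV[R]_m => expR (z ord0 a)).
Proof.
move=> oA; elim: k => [|k IH].
  move=> y _; apply: differentiable_continuous; exact: (derive_expR_coord 0 y a).1.
split=> [y _|v]; first exact: (derive_expR_coord 0 y a).1.
have -> : 'D_v (fun z : 'rV[R]_m => expR (z ord0 a)) = fun z => v ord0 a * expR (z ord0 a).
  by apply/funext => y; exact: (derive_expR_coord v y a).2.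
by apply: Ck_mul => //; exact: Ck_cst.
Qed.

Lemma squeeze_smooth i : smooth_Rn setT (fun y => squeeze y ord0 i).
Proof.
move=> k; have oT := @openT 'rV[R]_m.
under eq_fun do rewrite mxE.
apply: Ck_mul => //; first exact: Ck_cst.
apply: Ck_add => //; last exact: Ck_cst.
apply: Ck_inv => [//|x _|]; first exact: expR_neq0.
by apply: Ck_add => //; [exact: Ck_cst|exact: Ck_expR_coord].
Qed.

Lemma derive_squeeze (v y : 'rV[R]_m) i : 'D_v (fun z => squeeze z ord0 i) y =
  v ord0 i * (- r * expR (y ord0 i) / (1 + expR (y ord0 i)) ^+ 2).
Proof.
have [d D] := derive_expR_coord v y i.
under eq_fun do rewrite mxE.
have de := @diff_derivable _ _ _ _ _ v d.
have d1 : is_derive y v (fun z : 'rV[R]_m => 1 + expR (z ord0 i)) (v ord0 i * expR (y ord0 i)).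
  rewrite -D -[X in is_derive _ _ _ X]add0r.
  by apply: is_deriveD; exact: derivableP.
have n0 := expR_neq0 (y ord0 i).
have d2 : is_derive y v (fun z : 'rV[R]_m => (1 + expR (z ord0 i))^-1)
    (- (1 + expR (y ord0 i)) ^- 2 *: (v ord0 i * expR (y ord0 i))).
  have [d11 <-] := d1; apply: DeriveDef; first exact: derivableV.
  by rewrite deriveV.
have d3 := is_deriveZ r (is_deriveB d2 (is_derive_cst (2^-1 : R) y v)).
rewrite -[LHS]/('D_v (r \*: ((fun z : 'rV[R]_m => (1 + expR (z ord0 i))^-1) - cst 2^-1)) y).
rewrite (@derive_val _ _ _ _ _ _ _ d3) subr0.
rewrite -[LHS]/(r * (- (1 + expR (y ord0 i)) ^- 2 * (v ord0 i * expR (y ord0 i)))).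
by ring.
Qed.

End squeeze.

Section adapted_frames.
Variables (R : realType) (n : nat) (M : manifold R n).

Lemma coord_vec_mulmx m c (q : M) (a : 'rV[R]_m) (A : 'M[R]_(m, n)) : atlas c -> cdom c q ->
  coord_vec c q (a *m A) = \sum_i a ord0 i *: coord_vec c q (row i A).
Proof.
move=> ac cq; have tc b : tangent q (coord_vec c q b) by exact: coord_vec_tangent.
apply: (tangent_ext _ _ ac cq) => // [|j]; first exact: tangent_lincomb.
rewrite tvec_sumE coord_vec_coord// mxE; apply: eq_bigr => i _.
by rewrite coord_vec_coord// mxE.
Qed.

Lemma coord_vec_inj c (q : M) : atlas c -> cdom c q -> injective (@coord_vec R n M c q).
Proof.
by move=> ac cq a b E; apply/rowP => i; rewrite -!(coord_vec_coord _ _ ac cq) E.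
Qed.

Variables (m : nat) (D : M -> set (tvec M)).
Hypothesis dD : distribution m D.
Hypothesis iD : forall p X Y, section_at id D p X -> section_at id D p Y ->
  D p (lie_bracket X Y p).

(* Normalizing the frame by F q *m P = 1 for a constant matrix P makes it commute:
   the brackets lie in D and are killed by P. *)
Lemma adapted_frame p0 : exists c (U : set M) (F : M -> 'M[R]_(m, n)) (P : 'M[R]_(n, m)),
  [/\ [/\ atlas c, open U, U p0 & U `<=` cdom c],
      forall q, U q -> D q = [set coord_vec c q (a *m F q) | a in setT],
      forall q, U q -> F q *m P = 1%:M,
      forall q k a, U q -> smooth_at q (fun r => F r k a) &
      forall q k l a, U q -> coord_vec c q (row k (F q)) (fun r => F r l a) =
        coord_vec c q (row l (F q)) (fun r => F r k a)].
Proof.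
have sid := smooth_map_id M.
have [E [sE bE DE]] := local_frame dD p0.
have [c ac cp0] := atlas_cover p0.
pose A q : 'M[R]_(m, n) := \matrix_(i, a) E i q (coord_fun c a).
have sA0 i a : smooth_at p0 (fun q => A q i a).
  under eq_fun do rewrite mxE.
  by apply: (sE i).2; exact: coord_fun_smooth.
have tE0 i : tangent p0 (E i p0) := nbhs_singleton (sE i).1.
have rA : row_free (A p0).
  exact: (frame_row_free ac cp0 tE0 (nbhs_singleton bE).1).
(* A constant right inverse of the frame matrix at [p0]: [B] is the identity there, hence invertible
   nearby, and its inverse normalizes the frame. *)
pose P := pinvmx (A p0); pose B q := A q *m P.
have Bp0 : \det (B p0) != 0 by rewrite /B mulmxVp// det1 oner_eq0.
have sB0 i j : smooth_at p0 (fun q => B q i j).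
  by apply: smooth_at_mulmx => // ? ?; exact: smooth_at_cst.
have [oc _ _ _ _] := atlas_chart ac.
have nc : \forall q \near p0, cdom c q by exact: open_nbhs_nbhs.
have nA : \forall q \near p0, forall i a, smooth_at q (fun r => A r i a).
  by apply: filter_forall => i; apply: filter_forall => a; exact: smooth_at_near.
have ntE : \forall q \near p0, forall i, tangent q (E i q).
  by apply: filter_forall => i; exact: (sE i).1.
have [U [oU Up0 UP]] := near_open (filterI (filterI nc nA) (filterI (filterI ntE bE)
  (det_near_neq0 sB0 Bp0))).
pose F q := invmx (B q) *m A q.
have uB q : U q -> B q \in unitmx.
  by move=> /UP[_ [_ /= dB]]; rewrite unitmxE unitfE.
have FP q : U q -> F q *m P = 1%:M.
  by move=> Uq; rewrite /F -mulmxA mulVmx//; exact: uB.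
have AF q : U q -> A q = B q *m F q.
  by move=> Uq; rewrite /F mulmxA mulmxV ?mul1mx//; exact: uB.
have sF q k a : U q -> smooth_at q (fun r => F r k a).
  move=> Uq; have [[cq sA] [_ /= dB]] := UP q Uq.
  apply: smooth_at_mulmx => // i j; apply: smooth_at_invmx => // i' j'.
  by apply: smooth_at_mulmx => // ? ?; exact: smooth_at_cst.
have DF q : U q -> D q = [set coord_vec c q (a *m F q) | a in setT].
  move=> Uq; have [[/= cq _] [[te [_ bq]] _]] := UP q Uq.
  have Eq i : E i q = coord_vec c q (row i (A q)).
    rewrite {1}(tangent_coord (te i) ac cq); congr (coord_vec _ _ _).
    by apply/rowP => a; rewrite !mxE.
  rewrite bq; apply/seteqP; split=> [_ [a ->]|_ [a _ <-]].
    exists ((\row_i a i) *m B q) => //.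
    rewrite -mulmxA -AF// coord_vec_mulmx//; apply: eq_bigr => i _.
    by rewrite mxE Eq.
  exists (fun i => (a *m invmx (B q)) ord0 i).
  rewrite /F mulmxA coord_vec_mulmx//; apply: eq_bigr => i _.
  by rewrite Eq.
exists c, U, F, P; split=> // [|q k l a Uq]; first by split=> // q /UP[[]].
have [[/= cq _] _] := UP q Uq.
pose Fv k r := coord_vec c r (row k (F r)).
have nU : \forall r \near q, U r by exact: open_nbhs_nbhs.
have Fvx k' a' : \forall r \near q, Fv k' r (coord_fun c a') = F r k' a'.
  by apply: filterS nU => r Ur; rewrite /Fv coord_vec_coord ?mxE//; have [[]] := UP r Ur.
have secF k' : section_at id D q (Fv k').
  apply/(section_atP sid); split.
    apply: (smooth_field_chart sid ac cq) => [|j].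
      by apply: filterS nU => r Ur; apply: coord_vec_tangent => //; have [[]] := UP r Ur.
    by apply: smooth_at_eq (sF q k' j Uq); apply: filterS (Fvx k' j).
  apply: filterS nU => r Ur; rewrite (DF r Ur).
  by exists (delta_mx 0 k'); [exact: I|rewrite /Fv rowE].
have := iD (secF k) (secF l); rewrite DF// => -[b _ Eb].
have tF k' : tangent q (Fv k' q) by exact: coord_vec_tangent.
have comp a' : (b *m F q) ord0 a' = Fv k q (fun r => F r l a') - Fv l q (fun r => F r k a').
  rewrite -(coord_vec_coord (b *m F q) a' ac cq) Eb /lie_bracket asboolT; last exact: coord_fun_smooth.
  by rewrite (tangent_near (tF k) (Fvx l a')) (tangent_near (tF l) (Fvx k a')).
have FP0 k' l' b' : \sum_a' Fv k' q (fun r => F r l' a') * P a' b' = 0.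
  transitivity (Fv k' q (fun r => \sum_a' F r l' a' * P a' b')).
    rewrite (tangent_sum (tF k')) => [|a']; last by apply: smooth_atM; [exact: sF|exact: smooth_at_cst].
    apply: eq_bigr => a' _; rewrite (tangentM (tF k') (sF q l' a' Uq) (smooth_at_cst q (P a' b'))).
    by rewrite (tangent_cst _ (tF k')) mulr0 addr0.
  transitivity (Fv k' q (fun=> (1%:M : 'M[R]_m) l' b')); last exact: tangent_cst (tF k').
  apply: (tangent_near (tF k')).
  by apply: filterS nU => r Ur; rewrite -(FP r Ur) mxE.
(* [b] is [b *m F q *m P], the components of the bracket times [P]; by [FP0] this is a difference of
   two derivatives of constant matrix entries. *)
have b0 : b = 0.
  rewrite -[b]mulmx1 -(FP q Uq) mulmxA; apply/rowP => b'; rewrite mxE [RHS]mxE.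
  under eq_bigr do rewrite comp mulrBl.
  by rewrite sumrB !FP0 subrr.
by apply/eqP; rewrite -subr_eq0 -comp b0 mul0mx mxE.
Qed.

End adapted_frames.

Section integral_manifolds.
Variables (R : realType) (m n : nat).

(** Since [P] inverts the frame along the flow, [Phi z *m P - z] has zero derivative on the ball and
    is constant along segments; equal values of [Phi] thus force equal arguments. *)
Lemma flow_injective (F : 'rV[R]_n -> 'M[R]_(m, n)) (P : 'M[R]_(n, m))
    (Phi : 'rV[R]_m -> 'rV[R]_n) (r : R) :
  (forall x, `|x| < r -> F (Phi x) *m P = 1%:M) ->
  (forall x, `|x| < r -> differentiable Phi x /\ forall v, 'd Phi x v = v *m F (Phi x)) ->
  forall x y, `|x| < r -> `|y| < r -> Phi x = Phi y -> x = y.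
Proof.
move=> FP dPhi x y xr yr E; apply/rowP => k.
pose h (z : 'rV[R]_m) := (Phi z *m P) ord0 k - z ord0 k.
have dh z : `|z| < r -> differentiable h z /\ forall v, 'D_v h z = 0.
  move=> zr; have [dP EP] := dPhi z zr.
  pose l := mulmxr P : {linear 'rV[R]_n -> 'rV[R]_m}.
  have cl : continuous l by exact: mulmxr_continuous.
  have dl : differentiable l (Phi z) by exact: linear_differentiable.
  have d1 : differentiable (l \o Phi) z by exact: differentiable_comp.
  have d2 : differentiable (fun z => (l \o Phi) z ord0 k) z.
    by apply: differentiable_comp d1 (differentiable_coord _ _ _).
  have d3 : differentiable (fun z : 'rV[R]_m => z ord0 k) z by exact: differentiable_coord.
  split; first exact: differentiableB.
  move=> v; rewrite deriveB; [|exact: diff_derivable|exact: diff_derivable].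
  rewrite -(diff_row _ _ d1) derive_coord diff_comp//= diff_lin//=.
  by rewrite EP -mulmxA FP// mulmx1 subrr.
have seg s : 0 <= s <= 1 -> `|x + s *: (y - x)| < r.
  move=> /andP[s0 s1]; have -> : x + s *: (y - x) = (1 - s) *: x + s *: y.
    by rewrite scalerBr scalerBl scale1r addrA addrAC.
  apply: le_lt_trans (ler_normD _ _) _; rewrite !normrZ (ger0_norm s0) ger0_norm ?subr_ge0//.
  have x0 := normr_ge0 x; have y0 := normr_ge0 y.
  have [->|sn0] := eqVneq s 0; first by rewrite subr0 mul1r mul0r addr0.
  have sp : 0 < s by rewrite lt_def sn0.
  have -> : r = (1 - s) * r + s * r by ring.
  by apply: ler_ltD; [rewrite ler_wpM2l ?subr_ge0// ltW|rewrite ltr_pM2l].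
have [s s01|c /andP[c0 c1]] := @MVT_line R _ h x (y - x) 1 ltr01.
  by apply: (dh _ _).1; exact: seg.
rewrite (dh _ _).2; last by apply: seg; rewrite !ltW.
rewrite scale1r [x + _]addrC subrK mulr0 /h E.
by move=> /eqP; rewrite subr_eq0 => /eqP /addrI /oppr_inj ->.
Qed.

Variables (M : manifold R n).

Theorem frobenius (D : M -> set (tvec M)) : distribution m D ->
  (forall p X Y, section_at id D p X -> section_at id D p Y -> D p (lie_bracket X Y p)) ->
  integrable m D.
Proof.
move=> dD iD p0.
have [c [U [F [P [[ac oU Up0 Uc] DF FP sF cF]]]]] := adapted_frame dD iD p0.
have [oc oi K ccont cinvc] := atlas_chart ac.
pose A := cfun c @` U.
have AE : A = cfun c @` (cdom c `&` U).
  by rewrite setIC (setIidl Uc).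
have oA : open A by rewrite AE; exact: chart_image_open.
pose Fk (k : 'I_m) (x : 'rV[R]_n) : 'rV[R]_n := row k (F (cinv c x)).
have sFk k a : smooth_Rn A (fun x => Fk k x ord0 a).
  have s1 : smooth_on U (fun q => F q k a) by apply/(smooth_onP _ oU) => q Uq; exact: sF.
  have := s1 c ac; rewrite -AE.
  by under [in X in _ -> X]eq_fun do rewrite mxE.
have dFk k x : A x -> differentiable (Fk k) x.
  by move=> Ax; apply: differentiable_row => a; exact: (sFk k a 1%N).1.
(* Read in the chart, the symmetry of the derivatives of the frame components is exactly the
   commutation hypothesis of the flow. *)
have cFk x : A x -> forall k l, 'd (Fk k) x (Fk l x) = 'd (Fk l) x (Fk k x).
  move=> Ax k l; apply/rowP => a; rewrite !diff_row; try exact: dFk.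
  have [q Uq Eq] := Ax; have := cF q l k a Uq.
  rewrite !coord_vecE; try exact: sF.
  have Ex k' : row k' (F q) = Fk k' x by rewrite /Fk -Eq K//; exact: Uc.
  have Ef k' : (fun r => F r k' a) \o cinv c = fun y => Fk k' y ord0 a.
    by apply/funext => y; rewrite /= mxE.
  by rewrite !Ex !Ef Eq.
have Ap0 : A (cfun c p0) by exists p0.
have [r r0 [Phi [Phi0 HPhi]]] := commuting_flow oA Ap0 (fun k i => sFk k i 2%N) cFk.
have FkE x : (\matrix_k Fk k x) = F (cinv c x).
  by apply/matrixP => k a; rewrite !mxE.
pose B := [set x : 'rV[R]_m | `|x| < r].
have oB : open B.
  have -> : B = ball (0 : 'rV[R]_m) r.
    by apply/seteqP; split=> x; rewrite -ball_normE /B/= sub0r normrN.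
  exact: ball_open.
have sPhi i : smooth_Rn B (fun x => Phi x ord0 i) by exact: (derivative_smooth oA oB sFk).
pose Psi y := Phi (squeeze r y : 'rV[R]_m).
have sPsi i : smooth_Rn setT (fun y => Psi y ord0 i).
  move=> k; apply: (@Ck_comp R m m k setT B (squeeze r) (fun x => Phi x ord0 i)) => //.
  - exact: openT.
  - by move=> j; exact: squeeze_smooth.
  - by move=> x _; exact: squeeze_lt.
  - exact: sPhi.
have APsi y : A (Psi y) by have [] := HPhi _ (squeeze_lt r0 y).
have dPsi y : differentiable Psi y.
  by apply: differentiable_row => i; exact: (sPsi i 1%N).1.
(* The diagonal entries of the differential of [squeeze]. They do not vanish, so precomposition with
   [squeeze] only rescales the frame coefficients: the differential of the leaf stays injective and
   still fills the distribution. *)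
pose sg (y : 'rV[R]_m) k := - r * expR (y ord0 k) / (1 + expR (y ord0 k)) ^+ 2.
have sg0 y k : sg y k != 0.
  apply: mulf_neq0; last by rewrite invr_eq0 expf_neq0// expR_neq0.
  by apply: mulf_neq0; [rewrite oppr_eq0 gt_eqF|rewrite gt_eqF ?expR_gt0].
pose j (y : euclidean R m) : M := cinv c (Psi y).
have Uj y : U (j y).
  by have [q Uq Eq] := APsi y; rewrite /j -Eq K//; exact: Uc.
have cj y : cfun c (j y) = Psi y.
  by have [q Uq Eq] := APsi y; rewrite /j -Eq K//; exact: Uc.
have EPsi y a : 'd Psi y a = (\row_k (a ord0 k * sg y k)) *m F (j y).
  have dsq : differentiable (squeeze r : 'rV[R]_m -> 'rV[R]_m) y.
    by apply: differentiable_row => i; apply: (squeeze_smooth r i 1%N).1.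
  have [_ dP EP] := HPhi _ (squeeze_lt r0 y).
  rewrite diff_comp//= EP FkE; congr (_ *m _); apply/rowP => k.
  by rewrite mxE diff_row// derive_squeeze.
have sj : smooth_map j.
  have cj' : continuous j.
    move=> y; apply: (@continuous_comp _ _ _ Psi (cinv c)).
      exact: differentiable_continuous.
    by apply: cinvc; have [q Uq Eq] := APsi y; exists q => //; exact: Uc.
  split=> // V f oV sf d -> k.
  have oV' : open (j @^-1` V) by apply: open_comp => // y _; exact: cj'.
  rewrite /= image_id setTI.
  apply: (@Ck_comp R m n k _ (cfun c @` (cdom c `&` V)) Psi (f \o cinv c)) => //.
  - by move=> i; apply: Ck_sub (sPsi i k).
  - by move=> y Vy; exists (j y); [split=> //; exact: Uc|exact: cj].
  - exact: sf.
pose ic : chart R m (euclidean R m) := id_chart R m.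
have dj (y : euclidean R m) a : differential j y (coord_vec ic y a) = coord_vec c (j y) ('d Psi y a).
  have ty : tangent y (coord_vec ic y a) by exists ic, a.
  have cjy : cdom c (j y) := Uc _ (Uj y).
  apply: (tangent_ext (differential_tangent sj ty) _ ac cjy) => [|b].
    exact: coord_vec_tangent.
  have sb : smooth_at (j y) (coord_fun c b) by exact: coord_fun_smooth.
  rewrite (differentialE _ sb) coord_vec_coord// coord_vecE; last exact: (smooth_map_at sj sb).
  rewrite diff_row//; congr ('D_a _ y); apply/funext => z.
  by rewrite /coord_fun /= cj.
have tE (y : euclidean R m) v : tangent y v -> exists a, v = coord_vec ic y a.
  by move=> [d [a [-> _ ->]]]; exists a.
exists (euclidean R m), j; split; last first.
  by exists (0 : 'rV[R]_m); rewrite /j /Psi squeeze0 Phi0 K//; exact: Uc.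
split.
- move=> y z jyz; apply: (squeeze_inj r0).
  apply: (@flow_injective (fun x => F (cinv c x)) P Phi r) => [x xr|x xr||| ].
  + have [[q Uq Eq] _ _] := HPhi x xr.
    by rewrite -Eq K; [exact: FP|exact: Uc].
  + by have [_ dP EP] := HPhi x xr; split=> // v; rewrite EP FkE.
  + exact: squeeze_lt.
  + exact: squeeze_lt.
  + by rewrite -[LHS]/(Psi y) -cj jyz cj.
- split=> // y v w /tE[a ->] /tE[b ->]; rewrite !dj.
  move=> /(coord_vec_inj ac (Uc _ (Uj y))); rewrite !EPsi.
  (* Multiplication by [P] recovers the frame coefficients from the image vector. *)
  move=> /(congr1 (fun A => A *m P)); rewrite -!mulmxA FP// !mulmx1 => /rowP E.
  congr (coord_vec _ _ _); apply/rowP => k; have := E k; rewrite !mxE.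
  exact: (mulIf (sg0 y k)).
- move=> y; rewrite DF//; apply/seteqP; split=> [_ [v /tE[a ->] <-]|_ [b _ <-]].
    by rewrite dj EPsi; exists (\row_k (a ord0 k * sg y k)).
  exists (coord_vec ic y (\row_k (b ord0 k / sg y k))).
    by exists ic, (\row_k (b ord0 k / sg y k)).
  rewrite dj EPsi; suff -> : \row_k ((\row_l (b ord0 l / sg y l)) ord0 k * sg y k) = b by [].
  by apply/rowP => k; rewrite !mxE divfK.
Qed.

End integral_manifolds.

(** * Connections on the leaves *)

Section restricted_connections.
Variables (R : realType) (m n : nat) (M : manifold R n) (g : metric_field M).
Variables (D : M -> set (tvec M)) (L : manifold R m) (j : L -> M).
Hypotheses (bg : smooth_bilinear g) (dD : distribution m D) (nD : nondegenerate_on D g).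
Hypothesis Hj : integral_manifold D j.

(** The differential of [j] maps each tangent space of [L] injectively onto the fibre of [D], where
    [g] is non-degenerate; so the leaf carries a genuine metric although [g] itself may be
    degenerate. *)
Lemma integral_manifold_tensor : metric_tensor (induced_metric j g).
Proof.
have [_ [sj ij] DE] := Hj; have bL := induced_bilinear sj bg.
split=> [p v w|p a u v w|U X Y oU vX vY|p v tv v0].
- exact: (bilinear_sym bL).
- exact: (bilinear_linear bL).
- apply/(smooth_onP _ oU) => p Up; apply: (bilinear_smooth bL).
    by have /(field_alongP (smooth_map_id L) _ oU) := vX; apply.
  by have /(field_alongP (smooth_map_id L) _ oU) := vY; apply.
- apply: (ij p) => //; first exact: tangent0.
  rewrite (nD (p := j p) (v := differential j p v)).
  + by rewrite -[X in differential j p X](scale0r (0 : tvec L)) differentialZ scale0r.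
  + by rewrite -DE; exists v.
  + by move=> w; rewrite -DE => -[u tu <-]; exact: v0.
Qed.

(** The hypotheses involve sections of [D] alone, since the axioms for [nabS] cover nothing else.
    Metricity is the duality of pullbacks with both connections equal; the torsion identity is
    obtained after applying the differential of [j], which is injective. *)
Lemma restricted_levi_civita (nabS : conn_op M M) (nabL : conn_op L L) :
  connection id D nabS ->
  (forall p X Y, section_at id D p X -> section_at id D p Y ->
     nabS p (X p) Y - nabS p (Y p) X = lie_bracket X Y p) ->
  (forall p X Y Z, section_at id D p X -> section_at id D p Y -> section_at id D p Z ->
     X p (fun q => g q (Y q) (Z q)) = g p (nabS p (X p) Y) (Z p) + g p (Y p) (nabS p (X p) Z)) ->
  restricted_connection j D nabS nabL ->
  levi_civita (induced_metric j g) nabL.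
Proof.
move=> cS tf mS [cL [nabj pj HL]]; have [_ [sj ij] DE] := Hj.
have sL := smooth_map_id L.
have Dj p v : tangent p v -> D (j p) (differential j p v) by move=> tv; rewrite -DE; exists v.
have DjX p X : smooth_field_at id p X -> \forall q \near p, D (j q) (differential j q (X q)).
  by move=> [tX _]; apply: filterS tX => q; exact: Dj.
have secL p X : smooth_field_at id p X -> section_at id (@tangent R m L) p X.
  by move=> sX; apply/(section_atP sL); split=> //; case: sX.
have secj p X : smooth_field_at id p X -> section_at j D p (fun q => differential j q (X q)).
  move=> sX; apply/(section_atP sj); split; first exact: smooth_field_differential.
  exact: DjX.
have tL p v X : tangent p v -> smooth_field_at id p X -> tangent p (nabL p v X).
  by move=> tv sX; exact: (connection_value sL cL tv (secL _ _ sX)).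
split=> //; first exact: integral_manifold_tensor.
- apply: torsion_free_from_at => p X Y sX sY.
  have tX : tangent p (X p) := nbhs_singleton sX.1.
  have tY : tangent p (Y p) := nbhs_singleton sY.1.
  have := pullback_torsion sj dD cS pj tf sX sY (DjX _ _ sX) (DjX _ _ sY).
  rewrite -(HL p _ _ tX (secL _ _ sY)) -(HL p _ _ tY (secL _ _ sX)) -differential_sub.
  apply: (ij p); last exact: bracket_tangent.
  by apply: tangent_sub; exact: tL.
- apply: metric_connection_from_at => p v Y Z tv sY sZ.
  have := pullback_duality sj dD bg cS cS pj pj mS tv (Dj _ _ tv) (secj _ _ sY) (secj _ _ sZ).
  by rewrite -(HL p _ _ tv (secL _ _ sY)) -(HL p _ _ tv (secL _ _ sZ)).
Qed.

(** The pullback [nabj] is tied to the connection on [D] only through values on sections of [D], so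
    the same [nabj] witnesses both restrictions. *)
Lemma restricted_connection_congr (nabS nabS' : conn_op M M) (nabL : conn_op L L) :
  (forall p v Z, tangent p v -> section_at id D p Z -> nabS' p v Z = nabS p v Z) ->
  restricted_connection j D nabS' nabL -> restricted_connection j D nabS nabL.
Proof.
have [_ [sj ij] DE] := Hj.
move=> E [cL [nabj [cj pj] HL]]; split=> //; exists nabj => //; split=> // p v Z tv sZ.
by rewrite pj// E//; exact: differential_tangent.
Qed.

End restricted_connections.

(** * Integrability of the screen and the connections on its leaves *)

Theorem corollary3p9 (R : realType) (m : nat)
    (Mbar : manifold R m.+2) (gbar : metric_field Mbar)
    (nabbar nabbars : conn_op Mbar Mbar)
    (M : manifold R m.+1) (i : M -> Mbar) (ST : M -> set (tvec M))
    (nab nabs nabS nabsS : conn_op M M)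
    (Hstat : statistical_manifold gbar nabbar nabbars)
    (Hlight : lightlike_hypersurface gbar i)
    (Hscreen : screen_distribution (induced_metric i gbar) ST)
    (Hnab : induced_connection gbar i ST nabbar nab)
    (Hnabs : induced_connection gbar i ST nabbars nabs)
    (HnabS : induced_screen_connection (induced_metric i gbar) ST nab nabS)
    (HnabsS : induced_screen_connection (induced_metric i gbar) ST nabs nabsS)
    (Rad_par : parallel (Rad (induced_metric i gbar)) nab)
    (Rad_pars : parallel (Rad (induced_metric i gbar)) nabs)
    (S_par : parallel ST nab)
    (S_pars : parallel ST nabs)
    (Hmetric : metric_connection (induced_metric i gbar) nab) :
  integrable m ST /\
  forall (L : manifold R m) (j : L -> M), integral_manifold ST j ->
    (forall nabL : conn_op L L, restricted_connection j ST nabS nabL ->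
       levi_civita (induced_metric j (induced_metric i gbar)) nabL) /\
    (forall nabL : conn_op L L, restricted_connection j ST nabsS nabL ->
       levi_civita (induced_metric j (induced_metric i gbar)) nabL).
Proof.
have ii := Hlight.1; have sid := smooth_map_id M.
have bgbar := metric_tensor_bilinear (stat_metric Hstat).1.
have bg := induced_bilinear ii.1 bgbar.
have dS := screen_distr Hscreen.
have tf : torsion_free nab.
  exact: (induced_torsion_free ii bgbar (stat_connection Hstat) (stat_torsion_free Hstat) Hnab).
split.
  by apply: frobenius => // p X Y; exact: (screen_involutive Hscreen S_par tf).
move=> L j Hj.
have ES p v W : tangent p v -> section_at id ST p W -> nabS p v W = nab p v W.
  exact: (screen_connection_eq ii bgbar Hscreen S_par HnabS).
(* Each screen connection agrees with its induced connection on screen sections, and those two agree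
   with each other there; a single Levi-Civita computation, for [nabS], then settles both claims. *)
have EsS p v W : tangent p v -> section_at id ST p W -> nabsS p v W = nabS p v W.
  move=> tv sW; rewrite ES// (screen_connection_eq ii bgbar Hscreen S_pars HnabsS tv sW).
  exact: (dual_screen_eq ii bgbar Hscreen Hstat Hnab Hnabs S_par S_pars Hmetric tv sW).
have sec p X : section_at id ST p X -> smooth_field_at id p X /\ tangent p (X p).
  by move=> /(section_atP sid)[sX DX]; split=> //; exact: nbhs_singleton sX.1.
have LC (nabL : conn_op L L) : restricted_connection j ST nabS nabL ->
    levi_civita (induced_metric j (induced_metric i gbar)) nabL.
  apply: (restricted_levi_civita bg dS (screen_nondegenerate Hscreen) Hj HnabS.1).
    move=> p X Y secX secY; have [sX tX] := sec _ _ secX; have [sY tY] := sec _ _ secY.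
    by rewrite !ES//; exact: (torsion_free_at tf).
  move=> p X Y Z secX secY secZ; have [_ tX] := sec _ _ secX.
  rewrite !ES//; apply: (metric_connection_at Hmetric) => //; [exact: (sec _ _ secY).1|exact: (sec _ _ secZ).1].
split=> // nabL rL; apply: LC.
exact: (restricted_connection_congr Hj EsS rL).
Qed.
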